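(* Let $\xi=\{\xi(t),t\in\mathbb{R}\}$ be a real-valued, measurable, mean-square continuous stationary Gaussian process with $E\xi(t)=0$, $E\xi^2(t)=1$ and covariance function $$B(t)=E[\xi(0)\xi(t)]=\sum_{j=0}^{\kappa}D_j\frac{\cos(\varkappa_j t)}{(1+t^2)^{\alpha_j/2}},\quad t\in\mathbb{R},$$ where $\kappa\ge 0$ is an integer, $D_j\ge 0$, $\sum_{j=0}^{\kappa}D_j=1$, $0\le\varkappa_0<\varkappa_1<\dots<\varkappa_\kappa$ and $\alpha_j>0$ for all $j$. Let $G:\mathbb{R}\to\mathbb{R}$ be a non-random measurable function with $E\,G(\xi(0))=0$, $E\,G^4(\xi(0))<\infty$ and Hermite rank $m\ge 1$, and let $\varepsilon(t)=G(\xi(t))$. Consider the regression model $x(t)=g(t,\theta)+\varepsilon(t)$, $t\in[0,T]$, where $\Theta\subset\mathbb{R}^q$ is open with closure $\Theta^c$, $\theta\in\Theta$ is the true parameter and $g:\mathbb{R}\times\Theta^c\to\mathbb{R}$ is continuous. Let $\hat\theta_T$ be the least-squares estimate of $\theta$ and let $\hat w_T=T^{-1/2}d_T(\theta)(\hat\theta_T-\theta)$ be the normed least-squares estimate. Assume (with the notation of the context): (1) $g(t,\tau)$ is twice differentiable with respect to $\tau\in\Theta^c$; (2) $\liminf_{T\to\infty}T^{-1}d_{iT}^2(\theta)>0$ for $i=1,\dots,q$; (3) for every $R\ge 0$ there are positive constants $k^i(R),k^{il}(R),\tilde k^{il}(R)$ such that for all sufficiently large $T>T_0(R)$ and all $i,l=1,\dots,q$,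 $$\sup_{t\in[0,T]}\sup_{u\in V^c(R)}\frac{|h_i(t,u)|}{d_{iT}(\theta)}\le k^i(R)T^{-1/2},\quad \sup_{t\in[0,T]}\sup_{u\in V^c(R)}\frac{|h_{il}(t,u)|}{d_{il,T}(\theta)}\le k^{il}(R)T^{-1/2},\quad \frac{d_{il,T}(\theta)}{d_{iT}(\theta)d_{lT}(\theta)}\le\tilde k^{il}(R)T^{-1/2};$$ (4) for some $\lambda_*>0$ and $T_0$, $\lambda_{\min}(J_T(\theta))\ge\lambda_*$ for all $T>T_0$; (5) for some $\tau_0>0$ there are positive constants $\tilde k^i(\tau_0)$, $\bar k^{il}(\tau_0)$, $\hat k_{il}(\tau_0)$ such that for all sufficiently large $T$ and all $i,l=1,\dots,q$, $$\sup_{t\in[0,T]}\sup_{w\in V^c(\tau_0)}\frac{|f_i(t,w)|}{d_{iT}(\theta)}\le\tilde k^i(\tau_0)T^{-1/2},\qquad \sup_{t\in[0,T]}\sup_{w\in V^c(\tau_0)}\frac{|f_{il}(t,w)|}{d_{il,T}(\theta)}\le\bar k^{il}(\tau_0)T^{-1/2},$$ $$\sup_{w\in V^c(\tau_0),\,w\ne0}T\,d_{iT}^{-2}(\theta)\,d_{lT}^{-2}(\theta)\,\Phi_{il,T}(w,0)\,\|w\|^{-2}\le\hat k_{il}(\tau_0);$$ (6) for any $r>0$, $P\{\|\hat w_T\|>r\}\to0$ as $T\to\infty$. Then, with probability tending to $1$ as $T\to\infty$, the normed least-squares estimate $\hat w_T$ is the unique solution of the system of equations $\mathbf{M}_T(w)=0$,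 where $$\mathbf{M}_T(w)=\left(\frac{\partial}{\partial w_i}\Bigl(\tfrac12Q_T(\theta+T^{1/2}d_T^{-1}(\theta)w)\Bigr)\right)_{i=1}^q=\left(T^{-1/2}\int_0^T[x(t)-f(t,w)]\frac{-f_i(t,w)}{d_{iT}(\theta)}dt\right)_{i=1}^q .$$
   Context: Notation. $g_i(t,\tau)=\partial g(t,\tau)/\partial\tau_i$, $g_{il}(t,\tau)=\partial^2g(t,\tau)/\partial\tau_i\partial\tau_l$; $d_{iT}^2(\tau)=\int_0^Tg_i^2(t,\tau)dt$, $d_T(\tau)=\mathrm{diag}(d_{iT}(\tau))_{i=1}^q$, $d_{il,T}^2(\tau)=\int_0^Tg_{il}^2(t,\tau)dt$ (all $d$'s non-negative). $h_i(t,u)=g_i(t,\theta+d_T^{-1}(\theta)u)$, $h_{il}(t,u)=g_{il}(t,\theta+d_T^{-1}(\theta)u)$. $f(t,w)=g(t,\theta+T^{1/2}d_T^{-1}(\theta)w)$, $f_i(t,w)=g_i(t,\theta+T^{1/2}d_T^{-1}(\theta)w)$, $f_{il}(t,w)=g_{il}(t,\theta+T^{1/2}d_T^{-1}(\theta)w)$, and $\Phi_{il,T}(w,0)=\int_0^T(f_{il}(t,w)-f_{il}(t,0))^2dt$. $V^c(R)=\{u\in\mathbb{R}^q:\|u\|\le R\}$. It is understood that the arguments occurring lie in $\Theta^c$ for the indicated $T$, $u$, $w$. $J_T(\theta)=(J_{il,T}(\theta))_{i,l=1}^q$ with $J_{il,T}(\theta)=d_{iT}^{-1}(\theta)d_{lT}^{-1}(\theta)\int_0^Tg_i(t,\theta)g_l(t,\theta)dt$,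 and $\lambda_{\min}$ is the minimal eigenvalue. An inequality of the form $|a|/d\le c$ with $d\ge0$ is understood as $|a|\le c\,d$. Least-squares estimate: any random vector $\hat\theta_T\in\Theta^c$ with $Q_T(\hat\theta_T)=\inf_{\tau\in\Theta^c}Q_T(\tau)$, where $Q_T(\tau)=\frac1T\int_0^T[x(t)-g(t,\tau)]^2dt$. Hermite rank: with $\varphi(x)=(2\pi)^{-1/2}e^{-x^2/2}$ and Hermite polynomials $H_k(x)=(-1)^ke^{x^2/2}\frac{d^k}{dx^k}e^{-x^2/2}$, put $C_k=\int_{\mathbb{R}}G(x)H_k(x)\varphi(x)dx$. The Hermite rank of $G$ is $m$ if $C_m\ne0$ and $C_k=0$ for $1\le k<m$.
   Formalization: Uniqueness, and the identity of M_T with the gradient, are asserted only on a fixed ball ‖w‖ ≤ r0 with 0 < r0 ≤ τ0 independent of T; global uniqueness fails, e.g. g(t,τ)=τ+τ², Θ=(−0.9,1), θ=0, where M_T(−1/2)=0 always. *)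

(* Defs.v *)
From HB Require Import structures.
From mathcomp Require Import all_boot all_order all_algebra.
From mathcomp Require Import all_classical all_reals all_analysis.
Import Order.TTheory GRing.Theory Num.Theory.
Import numFieldNormedType.Exports.

Set Implicit Arguments.
Unset Strict Implicit.
Unset Printing Implicit Defensive.

Local Open Scope classical_set_scope.
Local Open Scope ring_scope.

Section Euclidean.
Variables (R : realType) (q : nat).

(* The library norm on 'rV[R]_q is the max-norm. *)
Definition enorm (u : 'rV[R]_q) : R := Num.sqrt (\sum_(i < q) u 0 i ^+ 2).

Definition eball (r : R) : set 'rV[R]_q := [set u | enorm u <= r].

(* For a symmetric real matrix of positive size the infimum is attained. *)
Definition lambda_min (A : 'M[R]_q) : R := inf [set a | eigenvalue A a].

(* Fréchet differentiability at x relative to A, so that it makes sense at the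
   boundary points of a closed A.  At interior points of A this is ordinary
   differentiability and D is the vector of partial derivatives; at a boundary
   point where the gradient relative to A is not unique, D is any of them. *)
Definition has_gradient (A : set 'rV[R]_q) (f : 'rV[R]_q -> R)
    (x : 'rV[R]_q) (D : 'I_q -> R) : Prop :=
  forall e : R, 0 < e -> \forall y \near x, A y ->
    `|f y - f x - \sum_(i < q) D i * (y 0 i - x 0 i)| <= e * enorm (y - x).

Definition twice_differentiable_on (A : set 'rV[R]_q) (f : 'rV[R]_q -> R)
    (f1 : 'I_q -> 'rV[R]_q -> R) (f2 : 'I_q -> 'I_q -> 'rV[R]_q -> R) : Prop :=
  forall x, A x ->
    has_gradient A f x (fun i => f1 i x) /\
    forall i, has_gradient A (f1 i) x (fun l => f2 i l x).

End Euclidean.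

Section Process.
Context (d : measure_display) (Omega : measurableType d) (R : realType).
Variable P : probability Omega R.
Implicit Types (xi : R -> Omega -> R).

(* A constant random variable (s = 0) is Gaussian; normal_prob m 0 is not the
   Dirac measure at m, hence the case distinction. *)
Definition gaussian_rv (X : Omega -> R) : Prop :=
  exists m s : R, 0 <= s /\
    forall A : set (measurableTypeR R), measurable A ->
      P (X @^-1` A) = if s == 0 then \d_m A else normal_prob m s A.

Definition gaussian_process xi : Prop :=
  forall (n : nat) (a t : 'I_n -> R),
    gaussian_rv (fun w => \sum_(i < n) a i * xi (t i) w).

Definition measurable_process xi : Prop :=
  measurable_fun [set: (measurableTypeR R * Omega)%type]
    (fun p : (measurableTypeR R * Omega)%type => xi p.1 p.2).

(* Equality of finite-dimensional distributions, tested on rectangles. *)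
Definition stationary_process xi : Prop :=
  forall (n : nat) (t : 'I_n -> R) (h : R)
         (A : 'I_n -> set (measurableTypeR R)),
    (forall i, measurable (A i)) ->
    P [set w | forall i, A i (xi (t i + h) w)] =
    P [set w | forall i, A i (xi (t i) w)].

Definition ms_continuous xi : Prop :=
  forall t : R,
    ('E_P[fun w => ((xi s w - xi t w) ^+ 2)%R])%E @[s --> t] --> 0%E.

Definition random_vector (q : nat) (X : Omega -> 'rV[R]_q) : Prop :=
  forall i, measurable_fun [set: Omega] (fun w => X w 0 i).

(* Inner-probability form, as measurability of E T is not assumed; for
   measurable E T it says P (E T) --> 1. *)
Definition with_probability_tending_to_1 (E : R -> set Omega) : Prop :=
  exists A : R -> set Omega,
    [/\ forall T, measurable (A T),
        forall T, A T `<=` E T &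
        P (A T) @[T --> +oo%R] --> 1%E].

End Process.

Section Hermite.
Variable R : realType.

Definition std_normal_density (x : R) : R :=
  (Num.sqrt (2 * pi))^-1 * expR (- (x ^+ 2 / 2)).

Definition hermite_poly (k : nat) (x : R) : R :=
  (-1) ^+ k * expR (x ^+ 2 / 2) *
  derive1n k (fun y : R => expR (- (y ^+ 2 / 2))) x.

Definition hermite_coef (G : R -> R) (k : nat) : R :=
  \int[lebesgue_measure]_x (G x * hermite_poly k x * std_normal_density x).

Definition hermite_rank (G : R -> R) (m : nat) : Prop :=
  hermite_coef G m != 0 /\
  forall k, (1 <= k < m)%N -> hermite_coef G k = 0.

End Hermite.

Definition cyclic_covariance (R : realType) (kappa : nat)
    (D vk alpha : 'I_kappa.+1 -> R) (t : R) : R :=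
  \sum_(j < kappa.+1)
    D j * (cos (vk j * t) / (1 + t ^+ 2) `^ (alpha j / 2)).

Section Regression.
Variables (R : realType) (q : nat).
Variables (g : R -> 'rV[R]_q -> R) (g1 : 'I_q -> R -> 'rV[R]_q -> R)
  (g2 : 'I_q -> 'I_q -> R -> 'rV[R]_q -> R).
Implicit Types (T : R) (tau : 'rV[R]_q).

Definition dT1 T tau (i : 'I_q) : R :=
  Num.sqrt (\int[lebesgue_measure]_(t in `[0, T]) (g1 i t tau ^+ 2)).

Definition dT2 T tau (i l : 'I_q) : R :=
  Num.sqrt (\int[lebesgue_measure]_(t in `[0, T]) (g2 i l t tau ^+ 2)).

Variable theta : 'rV[R]_q.

(* theta + d_T^{-1}(theta) u *)
Definition upoint T (u : 'rV[R]_q) : 'rV[R]_q :=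
  \row_i (theta 0 i + (dT1 T theta i)^-1 * u 0 i).

(* theta + T^{1/2} d_T^{-1}(theta) w *)
Definition wpoint T (w : 'rV[R]_q) : 'rV[R]_q :=
  \row_i (theta 0 i + Num.sqrt T * (dT1 T theta i)^-1 * w 0 i).

Definition Phi T (i l : 'I_q) (w : 'rV[R]_q) : R :=
  \int[lebesgue_measure]_(t in `[0, T])
    ((g2 i l t (wpoint T w) - g2 i l t (wpoint T 0)) ^+ 2).

Definition JT T : 'M[R]_q :=
  \matrix_(i, l) ((dT1 T theta i)^-1 * (dT1 T theta l)^-1 *
    \int[lebesgue_measure]_(t in `[0, T]) (g1 i t theta * g1 l t theta)).

(* Extended-real valued: a path of x need not be square integrable on [0, T]
   for every elementary outcome. *)
Definition QT (x : R -> R) T tau : \bar R :=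
  ((T^-1)%:E * \int[lebesgue_measure]_(t in `[0%R, T])
     ((x t - g t tau) ^+ 2)%:E)%E.

(* The closed form of the gradient in w of QT x T (wpoint T w) / 2. *)
Definition MT (x : R -> R) T (w : 'rV[R]_q) : 'rV[R]_q :=
  \row_i ((Num.sqrt T)^-1 * \int[lebesgue_measure]_(t in `[0, T])
    ((x t - g t (wpoint T w)) *
     (- g1 i t (wpoint T w) / dT1 T theta i))).

(* T^{-1/2} d_T(theta) (tau - theta) *)
Definition normed_estimate T tau : 'rV[R]_q :=
  \row_i ((Num.sqrt T)^-1 * dT1 T theta i * (tau 0 i - theta 0 i)).

End Regression.

Definition least_squares_estimate (d : measure_display)
    (Omega : measurableType d) (R : realType) (q : nat)
    (g : R -> 'rV[R]_q -> R) (Theta : set 'rV[R]_q)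
    (x : R -> Omega -> R) (hat : R -> Omega -> 'rV[R]_q) : Prop :=
  forall T : R, 0 < T ->
    random_vector (hat T) /\
    forall w : Omega, closure Theta (hat T w) /\
      QT g (x^~ w) T (hat T w) =
      ereal_inf [set QT g (x^~ w) T tau | tau in closure Theta].

(* Main.v *)
Require Import Defs.
From HB Require Import structures.
From mathcomp Require Import all_boot all_order all_algebra.
From mathcomp Require Import all_classical all_reals all_analysis.
From mathcomp Require Import measurable_realfun ring lra.
Import Order.TTheory GRing.Theory Num.Theory.
Import numFieldNormedType.Exports.

(** In the normed variable w the regression function f t w has first and second
    partial derivatives that are bounded on the ball of radius tau0, uniformly in
    T. Half the gradient of the criterion is then
    M i w = - average ((x - f) f_i), and its Jacobian is
    average (f_i f_l) - average ((x - f) f_il). At w = 0 the first average is the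
    information matrix J_T, whose least eigenvalue is at least lambda. On a ball
    of small radius r0 the Jacobian differs from J_T by at most a constant times
    r0, the constant involving the average of the squared noise, plus the averages
    of the noise against the functions f_il at w = 0 ([hessian_near]). Once this
    error is below lambda, the quadratic form of the Jacobian vanishes in no
    direction anywhere in the ball, and Rolle's theorem on the segment joining two zeros of M
    shows that they coincide ([half_gradient_unique]). On the event that the
    normed estimate lies in that ball, it is an interior minimizer of the
    criterion, hence a zero of M ([MT_what]). Consistency is a hypothesis, so only
    the two noise averages have to be controlled in probability.

    Both are instances of a weighted law of large numbers: for every Borel H with
    H (xi 0) integrable and all measurable weights bounded by 1, the weighted time
    average of H (xi t) - E H (xi 0) tends to 0 in probability
    ([lln_integrable]). It is applied to H = G with weights proportional to f_il,
    and to H = G^2 with weight 1. As only a first moment of H is at hand, the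
    proof goes through a dense class: the functions H for which the law holds form
    a linear space closed in L1 of the law of xi 0 ([lln_approx]), and cosines
    belong to it, because the covariance of cos (u xi s + b) and cos (u xi t + b)
    is an explicit continuous function of B (t - s), which vanishes at infinity
    ([process_cos_cov], [lln_cos]). Finally, a linear L1-closed class that
    contains all cosines contains all integrable functions ([trig_total]).

    The cosine transform of a centred Gaussian variable, on which the covariance
    computation rests, is obtained from the differential equation that Stein's
    identity gives for it ([normal_ibp], [normal_cos], [gaussian_cos]). *)

Set Implicit Arguments.
Unset Strict Implicit.
Unset Printing Implicit Defensive.

Local Open Scope classical_set_scope.
Local Open Scope ring_scope.

(** * Real-valued integrands *)

Section RealIntegrable.
Context d (T : measurableType d) (R : realType).
Variables (mu : {measure set T -> \bar R}) (D : set T).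
Hypothesis mD : measurable D.
Implicit Types f g : T -> R.

(* Restatements of the extended-real lemmas for integrands of the form
   [EFin \o (fun x => _)] without a nested composition, so that they apply
   backwards. *)
Lemma integrableDr f g : mu.-integrable D (EFin \o f) ->
  mu.-integrable D (EFin \o g) -> mu.-integrable D (EFin \o (fun x => f x + g x)).
Proof. exact: integrableD. Qed.

Lemma integrableBr f g : mu.-integrable D (EFin \o f) ->
  mu.-integrable D (EFin \o g) -> mu.-integrable D (EFin \o (fun x => f x - g x)).
Proof. by move=> f1 g1; have := integrableB mD f1 g1; apply: eq_integrable. Qed.

Lemma integrable_scale k f : mu.-integrable D (EFin \o f) ->
  mu.-integrable D (EFin \o (fun x => k * f x)).
Proof. exact: integrableZl. Qed.

Lemma integrable_measurable f : mu.-integrable D (EFin \o f) -> measurable_fun D f.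
Proof. by case/integrableP => /measurable_EFinP. Qed.

Lemma integrable_dom f g : measurable_fun D f -> mu.-integrable D (EFin \o g) ->
  (forall x, D x -> `|f x| <= g x) -> mu.-integrable D (EFin \o f).
Proof.
move=> mf ig fg; apply: le_integrable ig => //; first exact/measurable_EFinP.
move=> x Dx /=; rewrite lee_fin; apply: (le_trans (fg x Dx)).
exact: ler_norm.
Qed.

Lemma integrable_sumr (n : nat) (f : 'I_n -> T -> R) :
  (forall i, mu.-integrable D (EFin \o f i)) ->
  mu.-integrable D (EFin \o (fun x => \sum_(i < n) f i x)).
Proof.
elim: n f => [|n IH] f H.
  have := integrable0 mu D; apply: eq_integrable => // x _ /=.
  by rewrite big_ord0.
have := integrableDr (IH _ (fun i => H (widen_ord (leqnSn n) i))) (H ord_max).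
by apply: eq_integrable => // x _ /=; rewrite big_ord_recr.
Qed.

Lemma Rintegral_sum (n : nat) (f : 'I_n -> T -> R) :
  (forall i, mu.-integrable D (EFin \o f i)) ->
  \int[mu]_(x in D) (\sum_(i < n) f i x) = \sum_(i < n) \int[mu]_(x in D) f i x.
Proof.
elim: n f => [|n IH] f H.
  rewrite big_ord0 /Rintegral; under eq_integral do rewrite big_ord0.
  by rewrite integral0.
rewrite big_ord_recr/= -IH//.
rewrite -RintegralD//; last exact: integrable_sumr.
by apply: eq_Rintegral => x _; rewrite big_ord_recr.
Qed.

End RealIntegrable.

(** * Trigonometric functions are total in L1 of a probability on the line *)

Lemma cvge0_lt (R : realType) (X : choiceType) (F : set_system X)
    {FF : ProperFilter F} (u : X -> \bar R) (e : R) :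
  u x @[x --> F] --> 0%E -> 0 < e -> \forall x \near F, (u x < e%:E)%E.
Proof.
move=> /fine_cvgP[fu cu] e0.
have {}cu := cvgr_lt _ cu _ e0.
by near=> n; rewrite -[u n]fineK ?lte_fin; [near: n; exact: cu|near: n; exact: fu].
Unshelve. all: by end_near. Qed.

Section TrigTotal.
Context (R : realType).

Lemma bernoulli_sub (u : R) (N : nat) : 0 <= u <= 1 ->
  1 - N%:R * u <= (1 - u) ^+ N.
Proof.
move=> /andP[u0 u1]; elim: N => [|N IH]; first by rewrite mul0r subr0 expr0.
rewrite exprS.
have h : 0 <= (1 - u) by lra.
have N0 : 0 <= N%:R :> R by [].
apply: (@le_trans _ _ ((1 - u) * (1 - N%:R * u))); last by rewrite ler_wpM2l.
rewrite -natr1; nra.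
Qed.

Lemma exp_compl_le (u : R) (N : nat) : 0 <= u <= 1 ->
  (1 - u) ^+ N <= (1 + N%:R * u)^-1.
Proof.
move=> /andP[u0 u1].
have N0 : 0 <= N%:R * u :> R by rewrite mulr_ge0.
rewrite -[leRHS]div1r ler_pdivlMr; last by lra.
elim: N {N0} => [|N IH]; first by rewrite mul0r addr0 expr0 mulr1.
have N0 : 0 <= N%:R :> R by [].
apply: le_trans IH; rewrite exprSr -mulrA ler_wpM2l ?exprn_ge0//; first by lra.
rewrite -natr1; nra.
Qed.

Lemma cvg_nat_geometric (q : R) : 0 <= q < 1 ->
  (fun n : nat => n%:R * q ^+ n) @ \oo --> (0 : R).
Proof.
move=> /andP[q0 q1].
set p := Num.sqrt q.
have p0 : 0 <= p by rewrite sqrtr_ge0.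
have p1 : p < 1 by rewrite -sqrtr1 ltr_sqrt.
have qE : q = p * p by rewrite -expr2 sqr_sqrtr.
have H n : n%:R * q ^+ n <= (1 - p)^-1 * p ^+ n.
  rewrite qE exprMn mulrA ler_wpM2r ?exprn_ge0//.
  have := @exp_compl_le (1 - p) n; rewrite subKr => /(_ _)/le_trans H.
  have d0 : 0 < 1 - p by lra.
  have N0 : 0 <= n%:R * (1 - p) :> R by rewrite mulr_ge0// ltW.
  apply: (@le_trans _ _ (n%:R * (1 + n%:R * (1 - p))^-1)).
    rewrite ler_wpM2l//; apply: H => //; lra.
  rewrite ler_pdivrMr; last by lra.
  rewrite mulrDr mulr1 mulrCA mulVf ?mulr1 ?gt_eqF// lerDr invr_ge0; exact: ltW.
apply: (@squeeze_cvgr _ _ _ _ (fun=> 0) (fun n => (1 - p)^-1 * p ^+ n)).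
- by apply: nearW => n; rewrite H mulr_ge0// exprn_ge0.
- exact: cvg_cst.
- rewrite -[X in _ --> X](mulr0 (1 - p)^-1); apply: cvgM; first exact: cvg_cst.
  by apply: cvg_expr; rewrite ger0_norm.
Qed.

(** A power of 1 - y^n that is a polynomial in y and still detects y < 1/2:
    with N = n 2^n factors, N y^n = n (2y)^n tends to 0 or is at least n, and
    Bernoulli's inequality bounds (1 - y^n)^N from both sides by functions of
    N y^n. *)
Lemma cvg_step (y : R) : 0 <= y <= 1 ->
  (fun n : nat => (1 - y ^+ n) ^+ (n * 2 ^ n)) @ \oo --> ((y < 2^-1)%R%:R : R).
Proof.
move=> /andP[y0 y1].
have yn n : 0 <= y ^+ n <= 1 by rewrite exprn_ge0// exprn_ile1.
have E n : (n * 2 ^ n)%:R * y ^+ n = n%:R * (2 * y) ^+ n :> R.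
  by rewrite natrM natrX exprMn mulrA.
case: ltP => [yh|yh].
- apply: (@squeeze_cvgr _ _ _ _ (fun n => 1 - n%:R * (2 * y) ^+ n) (fun=> 1)).
  + apply: nearW => n; rewrite -E bernoulli_sub//=.
    by have /andP[? ?] := yn n; rewrite exprn_ile1//; lra.
  + rewrite -[X in _ --> X]subr0; apply: cvgB; first exact: cvg_cst.
    by apply: cvg_nat_geometric; apply/andP; split; lra.
  + exact: cvg_cst.
- apply: (@squeeze_cvgr _ _ _ _ (fun=> 0) (fun n : nat => n.+1%:R^-1)).
  + apply: nearW => n; have /andP[? ?] := yn n.
    apply/andP; split; first by rewrite exprn_ge0//; lra.
    apply: (le_trans (@exp_compl_le _ (n * 2 ^ n) (yn n))); rewrite E.
    have : 1 <= (2 * y) ^+ n by rewrite exprn_ege1//; lra.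
    move=> h; rewrite lef_pV2 ?posrE//; last first.
      by rewrite ltr_pwDl// mulr_ge0// (le_trans _ h).
    by rewrite -natr1 addrC lerD2l ler_peMr.
  + exact: cvg_cst.
  + exact: cvg_harmonic.
Qed.

Variable mu : probability (measurableTypeR R) R.
(* [S] is any class of functions that is linear and closed in L1 and that
   contains the trigonometric functions. *)
Variable S : set (R -> R).
Hypothesis S_lin : forall (a : R) f h, S f -> S h -> S (fun x => a * f x + h x).
Hypothesis S_cos : forall s b, S (fun x => cos (s * x + b)).
Hypothesis S_L1 : forall f, mu.-integrable [set: _] (EFin \o f) ->
  (forall e : R, 0 < e -> exists2 h, S h & (\int[mu]_x `|f x - h x|%:E < e%:E)%E) ->
  S f.

Let S_1 : S (fun=> 1).
Proof.
have := S_cos 0 0; congr (S _); apply/funext => x.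
by rewrite mul0r addr0 cos0.
Qed.

Let S_0 : S (fun=> 0).
Proof.
by have := S_lin (-1) S_1 S_1; congr (S _); apply/funext => x; lra.
Qed.

Let S_bounded_cvg (h : nat -> R -> R) f : (forall n, S (h n)) ->
  (forall n, measurable_fun [set: measurableTypeR R] (h n)) ->
  (forall n x, `|h n x| <= 1) -> (forall x, h n x @[n --> \oo] --> f x) -> S f.
Proof.
move=> Sh mh h1 hf.
have mf : measurable_fun [set: measurableTypeR R] f.
  by apply: (measurable_fun_cvg mh) => x _; exact: hf.
have [] := @dominated_convergence _ _ _ mu setT measurableT
  (fun n => EFin \o h n) (EFin \o f) (cst 1%E).
- by move=> n; apply/measurable_EFinP.
- exact/measurable_EFinP.
- by apply: aeW => x _; apply: cvg_EFin; [exact: nearW|exact: hf].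
- by apply: finite_measure_integrable_cst.
- by apply: aeW => x n _ /=; rewrite lee_fin.
move=> intf + _ => cv.
apply: S_L1 => // e e0.
have cv' : (\int[mu]_x `|h n x - f x|%:E)%E @[n --> \oo] --> 0%E by exact: cv.
have [N _ /(_ N (leqnn N)) HN] := cvge0_lt cv' e0.
exists (h N) => //.
by under eq_integral do rewrite distrC.
Qed.

Section Wave.
Variables s b : R.
Let y x := (1 + cos (s * x + b)) / 2.

Let y_itv x : 0 <= y x <= 1.
Proof.
rewrite /y; have := cos_le1 (s * x + b); have := cos_geN1 (s * x + b).
by move=> *; apply/andP; split; lra.
Qed.

Let mcos s' b' : measurable_fun [set: measurableTypeR R] (fun x => cos (s' * x + b')).
Proof.
apply: measurableT_comp => //.
  by apply: continuous_measurable_fun; exact: continuous_cos.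
by apply: measurable_funD => //; apply: measurable_funM => //.
Qed.

Let my : measurable_fun [set: measurableTypeR R] y.
Proof. by apply: measurable_funM => //; apply: measurable_funD => //; exact: mcos. Qed.

(* The product-to-sum formulas keep trigonometric polynomials closed under
   multiplication by [y]. *)
Let Q f := forall s' b', S (fun x => f x * cos (s' * x + b')).

Let Q_y f : Q f -> Q (fun x => y x * f x).
Proof.
move=> Qf s' b'.
have h1 := S_lin (1/4) (Qf (s + s') (b + b')) S_0.
have h2 := S_lin (1/4) (Qf (s - s') (b - b')) h1.
have := S_lin (1/2) (Qf s' b') h2.
congr (S _); apply/funext => x; rewrite /y.
have -> : (s + s') * x + (b + b') = (s * x + b) + (s' * x + b') by ring.
have -> : (s - s') * x + (b - b') = (s * x + b) - (s' * x + b') by ring.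
rewrite (cosD (s * x + b) (s' * x + b')) (cosB (s * x + b) (s' * x + b')).
by field.
Qed.

Let Q_poly n N : Q (fun x => (1 - y x ^+ n) ^+ N).
Proof.
elim: N => [|N IH]; first by move=> s' b'; have := S_cos s' b';
  congr (S _); apply/funext => x; rewrite expr0 mul1r.
have H k : Q (fun x => y x ^+ k * (1 - y x ^+ n) ^+ N).
  elim: k => [|k IHk]; first by move=> s' b'; have := IH s' b';
    congr (S _); apply/funext => x; rewrite expr0 mul1r.
  move=> s' b'; have := Q_y IHk s' b'; congr (S _); apply/funext => x.
  by rewrite exprS !mulrA.
move=> s' b'; have := S_lin (-1) (H n s' b') (IH s' b').
by congr (S _); apply/funext => x; rewrite exprS; ring.
Qed.

(** A square wave is the pointwise limit of the trigonometric polynomials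
    (1 - y^n)^(n 2^n) with y = (1 + cos) / 2, all bounded by 1. *)
Lemma S_wave : S (fun x => (cos (s * x + b) < 0)%R%:R).
Proof.
apply: (@S_bounded_cvg (fun n x => (1 - y x ^+ n) ^+ (n * 2 ^ n))).
- move=> n; have := Q_poly n (n * 2 ^ n) 0 0; congr (S _); apply/funext => x.
  by rewrite mul0r addr0 cos0 mulr1.
- move=> n; apply: measurable_funX; apply: measurable_funB => //.
  exact: measurable_funX.
- move=> n x; have /andP[y0 y1] := y_itv x.
  have := exprn_ge0 n y0; have := exprn_ile1 n y0 y1 => h0 h1.
  by rewrite ger0_norm ?exprn_ge0 ?exprn_ile1//; lra.
- move=> x; have := cvg_step (y_itv x).
  by rewrite /y (_ : (_ < 2^-1) = (cos (s * x + b) < 0))//; apply/idP/idP; lra.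
Qed.

End Wave.

(** Stretched square waves: as the half-period grows, the set where
    sin ((x - c) / (n + 1)) > 0 agrees with the ray beyond c on every bounded
    set. *)
Lemma S_ray c : S (\1_(`]c, +oo[%classic : set R)).
Proof.
apply: (@S_bounded_cvg (fun n x => (cos (n.+1%:R^-1 * x + (pi/2 - n.+1%:R^-1 * c)) < 0)%R%:R)).
- by move=> n; exact: S_wave.
- move=> n; apply: (measurableT_comp (f := fun b : bool => b%:R : R)) => //.
  apply: measurable_fun_ltr => //.
  apply: measurableT_comp => //.
    by apply: continuous_measurable_fun; exact: continuous_cos.
  by apply: measurable_funD => //; apply: measurable_funM => //.
- by move=> n x; case: (_ < _); rewrite ?normr1 ?normr0.
- move=> x; apply: cvg_near_cst.
  near=> n.
  have -> : n.+1%:R^-1 * x + (pi/2 - n.+1%:R^-1 * c) = n.+1%:R^-1 * (x - c) + pi / 2 by ring.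
  rewrite cosDpihalf oppr_lt0 indicE mem_setE in_itv/= andbT; congr (_%:R).
  have n0 : 0 < n.+1%:R^-1 :> R by rewrite invr_gt0.
  have n2 : n.+1%:R^-1 * `|x - c| < 2.
    rewrite mulrC ltr_pdivrMr//.
    have : `|x - c| <= n%:R by near: n; exact: nbhs_infty_ger.
    by rewrite -natr1; have : 0 <= n%:R :> R by []; lra.
  congr nat_of_bool.
  have [xc|xc|->] := ltgtP x c; last by rewrite subrr mulr0 sin0 ltxx.
  + apply/negbTE; rewrite -leNgt -[X in sin X]opprK sinN oppr_le0 ltW//.
    apply: sin2_gt0; rewrite -mulrN; rewrite ltr0_norm in n2; last by lra.
    by rewrite n2 mulr_gt0//; lra.
  + apply: sin2_gt0; rewrite ger0_norm in n2; last by lra.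
    by rewrite n2 mulr_gt0//; lra.
Unshelve. all: by end_near. Qed.

Lemma S_indic (A : set (measurableTypeR R)) : measurable A -> S (\1_A).
Proof.
move=> mA; have {mA} : (@RGenOInfty.G R).-sigma.-measurable A.
  by rewrite -RGenOInfty.measurableE.
move: A; apply: (@dynkin_induction _ (measurableTypeR R) _ (fun A => S (\1_A))).
- exact: RGenOInfty.measurableE.
- move=> _ _ [a ->] [b ->]; exists (Num.max a b).
  apply/seteqP; split => x /=; rewrite !in_itv/= !andbT gt_max.
    by move=> [-> ->].
  by move=> /andP.
- by have := S_1; congr (S _); apply/funext => x; rewrite indicT.
- by move=> _ [c ->]; exact: S_ray.
- move=> A mA SA; have := S_lin (-1) SA S_1; congr (S _); apply/funext => x.
  by rewrite !indicE in_setC; case: (x \in A) => /=; ring.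
- move=> F mF tF SF.
  apply: (@S_bounded_cvg (fun n => \1_(\big[setU/set0]_(i < n) F i))).
  + elim=> [|n IH]; first by rewrite big_ord0; have := S_0; congr (S _);
      apply/funext => x; rewrite indic0.
    have := S_lin 1 IH (SF n); rewrite big_ord_recr/=; congr (S _).
    apply/funext => x; rewrite mul1r !indicE in_setU.
    have [xF|] := boolP (x \in F n); rewrite ?orbT ?orbF ?addr0//.
    rewrite (_ : _ \in _ = false) ?add0r//; apply/negbTE; apply/negP => /set_mem.
    rewrite -bigcup_mkord => -[i /= ltin Fix].
    have ein : i = n by apply: tF => //; exists x; split => //; exact: set_mem.
    by move: ltin; rewrite ein ltnn.
  + by move=> n; apply: measurable_indic; exact: bigsetU_measurable.
  + by move=> n x; rewrite indicE; case: (_ \in _); rewrite ?normr1 ?normr0.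
  + move=> x; apply: cvg_near_cst; have [[i _ Fix]|nF] := pselect ((\bigcup_k F k) x).
      near=> n; rewrite !indicE !mem_set//; first by exists i.
      rewrite -bigcup_mkord; exists i => //=.
      by near: n; exact: nbhs_infty_gt.
    near=> n; rewrite !indicE !memNset// -bigcup_mkord => -[i _ Fix].
    by apply: nF; exists i.
Unshelve. all: by end_near. Qed.

Import HBSimple.

(** Rays generate the Borel sets and form a pi-system, so the Dynkin argument of
    [S_indic] gives all indicators; simple functions are dense in L1. *)
Theorem trig_total f : mu.-integrable [set: _] (EFin \o f) -> S f.
Proof.
move=> intf; apply: S_L1 => // e e0.
have [g [_ _ cv]] := approximation_sfun_integrable measurableT intf.
have [N _ /(_ N (leqnn N)) HN] := cvge0_lt cv e0.
exists ((g N : R -> R)).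
  have := fimfunEord (g N); set s := fset_set _ => gE.
  have : forall n (c : 'I_n -> R) (A : 'I_n -> set (measurableTypeR R)),
      (forall i, measurable (A i)) -> S (fun x => \sum_(i < n) c i * \1_(A i) x).
    elim=> [|n IH] c A mA.
      by have := S_0; congr (S _); apply/funext => x; rewrite big_ord0.
    have := S_lin (c ord_max) (S_indic (mA ord_max)) (IH _ _ (fun i => mA (widen_ord (leqnSn n) i))).
    move/(_ (fun i => c (widen_ord (leqnSn n) i))).
    by congr (S _); apply/funext => x; rewrite big_ord_recr/= addrC.
  move=> /(_ (size (finmap.enum_fset s)) (fun i => (finmap.enum_fset s)`_i) (fun i => g N @^-1` [set (finmap.enum_fset s)`_i])).
  move=> /(_ (fun i => measurable_sfunP (g N) (measurable_set1 _))); congr (S _).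
  by apply/funext => x; rewrite gE.
by move: HN; under eq_integral do rewrite -EFinB abse_EFin.
Qed.

End TrigTotal.

(** * Gaussian laws: moments and cosine transforms *)

Section Density.
Context d (T : measurableType d) (R : realType).
Variables (mu nu : {measure set T -> \bar R}) (p : T -> R).
Hypothesis mp : measurable_fun [set: T] p.
Hypothesis p0 : forall x, 0 <= p x.
Hypothesis nuE : forall A, measurable A -> nu A = (\int[mu]_(x in A) (p x)%:E)%E.
Local Open Scope ereal_scope.

Import HBNNSimple.

Let integral_density_nnsfun (h : {nnsfun T >-> R}) :
  \int[nu]_x (h x)%:E = \int[mu]_x (h x * p x)%:E.
Proof.
under [LHS]eq_integral do rewrite fimfunE -fsumEFin//.
rewrite [LHS]ge0_integral_fsum//; last 2 first.
  - by move=> r; exact/measurable_EFinP/measurableT_comp.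
  - by move=> n x _; rewrite EFinM nnfun_muleindic_ge0.
under [RHS]eq_integral.
  move=> x xD; rewrite EFinM muleC fimfunE -fsumEFin// ge0_mule_fsumr; last first.
    by move=> r; rewrite EFinM nnfun_muleindic_ge0.
  over.
rewrite [RHS]ge0_integral_fsum//; last 2 first.
  - move=> r; apply/measurable_EFinP; apply: measurable_funM => //.
    by apply: measurable_funM => //.
  - move=> n x _; rewrite mule_ge0//; first by rewrite lee_fin.
    by rewrite EFinM nnfun_muleindic_ge0.
apply: eq_fsbigr => r _.
rewrite integralZl_indic_nnsfun//= integral_indic// setIT nuE//.
under [RHS]eq_integral do rewrite EFinM muleCA.
have [rh|rh] := pselect (range h r); last first.
  have -> : h @^-1` [set r] = set0.
    by apply/seteqP; split => // x /= hx; apply: rh; exists x.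
  rewrite integral_set0 mule0; under eq_integral do rewrite indic0 mule0 mule0.
  by rewrite integral0.
have r0 : (0 <= r)%R by case: rh => x _ <-.
rewrite ge0_integralZl//.
- congr (_ * _); rewrite [LHS]integral_mkcond; apply: eq_integral => x _.
  by rewrite patchE indicE; case: ifP => _; rewrite ?mule1 ?mule0.
- apply/measurable_EFinP; apply: measurable_funM => //.
- by move=> x _; rewrite mule_ge0 ?lee_fin.
Qed.

(** Simple functions first, then monotone convergence along the canonical
    increasing approximation. *)
Lemma ge0_integral_density (f : T -> R) : measurable_fun [set: T] f ->
  (forall x, (0 <= f x)%R) ->
  \int[nu]_x (f x)%:E = \int[mu]_x (f x * p x)%:E.
Proof.
move=> mf f0.
have mf' : measurable_fun [set: T] (EFin \o f) by exact/measurable_EFinP.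
pose f_ := nnsfun_approx measurableT mf'.
have f_f x : (f_ n x)%:E @[n --> \oo] --> (f x)%:E.
  by apply: cvg_nnsfun_approx => //= y _; rewrite lee_fin.
transitivity (limn (fun n => \int[nu]_x (f_ n x)%:E)).
  rewrite -monotone_convergence//=.
  - apply: eq_integral => x _; apply/esym/cvg_lim => //=; exact: f_f.
  - by move=> n; exact/measurable_EFinP/measurable_funTS.
  - by move=> n ? _; rewrite lee_fin.
  - by move=> ? _ ? ? mn; rewrite lee_fin; exact/lefP/nd_nnsfun_approx.
transitivity (limn (fun n => \int[mu]_x (f_ n x * p x)%:E)).
  by congr (limn _); apply/funext => n; exact: integral_density_nnsfun.
rewrite -monotone_convergence//=.
- apply: eq_integral => x _; apply/cvg_lim => //=.
  under eq_fun do rewrite EFinM.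
  rewrite EFinM; apply: cvgeZr => //; exact: f_f.
- by move=> n; apply/measurable_EFinP; apply: measurable_funM => //.
- by move=> n x _; rewrite lee_fin mulr_ge0.
- move=> x _ i j ij; rewrite lee_fin ler_wpM2r//.
  exact/lefP/nd_nnsfun_approx.
Qed.

End Density.

Section GaussIBP.
Context (R : realType) (m s : R).
Hypothesis s0 : s != 0.
Notation mu := (@lebesgue_measure R).
Let p := normal_pdf m s.

Lemma normal_pdf_derive (x : R) :
  is_derive x (1 : R) (p : R^o -> R^o) (- ((x - m) / s ^+ 2) * p x).
Proof.
rewrite /p normal_pdfE// /normal_fun.
apply: trigger_derive.
rewrite /GRing.scale/=.
by field.
Qed.

(** Doubling the variance of the Gaussian absorbs a quadratic factor, because
    t <= exp t: quadratic growth is integrable against the normal density. *)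
Lemma normal_pdf_decay (x : R) :
  (1 + (x - m) ^+ 2) * p x <=
  (1 + 4 * s ^+ 2) * normal_peak s * normal_fun m (Num.sqrt 2 * s) x.
Proof.
rewrite /p normal_pdfE// /normal_fun.
rewrite mulrCA -mulrA [leRHS]mulrCA ler_wpM2l ?normal_peak_ge0//.
rewrite exprMn sqr_sqrtr//.
set z := (x - m) ^+ 2; have z0 : 0 <= z by rewrite sqr_ge0.
have sp : 0 < s ^+ 2 by rewrite exprn_even_gt0.
set t := z / (4 * s ^+ 2).
have t0 : 0 <= t by rewrite divr_ge0//; lra.
have -> : - z / (s ^+ 2 *+ 2) = - t + - t by rewrite /t; field.
have -> : - z / (2 * s ^+ 2 *+ 2) = - t by rewrite /t; field.
have -> : z = 4 * s ^+ 2 * t by rewrite /t; field.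
rewrite expRD mulrA ler_wpM2r ?expR_ge0// expRN.
rewrite ler_pdivrMr ?expR_gt0//.
have := expR_ge1Dx t => h.
have h1 : 1 <= expR t by lra.
have h2 : t <= expR t by lra.
have : 4 * s ^+ 2 * t <= 4 * s ^+ 2 * expR t by rewrite ler_wpM2l//; lra.
lra.
Qed.

Lemma integrable_normal_quad : mu.-integrable [set: _]
  (EFin \o (fun x => (1 + (x - m) ^+ 2) * p x)).
Proof.
have s20 : Num.sqrt 2 * s != 0 by rewrite mulf_neq0// gt_eqF// sqrtr_gt0.
have K := integrable_normal_pdf m (Num.sqrt 2 * s).
rewrite (normal_pdfE _ s20) in K.
have {}K := integrableZl measurableT
  ((1 + 4 * s ^+ 2) * normal_peak s / normal_peak (Num.sqrt 2 * s)) K.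
apply: le_integrable K => //.
  apply/measurable_EFinP; apply: measurable_funM; last exact: measurable_normal_pdf.
  by apply: measurable_funD => //; apply: measurable_funX; apply: measurable_funB.
move=> x _ /=; rewrite ?abse_EFin -?EFinM ?abse_EFin lee_fin.
rewrite ger0_norm; last first.
  by rewrite mulr_ge0 ?normal_pdf_ge0// addr_ge0// sqr_ge0.
apply: (le_trans (normal_pdf_decay x)).
apply: le_trans (ler_norm _).
by rewrite [leRHS]mulrA divfK ?gt_eqF ?normal_peak_gt0.
Qed.

Lemma normal_pdf_dom (w : R -> R) (C : R) : measurable_fun [set: R] w ->
  (forall x, `|w x| <= C * (1 + (x - m) ^+ 2)) ->
  mu.-integrable [set: _] (EFin \o (fun x => w x * p x)).
Proof.
move=> mw wC.
have K := integrableZl measurableT C integrable_normal_quad.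
apply: le_integrable K => //.
  apply/measurable_EFinP; apply: measurable_funM => //; exact: measurable_normal_pdf.
move=> x _ /=; rewrite ?abse_EFin -?EFinM ?abse_EFin lee_fin normrM.
rewrite (ger0_norm (normal_pdf_ge0 _ _ _)) mulrA.
apply: le_trans (ler_norm _).
by rewrite ler_wpM2r// normal_pdf_ge0.
Qed.

(** Stein's identity. The integrand is the derivative of h p, so on the interval
    of radius n + 1 around m the integral is a boundary term, which is O(1/n) by
    [normal_pdf_decay]. *)
Lemma normal_ibp (h h' : R -> R) (C : R) :
  (forall x : R, is_derive x (1 : R) (h : R^o -> R^o) (h' x)) ->
  continuous h' ->
  (forall x, `|h x| <= C * (1 + `|x - m|)) ->
  (forall x, `|h' x| <= C) ->
  (\int[mu]_x ((h' x - (x - m) / s ^+ 2 * h x) * p x)%:E = 0)%E.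
Proof.
move=> dh ch' hC h'C.
have sp : 0 < s ^+ 2 by rewrite exprn_even_gt0.
have C0 : 0 <= C by apply: le_trans (h'C 0).
have ch : continuous h.
  by move=> x; apply/differentiable_continuous/derivable1_diffP; case: (dh x).
pose w x := h' x - (x - m) / s ^+ 2 * h x.
have cw : continuous w.
  move=> x; apply: cvgB; first exact: ch'.
  apply: cvgM; last exact: ch.
  by apply: cvgM; [apply: cvgB; [exact: cvg_id|exact: cvg_cst]|exact: cvg_cst].
have quad (z : R) : 0 <= z -> z <= 1 + z ^+ 2 by move=> ?; nra.
have wb x : `|w x| <= (C + 2 * C / s ^+ 2) * (1 + (x - m) ^+ 2).
  rewrite /w (le_trans (ler_normB _ _))// normrM normrM.
  have -> : `|(s ^+ 2)^-1| = (s ^+ 2)^-1 by rewrite ger0_norm// invr_ge0 ltW.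
  rewrite -[(x - m) ^+ 2]real_normK ?num_real//.
  have := hC x; have := h'C x; set z := `|x - m|; have z0 : 0 <= z by exact: normr_ge0.
  move=> A B.
  have -> : (C + 2 * C / s ^+ 2) * (1 + z ^+ 2) =
     C * (1 + z ^+ 2) + (2 * C * (1 + z ^+ 2)) / s ^+ 2 by ring.
  have -> : z / s ^+ 2 * `|h x| = (z * `|h x|) / s ^+ 2 by ring.
  rewrite lerD//; first by nra.
  rewrite ler_wpM2r// ?invr_ge0 ?(ltW sp)//.
  have : z * `|h x| <= z * (C * (1 + z)) by rewrite ler_wpM2l.
  by have := quad z z0 => ? ?; nra.
have iw : mu.-integrable [set: _] (EFin \o (fun x => w x * p x)).
  by apply: normal_pdf_dom wb; exact: continuous_measurable_fun.
pose k x := h x * p x.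
have dk (x : R) : is_derive x (1 : R) (k : R^o -> R^o) (w x * p x).
  have := normal_pdf_derive x => dp; have := dh x => dhx.
  apply: trigger_derive; rewrite /GRing.scale/= /w; ring.
have ck : continuous k.
  by move=> x; apply/differentiable_continuous/derivable1_diffP; case: (dk x).
pose D (n : nat) := `[m - n.+1%:R, m + n.+1%:R]%classic : set R.
have ftc n : (\int[mu]_(x in D n) (w x * p x)%:E)%E =
    (k (m + n.+1%:R) - k (m - n.+1%:R))%:E.
  rewrite EFinB; apply: (@continuous_FTC2 _ (fun x => w x * p x)).
  - by have : 0 < n.+1%:R :> R by []; lra.
  - apply: continuous_subspaceT => x; apply: cvgM; first exact: cw.
    exact: continuous_normal_pdf.
  - split.
    + by move=> x _; case: (dk x).
    + by apply: cvg_at_right_filter; exact: ck.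
    + by apply: cvg_at_left_filter; exact: ck.
  - move=> x _; rewrite derive1E; have dkx := dk x; exact: derive_val.
have cvL : (\int[mu]_(x in D n) (w x * p x)%:E)%E @[n --> \oo] -->
    (\int[mu]_x (w x * p x)%:E)%E.
  under eq_fun do rewrite integral_mkcond.
  have mwp : measurable_fun [set: R] (fun x => (w x * p x)%:E).
    by apply/measurable_EFinP; case/integrableP: iw => /measurable_EFinP.
  have [] // := @dominated_convergence _ _ _ mu setT measurableT
    (fun n => (fun x => (w x * p x)%:E) \_ (D n)) (fun x => (w x * p x)%:E)
    (fun x => `|(w x * p x)%:E|%E).
  - move=> n; apply/(measurable_restrictT _ _).1 => //.
    exact: measurable_itv.
    by apply: (measurable_funS measurableT _ mwp).
  - apply: aeW => x _; apply: cvg_near_cst; near=> n.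
    rewrite patchE mem_set// /D/= in_itv/=.
    have : `|x - m| <= n%:R by near: n; exact: nbhs_infty_ger.
    by rewrite ler_norml -natr1 => /andP[? ?]; apply/andP; split; lra.
  - exact: integrable_abse.
  - apply: aeW => x n _; rewrite patchE; case: ifP => // _.
    by rewrite abse0 abse_ge0.
have kb n (x : R) : `|x - m| = n.+1%:R -> `|k x| <=
    2 * C * ((1 + 4 * s ^+ 2) * normal_peak s) * (4 * s ^+ 2 * n.+1%:R^-1).
  move=> xn.
  have n1 : 1 <= n.+1%:R :> R by rewrite ler1n.
  rewrite /k normrM (ger0_norm (normal_pdf_ge0 _ _ _)).
  apply: (@le_trans _ _ (2 * C * ((1 + (x - m) ^+ 2) * p x))).
    rewrite mulrA ler_wpM2r ?normal_pdf_ge0//; apply: (le_trans (hC x)).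
    rewrite -[(x - m) ^+ 2]real_normK ?num_real//; set z := `|x - m|.
    have z0 : 0 <= z by exact: normr_ge0.
    by have := quad z z0; nra.
  have : (1 + (x - m) ^+ 2) * p x <= ((1 + 4 * s ^+ 2) * normal_peak s) * (4 * s ^+ 2 / n.+1%:R).
    apply: (le_trans (normal_pdf_decay x)); rewrite ler_wpM2l//.
      by rewrite mulr_ge0 ?normal_peak_ge0//; lra.
    rewrite /normal_fun exprMn sqr_sqrtr// -[(x - m) ^+ 2]real_normK ?num_real// xn.
    rewrite mulNr expRN.
    set N := n.+1%:R in n1 *.
    have -> : N ^+ 2 / (2 * s ^+ 2 *+ 2) = N ^+ 2 / (4 * s ^+ 2) by field.
    have -> : 4 * s ^+ 2 / N = (N / (4 * s ^+ 2))^-1 by field; rewrite s0 gt_eqF//; lra.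
    have N4 : 0 < N / (4 * s ^+ 2) by rewrite divr_gt0//; lra.
    rewrite lef_pV2 ?posrE ?expR_gt0//.
    apply: le_trans (expR_ge1Dx _).
    have : N / (4 * s ^+ 2) <= N ^+ 2 / (4 * s ^+ 2).
      by rewrite ler_wpM2r ?invr_ge0//; nra.
    by lra.
  have C2 : 0 <= 2 * C by lra.
  by move=> /(ler_wpM2l C2); rewrite !mulrA.
have cv0 : (k (m + n.+1%:R) - k (m - n.+1%:R))%:E @[n --> \oo] --> 0%:E.
  apply: cvg_EFin; first exact: nearW.
  apply/norm_cvg0P.
  set K := 2 * C * ((1 + 4 * s ^+ 2) * normal_peak s) * (4 * s ^+ 2).
  apply: (@squeeze_cvgr _ _ _ _ (fun=> 0) (fun n : nat => 2 * K * n.+1%:R^-1)).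
  - apply: nearW => n; rewrite normr_ge0/=.
    apply: (le_trans (ler_normB _ _)).
    have A := kb n (m + n.+1%:R); have B := kb n (m - n.+1%:R).
    move: A B; rewrite addrAC subrr add0r normr_nat => /(_ erefl) A.
    rewrite addrAC subrr add0r normrN normr_nat => /(_ erefl) B.
    by apply: (le_trans (lerD A B)); rewrite le_eqVlt /K; apply/orP; left; apply/eqP; ring.
  - exact: cvg_cst.
  - rewrite -[X in _ --> X](mulr0 (2 * K)); apply: cvgM; first exact: cvg_cst.
    exact: cvg_harmonic.
move: cvL; under eq_fun do rewrite ftc.
by move=> /cvg_unique; apply => //; exact: cv0.
Unshelve. all: by end_near. Qed.

End GaussIBP.

(** Leibniz rule with a dominating function, in the form of [is_derive] so that
    it composes with the automatic derivation of the integrand. *)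
Lemma is_derive_under_integral (R : realType) d (Y : measurableType d)
    (mu : {measure set Y -> \bar R}) (B : set Y) (f f' : R -> Y -> R)
    (a u v : R) (G : Y -> R) :
  measurable B -> u < a < v ->
  (forall x, u < x < v -> mu.-integrable B (EFin \o f x)) ->
  (forall (x : R) y, u < x < v -> B y ->
     is_derive x (1 : R) (f^~ y : R^o -> R^o) (f' x y)) ->
  (forall y, 0 <= G y) -> mu.-integrable B (EFin \o G) ->
  (forall x y, u < x < v -> B y -> `|f' x y| <= G y) ->
  is_derive a (1 : R) ((fun x => \int[mu]_(y in B) f x y) : R^o -> R^o)
    (\int[mu]_(y in B) f' a y).
Proof.
move=> mB uav intf df G0 iG f'G.
have Ia : `]u, v[%classic a by rewrite /= in_itv/=.
have E x y : `]u, v[%classic x -> B y -> lebesgue_integral_under.partial1of2 f x y = f' x y.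
  rewrite /= in_itv/= => Ix By; rewrite lebesgue_integral_under.partial1of2E.
  by have := df x y Ix By => dfx; exact: derive_val.
have intf' x : `]u, v[%classic x -> mu.-integrable B (EFin \o f x).
  by rewrite /= in_itv/=; exact: intf.
have df' x y : `]u, v[%classic x -> B y -> derivable (f^~ y) x 1.
  by rewrite /= in_itv/= => Ix By; case: (df x y Ix By).
have f'G' x y : `]u, v[%classic x -> B y -> `|lebesgue_integral_under.partial1of2 f x y| <= G y.
  by move=> Ix By; rewrite E// f'G//; move: Ix; rewrite /= in_itv.
have D1 := lebesgue_integral_under.derivable_under_integral mB Ia intf' df' G0 iG f'G'.
have D2 := lebesgue_integral_under.differentiation_under_integral mB Ia intf' df' G0 iG f'G'.
apply: DeriveDef; first exact: D1.
rewrite -derive1E D2; apply: eq_Rintegral => y /set_mem By; exact: E.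
Qed.

Section GaussMoments.
Context (R : realType) (m s : R).
Hypothesis s0 : s != 0.
Notation mu := (@lebesgue_measure R).
Let p := normal_pdf m s.
Let sp : 0 < s ^+ 2. Proof. by rewrite exprn_even_gt0. Qed.

Let mz : measurable_fun [set: R] (fun x : R => x - m).
Proof. exact: measurable_funB. Qed.

Let mtrig (f : R -> R) (u b : R) : continuous f ->
  measurable_fun [set: R] (fun x : R => f (u * (x - m) + b)).
Proof.
move=> cf; apply: measurableT_comp; first exact: continuous_measurable_fun.
by apply: measurable_funD => //; apply: measurable_funM => //; exact: mz.
Qed.

Let absz (x : R) : `|x - m| <= 1 + (x - m) ^+ 2.
Proof.
rewrite -[(x - m) ^+ 2]real_normK ?num_real//.
by have := normr_ge0 (x - m); set z := `|x - m| => ?; nra.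
Qed.

Let int1 : mu.-integrable [set: _] (EFin \o p).
Proof. exact: integrable_normal_pdf. Qed.

Let intz : mu.-integrable [set: _] (EFin \o (fun x => (x - m) * p x)).
Proof.
apply: (@normal_pdf_dom R m s s0 _ 1) => //.
by move=> x; rewrite mul1r; exact: absz.
Qed.

Let intz2 : mu.-integrable [set: _] (EFin \o (fun x => (x - m) ^+ 2 * p x)).
Proof.
apply: (@normal_pdf_dom R m s s0 _ 1) => //; first exact: measurable_funX.
by move=> x; rewrite ger0_norm ?sqr_ge0//; lra.
Qed.

(* [normal_ibp] for h = 1 *)
Let Iz : \int[mu]_x ((x - m) * p x) = 0.
Proof.
have := @normal_ibp R m s s0 (fun=> 1) (fun=> 0) 1.
move=> /(_ (fun x => is_derive_cst _ _ _)) H.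
have {}H : (\int[mu]_x ((0 - (x - m) / s ^+ 2 * 1) * normal_pdf m s x)%:E)%E = 0%E.
  apply: H.
  - by move=> x; exact: cvg_cst.
  - by move=> x; rewrite normr1 mul1r lerDl.
  - by move=> x; rewrite normr0.
transitivity (- s ^+ 2 * \int[mu]_x ((0 - (x - m) / s ^+ 2 * 1) * normal_pdf m s x)); last first.
  by rewrite /Rintegral H mulr0.
rewrite -RintegralZl//; first by apply: eq_Rintegral => x _; rewrite -/p; field.
have := integrable_scale measurableT (- (s ^+ 2)^-1) intz.
by apply: eq_integrable => // x _ /=; congr EFin; rewrite -/p; field.
Qed.

(* [normal_ibp] for h x = x - m *)
Let Iz2 : \int[mu]_x ((x - m) ^+ 2 * p x) = s ^+ 2.
Proof.
have H : (\int[mu]_x ((1 - (x - m) / s ^+ 2 * (x - m)) * normal_pdf m s x)%:E)%E = 0%E.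
  apply: (@normal_ibp R m s s0 (fun x => x - m) (fun=> 1) 1).
  - by move=> x; apply: trigger_derive; rewrite subr0.
  - by move=> x; exact: cvg_cst.
  - by move=> x; rewrite mul1r lerDr.
  - by move=> x; rewrite normr1.
have K : \int[mu]_x (p x) = 1 by rewrite /Rintegral integral_normal_pdf.
have I2 := integrable_scale measurableT (s ^+ 2)^-1 intz2.
have : \int[mu]_x (p x - (s ^+ 2)^-1 * ((x - m) ^+ 2 * p x)) = 0.
  rewrite /Rintegral -[RHS](congr1 fine H); congr fine; apply: eq_integral => x _.
  by rewrite -/p; congr EFin; field.
rewrite RintegralB// RintegralZl// K => /eqP; rewrite subr_eq0 => /eqP E.
by rewrite -[RHS]mulr1 E mulrA divff ?mul1r// gt_eqF.
Qed.

Lemma normal_second_moment c :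
  (\int[mu]_x ((x + c) ^+ 2 * p x)%:E = (s ^+ 2 + (m + c) ^+ 2)%:E)%E.
Proof.
have I1 := integrable_scale measurableT ((m + c) ^+ 2) int1.
have I2 := integrable_scale measurableT (2 * (m + c)) intz.
have E x : (x + c) ^+ 2 * p x = (m + c) ^+ 2 * p x +
   (2 * (m + c) * ((x - m) * p x) + (x - m) ^+ 2 * p x) by ring.
have I : mu.-integrable [set: _] (EFin \o (fun x => (m + c) ^+ 2 * p x +
   (2 * (m + c) * ((x - m) * p x) + (x - m) ^+ 2 * p x))).
  by apply: integrableDr => //; exact: integrableDr.
under eq_integral do rewrite E.
rewrite -[LHS]fineK; last exact: integrable_fin_num.
congr EFin; rewrite -/(Rintegral _ _ _).
rewrite RintegralD//; last exact: integrableDr.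
rewrite RintegralD// !RintegralZl// Iz Iz2 mulr0 add0r.
by rewrite /Rintegral integral_normal_pdf mulr1 addrC.
Qed.

(** By [normal_ibp] the integral F u satisfies F' u = - s^2 u F u, hence
    F u * exp (u^2 s^2 / 2) is constant in u. *)
Lemma normal_cos (b u : R) :
  \int[mu]_x (cos (u * (x - m) + b) * p x) = cos b * expR (- (u ^+ 2 * s ^+ 2 / 2)).
Proof.
have intT (f : R -> R) u' : continuous f -> (forall x, `|f x| <= 1) ->
    mu.-integrable [set: _] (EFin \o (fun x => f (u' * (x - m) + b) * p x)).
  move=> cf f1; apply: (@normal_pdf_dom R m s s0 _ 1); first exact: mtrig.
  by move=> x; rewrite mul1r; apply: (le_trans (f1 _)); rewrite lerDl sqr_ge0.
pose F u' := \int[mu]_x (cos (u' * (x - m) + b) * p x).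
pose S u' := \int[mu]_x ((- (x - m) * sin (u' * (x - m) + b)) * p x).
have dF (u' : R) : is_derive u' (1 : R) (F : R^o -> R^o) (S u').
  apply: (@is_derive_under_integral R _ _ mu setT
    (fun u' x => cos (u' * (x - m) + b) * p x)
    (fun u' x => (- (x - m) * sin (u' * (x - m) + b)) * p x) u' (u' - 1) (u' + 1)
    (fun x => (1 + (x - m) ^+ 2) * p x)).
  - exact: measurableT.
  - by apply/andP; split; lra.
  - by move=> x _; apply: intT; [exact: continuous_cos|exact: cos_max].
  - move=> x y _ _; apply: trigger_derive.
    by rewrite /GRing.scale/=; ring.
  - by move=> x; rewrite mulr_ge0 ?normal_pdf_ge0// addr_ge0 ?sqr_ge0.
  - exact: integrable_normal_quad.
  - move=> x y _ _; rewrite !normrM normrN (ger0_norm (normal_pdf_ge0 _ _ _)).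
    rewrite ler_wpM2r ?normal_pdf_ge0//; apply: le_trans (absz y).
    by rewrite ler_piMr// sin_max.
have SE u' : S u' = - (s ^+ 2 * u') * F u'.
  have H : (\int[mu]_x ((u' * cos (u' * (x - m) + b) - (x - m) / s ^+ 2 * sin (u' * (x - m) + b)) * p x)%:E)%E = 0%E.
    apply: (@normal_ibp R m s s0 (fun x => sin (u' * (x - m) + b)) (fun x => u' * cos (u' * (x - m) + b)) (1 + `|u'|)).
    - by move=> x; apply: trigger_derive; rewrite /GRing.scale/=; ring.
    - move=> x; apply: cvgM; first exact: cvg_cst.
      apply: continuous_comp; last exact: continuous_cos.
      apply: cvgD; last exact: cvg_cst.
      by apply: cvgM; [exact: cvg_cst|apply: cvgB; [exact: cvg_id|exact: cvg_cst]].
    - move=> x; apply: (le_trans (sin_max _)).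
      by have := normr_ge0 u'; have := normr_ge0 (x - m); nra.
    - move=> x; rewrite normrM; apply: (@le_trans _ _ `|u'|); last by lra.
      by rewrite ler_piMr// cos_max.
  have iC := integrable_scale measurableT u' (intT cos u' (@continuous_cos R) (@cos_max R)).
  have iS : mu.-integrable [set: _] (EFin \o (fun x => (- (x - m) * sin (u' * (x - m) + b)) * p x)).
    apply: (@normal_pdf_dom R m s s0 _ 1).
      by apply: measurable_funM; [exact: measurable_funN|apply: mtrig; exact: continuous_sin].
    move=> x; rewrite mul1r normrM normrN; apply: le_trans (absz x).
    by rewrite ler_piMr// sin_max.
  have : \int[mu]_x (u' * (cos (u' * (x - m) + b) * p x) + (s ^+ 2)^-1 * ((- (x - m) * sin (u' * (x - m) + b)) * p x)) = 0.
    rewrite /Rintegral -[RHS](congr1 fine H); congr fine; apply: eq_integral => x _.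
    by congr EFin; field.
  have iS' := integrable_scale measurableT (s ^+ 2)^-1 iS.
  rewrite RintegralD// !RintegralZl//; last exact: intT (@continuous_cos R) (@cos_max R).
  rewrite -/(F u') -/(S u') => E.
  have : s ^+ 2 * (u' * F u' + (s ^+ 2)^-1 * S u') = 0 by rewrite E mulr0.
  rewrite mulrDr mulVKf ?gt_eqF// => /eqP; rewrite addrC addr_eq0 => /eqP ->; ring.
pose H u' := F u' * expR (u' ^+ 2 * s ^+ 2 / 2).
have dH (u' : R) : is_derive u' (1 : R) (H : R^o -> R^o) 0.
  have := dF u'; rewrite SE => dFu; apply: trigger_derive.
  by rewrite /GRing.scale/=; field.
have := is_derive_0_is_cst u 0 dH; rewrite /H.
rewrite expr0n/= !mul0r expR0 mulr1 {2}/F.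
under eq_Rintegral do rewrite mul0r add0r.
rewrite RintegralZl// /Rintegral integral_normal_pdf mulr1 => <-.
by rewrite -[RHS]mulrA -expRD subrr expR0 mulr1.
Qed.

End GaussMoments.

Section GaussianCos.
Context d (Omega : measurableType d) (R : realType) (P : probability Omega R).
Variables (X : Omega -> R) (v : R).
Hypothesis mX : measurable_fun [set: Omega] X.

Lemma ge0_integral_law (nu : {measure set (measurableTypeR R) -> \bar R}) (h : R -> R) :
  (forall A : set (measurableTypeR R), measurable A -> P (X @^-1` A) = nu A) ->
  measurable_fun [set: measurableTypeR R] h -> (forall x, 0 <= h x) ->
  (\int[P]_w (h (X w))%:E = \int[nu]_x (h x)%:E)%E.
Proof.
move=> XE mh h0.
have := @ge0_integral_pushforward _ _ _ (measurableTypeR R) R X mX P setT (EFin \o h).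
rewrite preimage_setT => <- //; last 2 first.
- exact/measurable_EFinP.
- by move=> x _; rewrite lee_fin.
apply: eq_measure_integral => A mA _; rewrite /pushforward; exact: XE.
Qed.

Hypothesis gX : gaussian_rv P X.
Hypothesis X1 : (\int[P]_w (X w)%:E = 0)%E.
Hypothesis X2 : (\int[P]_w (X w ^+ 2)%:E = v%:E)%E.

Let iX2 : P.-integrable [set: _] (EFin \o (fun w => X w ^+ 2)).
Proof.
apply/integrableP; split; first exact/measurable_EFinP/measurable_funX.
under eq_integral do rewrite /= ger0_norm ?sqr_ge0//.
by rewrite X2 ltry.
Qed.

Let i1 : P.-integrable [set: _] (EFin \o (fun w => 1)).
Proof. exact: finite_measure_integrable_cst. Qed.

Let iX : P.-integrable [set: _] (EFin \o X).
Proof.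
apply: (integrable_dom _ mX (integrableDr _ i1 iX2)) => // w _.
have := normr_ge0 (X w); rewrite -[X w ^+ 2]real_normK ?num_real//; nra.
Qed.

(* The means of X^2 and (X + 1)^2 are integrals of nonnegative functions and
   together identify the two parameters of the law of [X] from moments. *)
Let X2' : (\int[P]_w ((X w + 1) ^+ 2)%:E = (v + 1)%:E)%E.
Proof.
have E w : (X w + 1) ^+ 2 = (X w ^+ 2 + 2 * X w) + 1 by ring.
have iX' := integrable_scale measurableT 2 iX.
under eq_integral do rewrite E EFinD.
rewrite integralD//; last exact: integrableDr.
under eq_integral do rewrite EFinD.
rewrite integralD// X2; under [X in (_ + X + _)%E]eq_integral do rewrite EFinM.
rewrite integralZl// X1 mule0 adde0 integral_cst//= mul1e.
by rewrite probability_setT.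
Qed.

(** The parameters m and s of the law are only known to exist; the first two
    moments force m = 0 and s^2 = v. Working with 1 + cos keeps the integrands
    nonnegative, as the transfer to the law requires. *)
Lemma gaussian_cos (u b : R) :
  (\int[P]_w (cos (u * X w + b))%:E = (cos b * expR (- (u ^+ 2 * v / 2)))%:E)%E.
Proof.
have mc : measurable_fun [set: measurableTypeR R] (fun x => cos (u * x + b)).
  apply: measurableT_comp; first by apply: continuous_measurable_fun; exact: continuous_cos.
  by apply: measurable_funD => //; apply: measurable_funM.
have mc1 : measurable_fun [set: measurableTypeR R] (fun x => 1 + cos (u * x + b)).
  exact: measurable_funD.
have ic : P.-integrable [set: _] (EFin \o (fun w => cos (u * X w + b))).
  apply: (integrable_dom _ _ i1) => //; last by move=> w _; exact: cos_max.
  exact: (measurableT_comp mc).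
suff : (\int[P]_w (1 + cos (u * X w + b))%:E = (1 + cos b * expR (- (u ^+ 2 * v / 2)))%:E)%E.
  under eq_integral do rewrite EFinD.
  rewrite integralD//= integral_cst//= mul1e probability_setT EFinD.
  rewrite -[(\int[P]_w _)%E]fineK; last exact: integrable_fin_num.
  rewrite -!EFinD => e0; have e := EFin_inj e0; congr EFin; lra.
have c0 x : 0 <= 1 + cos (u * x + b) by have := cos_geN1 (u * x + b); lra.
have mq : measurable_fun [set: measurableTypeR R] (fun x : R => x ^+ 2).
  exact: measurable_funX.
have mq1 : measurable_fun [set: measurableTypeR R] (fun x : R => (x + 1) ^+ 2).
  by apply: measurable_funX; exact: measurable_funD.
have [m [s [_ XE]]] := gX.
have [s0|s0] := eqVneq s 0.
- have law (h : R -> R) : measurable_fun [set: measurableTypeR R] h ->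
      (forall x, 0 <= h x) -> (\int[P]_w (h (X w))%:E = (h m)%:E)%E.
    move=> mh h0; have {}XE (A : set (measurableTypeR R)) : measurable A -> P (X @^-1` A) = \d_m A.
      by move=> /XE ->; rewrite s0 eqxx.
    rewrite (@ge0_integral_law (@dirac _ (measurableTypeR R) m R) h XE)// integral_dirac//.
      by rewrite diracT mul1e.
    exact/measurable_EFinP.
  move: X2 X2'; rewrite (law _ mq (fun x => sqr_ge0 x)) (law _ mq1 (fun x => sqr_ge0 _)).
  move=> [e1] [e2]; have m0 : m = 0 by nra.
  rewrite (law _ mc1 c0) -e1 m0 expr0n/= !mulr0 mul0r oppr0 expR0 mulr1.
  by rewrite add0r.
- have law (h : R -> R) : measurable_fun [set: measurableTypeR R] h ->
      (forall x, 0 <= h x) ->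
      (\int[P]_w (h (X w))%:E = \int[lebesgue_measure]_x (h x * normal_pdf m s x)%:E)%E.
    move=> mh h0; have {}XE (A : set (measurableTypeR R)) : measurable A -> P (X @^-1` A) = normal_prob m s A.
      by move=> /XE ->; rewrite (negbTE s0).
    rewrite (@ge0_integral_law (@normal_prob R m s) h XE)//.
    apply: ge0_integral_density => //; first exact: measurable_normal_pdf.
    by move=> x; exact: normal_pdf_ge0.
  move: X2 X2'; rewrite (law _ mq (fun x => sqr_ge0 x)) (law _ mq1 (fun x => sqr_ge0 _)).
  have := normal_second_moment m s0 0; under eq_integral do rewrite addr0.
  move=> ->; rewrite (normal_second_moment m s0 1) addr0 => -[e1] [e2].
  have m0 : m = 0 by nra.
  have vE : v = s ^+ 2 by rewrite -e1 m0 expr0n/= addr0.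
  rewrite (law _ mc1 c0).
  have ip : (@lebesgue_measure R).-integrable [set: _] (EFin \o normal_pdf m s).
    exact: integrable_normal_pdf.
  have icp : (@lebesgue_measure R).-integrable [set: _] (EFin \o (fun x => cos (u * x + b) * normal_pdf m s x)).
    apply: (integrable_dom _ _ ip) => //.
      by apply: measurable_funM => //; exact: measurable_normal_pdf.
    move=> x _; rewrite normrM (ger0_norm (normal_pdf_ge0 _ _ _)).
    by rewrite ler_piMl ?normal_pdf_ge0// cos_max.
  under eq_integral do rewrite mulrDl mul1r EFinD.
  rewrite integralD// integral_normal_pdf EFinD; congr (_ + _)%E.
  have := normal_cos m s0 b u; rewrite m0; under eq_Rintegral do rewrite subr0.
  by rewrite m0 in icp *; rewrite vE => <-; rewrite fineK//; exact: integrable_fin_num.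
Qed.

End GaussianCos.

(** * Decorrelation of cosines of the process *)

Section StationaryPairs.
Context d (Omega : measurableType d) (R : realType) (P : probability Omega R).
Variable xi : R -> Omega -> R.
Hypothesis xi_measurable : measurable_process xi.
Hypothesis xi_stationary : stationary_process P xi.

Lemma measurable_process_section t : measurable_fun [set: Omega] (xi t).
Proof.
have := @measurableT_comp _ _ _ _ _ _ _ _ _ xi_measurable (pair1_measurable (t : measurableTypeR R)).
exact.
Qed.

(** Stationarity says that the two pairs have laws agreeing on rectangles, and
    rectangles determine a finite measure on the plane. *)
Lemma stationary_pair (F : R * R -> R) (s t : R) :
  measurable_fun [set: (measurableTypeR R * measurableTypeR R)%type] F ->
  (forall z, 0 <= F z) ->
  (\int[P]_w (F (xi s w, xi t w))%:E = \int[P]_w (F (xi 0 w, xi (t - s)%R w))%:E)%E.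
Proof.
move=> mF F0.
pose T2 : measurableType _ := (measurableTypeR R * measurableTypeR R)%type.
pose Z1 w : T2 := (xi s w, xi t w).
pose Z2 w : T2 := (xi 0 w, xi (t - s) w).
have mZ1 : measurable_fun [set: Omega] Z1.
  by apply: measurable_fun_pair; exact: measurable_process_section.
have mZ2 : measurable_fun [set: Omega] Z2.
  by apply: measurable_fun_pair; exact: measurable_process_section.
pose X1 : {mfun Omega >-> T2} := HB.pack Z1 (isMeasurableFun.Build _ _ _ _ Z1 mZ1).
pose X2 : {mfun Omega >-> T2} := HB.pack Z2 (isMeasurableFun.Build _ _ _ _ Z2 mZ2).
have mF' : measurable_fun [set: T2] (EFin \o F) by exact/measurable_EFinP.
have F0' z : (0 <= (EFin \o F) z)%E by rewrite lee_fin.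
have := @ge0_integral_distribution _ _ _ T2 R P X1 _ mF' F0'.
have := @ge0_integral_distribution _ _ _ T2 R P X2 _ mF' F0'.
rewrite /comp/= => <- <-.
apply: eq_measure_integral => A mA _; rewrite /distribution.
pose C : set (set T2) :=
  [set C | exists A, measurable A /\ exists B, measurable B /\ C = A `*` B].
pose m1 : {measure set T2 -> \bar R} := distribution P X1.
pose m2 : {measure set T2 -> \bar R} := distribution P X2.
apply: (@measure_unique _ R T2 C (fun=> setT) _ _ _ _ m1 m2).
- rewrite measurable_prod_measurableType //; congr (<<s _ >>).
  rewrite predeqE; split => [[A' mA' [B mB <-]]|[A' [mA' [B [mB ->]]]]].
    by exists A'; split => //; exists B.
  by exists A' => //; exists B.
- move=> /= _ _ [W1 [mW1 [W2 [mW2 ->]]]] [Y1 [mY1 [Y2 [mY2 ->]]]].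
  rewrite -setXI; exists (W1 `&` Y1); split; first exact: measurableI.
  by exists (W2 `&` Y2); split => //; exact: measurableI.
- by move=> _; exists setT; split => //; exists setT; split => //; rewrite setXTT.
- by rewrite bigcup_const//; exists 0%N.
- move=> _ [A1 [mA1 [A2 [mA2 ->]]]].
  pose tt (i : 'I_2) : R := if i == ord0 then 0 else t - s.
  pose AA (i : 'I_2) : set (measurableTypeR R) := if i == ord0 then A1 else A2.
  have := @xi_stationary 2 tt s AA; rewrite /m1 /m2 /= /distribution /pushforward /tt /AA => H.
  have E1 : [set w | forall i : 'I_2, AA i (xi (tt i + s) w)] = Z1 @^-1` (A1 `*` A2).
    apply/seteqP; split => w /=.
      move=> h; split; first by have := h ord0; rewrite /AA /tt/= add0r.
      by have := h ord_max; rewrite /AA /tt/= subrK.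
    move=> [h1 h2] i; rewrite /AA /tt; case: eqP => _; first by rewrite add0r.
    by rewrite subrK.
  have E2 : [set w | forall i : 'I_2, AA i (xi (tt i) w)] = Z2 @^-1` (A1 `*` A2).
    apply/seteqP; split => w /=.
      move=> h; split; first by have := h ord0; rewrite /AA /tt/=.
      by have := h ord_max; rewrite /AA /tt/=.
    by move=> [h1 h2] i; rewrite /AA /tt; case: eqP.
  by rewrite -E1 -E2; apply: H => i; case: eqP.
- by move=> _; rewrite /m1 /= /distribution /pushforward preimage_setT probability_setT ltry.
- by [].
Qed.

End StationaryPairs.

Section GaussianProcess.
Context d (Omega : measurableType d) (R : realType) (P : probability Omega R).
Variable xi : R -> Omega -> R.
Variable B : R -> R.
Hypothesis xi_measurable : measurable_process xi.
Hypothesis xi_stationary : stationary_process P xi.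
Hypothesis xi_gaussian : gaussian_process P xi.
Hypothesis xi_mean : forall t, ('E_P[xi t] = 0)%E.
Hypothesis xi_var : forall t, ('E_P[fun w => (xi t w ^+ 2)%R] = 1)%E.
Hypothesis xi_cov : forall t, ('E_P[fun w => (xi 0%R w * xi t w)%R] = (B t)%:E)%E.

Let mxi t : measurable_fun [set: Omega] (xi t).
Proof. exact: measurable_process_section. Qed.

Let i1 : P.-integrable [set: _] (EFin \o (fun w : Omega => 1 : R)).
Proof. exact: finite_measure_integrable_cst. Qed.

Let ixi2 t : P.-integrable [set: _] (EFin \o (fun w => xi t w ^+ 2)).
Proof.
apply/integrableP; split; first exact/measurable_EFinP/measurable_funX.
under eq_integral do rewrite /= ger0_norm ?sqr_ge0//.
by have := xi_var t; rewrite unlock => ->; rewrite ltry.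
Qed.

Let ixi t : P.-integrable [set: _] (EFin \o xi t).
Proof.
apply: (integrable_dom _ _ (integrableDr _ i1 (ixi2 t))) => // w _.
have := normr_ge0 (xi t w); rewrite -[xi t w ^+ 2]real_normK ?num_real//; nra.
Qed.

Let ixixi s t : P.-integrable [set: _] (EFin \o (fun w => xi s w * xi t w)).
Proof.
apply: (integrable_dom _ _ (integrableDr _ (ixi2 s) (ixi2 t))) => //.
  exact: measurable_funM.
move=> w _; rewrite ler_norml; apply/andP.
by have := sqr_ge0 (xi s w + xi t w); have := sqr_ge0 (xi s w - xi t w); split; nra.
Qed.

Lemma process_second_moment (s t c : R) :
  (\int[P]_w ((xi s w + c * xi t w) ^+ 2)%:E = (1 + c ^+ 2 + 2 * c * B (t - s))%:E)%E.
Proof.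
rewrite (@stationary_pair _ _ _ P xi _ _ (fun z => (z.1 + c * z.2) ^+ 2))//; last 2 first.
- apply: measurable_funX; apply: measurable_funD; first exact: measurable_fst.
  by apply: measurable_funM => //; exact: measurable_snd.
- by move=> z; exact: sqr_ge0.
have E w : (xi 0 w + c * xi (t - s) w) ^+ 2 =
   (xi 0 w ^+ 2 + c ^+ 2 * xi (t - s) w ^+ 2) + 2 * c * (xi 0 w * xi (t - s) w) by ring.
have J1 := integrable_scale measurableT (c ^+ 2) (ixi2 (t - s)).
have J2 := integrable_scale measurableT (2 * c) (ixixi 0 (t - s)).
have J3 := integrableDr measurableT (ixi2 0) J1.
under eq_integral do rewrite E EFinD.
rewrite integralD//.
under eq_integral do rewrite EFinD.
rewrite integralD//.
under [X in (_ + X + _)%E]eq_integral do rewrite EFinM.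
under [X in (_ + _ + X)%E]eq_integral do rewrite EFinM.
rewrite !integralZl//.
have := xi_var 0; rewrite unlock => ->.
have := xi_var (t - s); rewrite unlock => ->.
have := xi_cov (t - s); rewrite unlock => ->.
by rewrite mule1.
all: first [exact: ixixi | exact: ixi2].
Qed.

Lemma process_cos_pair (s t c u b : R) :
  (\int[P]_w (cos (u * (xi s w + c * xi t w) + b))%:E =
   (cos b * expR (- (u ^+ 2 * (1 + c ^+ 2 + 2 * c * B (t - s)) / 2)))%:E)%E.
Proof.
apply: (@gaussian_cos _ _ _ P (fun w => xi s w + c * xi t w)).
- by apply: measurable_funD => //; exact: measurable_funM.
- have := @xi_gaussian 2 (fun i => if i == ord0 then 1 else c) (fun i => if i == ord0 then s else t).
  congr (gaussian_rv P _); apply/funext => w.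
  by rewrite !big_ord_recl big_ord0/= mul1r addr0.
- have J := integrable_scale measurableT c (ixi t).
  under eq_integral do rewrite EFinD.
  rewrite integralD//.
  under [X in (_ + X)%E]eq_integral do rewrite EFinM.
  rewrite integralZl//.
  have := xi_mean s; rewrite unlock => ->.
  by have := xi_mean t; rewrite unlock => ->; rewrite mule0 adde0.
  all: try exact: ixi.
- exact: process_second_moment.
Qed.

Lemma process_cos (t u b : R) :
  (\int[P]_w (cos (u * xi t w + b))%:E = (cos b * expR (- (u ^+ 2 / 2)))%:E)%E.
Proof.
have := process_cos_pair t t 0 u b.
under eq_integral do rewrite mul0r addr0.
by move=> ->; rewrite expr0n/= mulr0 mul0r !addr0 mulr1.
Qed.

(** Applying [process_cos_pair] with c = 1 and c = -1, product-to-sum gives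
    the covariance in closed form, a continuous function of B (t - s) that
    vanishes with it. *)
Lemma process_cos_cov (u b e : R) : 0 < e ->
  exists2 del, 0 < del & forall s t, `|B (t - s)| < del ->
    `|\int[P]_w ((cos (u * xi s w + b) - cos b * expR (- (u ^+ 2 / 2))) *
                 (cos (u * xi t w + b) - cos b * expR (- (u ^+ 2 / 2))))| <= e.
Proof.
move=> e0; set m := cos b * _.
have mc (c : R) t : measurable_fun [set: Omega] (fun w => cos (u * xi t w + c)).
  apply: (measurableT_comp (f := cos)); first by apply: continuous_measurable_fun; exact: continuous_cos.
  by apply: measurable_funD => //; apply: measurable_funM.
have ic t : P.-integrable [set: _] (EFin \o (fun w => cos (u * xi t w + b))).
  by apply: (integrable_dom _ _ i1) => // w _; exact: cos_max.
have icc s t c b' : P.-integrable [set: _] (EFin \o (fun w => cos (u * (xi s w + c * xi t w) + b'))).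
  apply: (integrable_dom _ _ i1) => //; last by move=> w _; exact: cos_max.
  apply: (measurableT_comp (f := cos)); first by apply: continuous_measurable_fun; exact: continuous_cos.
  by apply: measurable_funD => //; apply: measurable_funM => //; apply: measurable_funD => //; apply: measurable_funM.
have val s t : \int[P]_w ((cos (u * xi s w + b) - m) * (cos (u * xi t w + b) - m)) =
   2^-1 * expR (- u ^+ 2) * (cos (2 * b) * (expR (- (u ^+ 2 * B (t - s))) - 1) +
      (expR (u ^+ 2 * B (t - s)) - 1)).
  have E w : (cos (u * xi s w + b) - m) * (cos (u * xi t w + b) - m) =
     2^-1 * cos (u * (xi s w + 1 * xi t w) + 2 * b) +
     (2^-1 * cos (u * (xi s w + -1 * xi t w) + 0) +
      ((- m) * cos (u * xi s w + b) + ((- m) * cos (u * xi t w + b) + m ^+ 2 * 1))).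
    have -> : u * (xi s w + 1 * xi t w) + 2 * b = (u * xi s w + b) + (u * xi t w + b) by ring.
    have -> : u * (xi s w + -1 * xi t w) + 0 = (u * xi s w + b) - (u * xi t w + b) by ring.
    rewrite (cosD (u * xi s w + b) (u * xi t w + b)) (cosB (u * xi s w + b) (u * xi t w + b)).
    by field.
  under eq_Rintegral do rewrite E.
  have J1 := integrable_scale measurableT 2^-1 (icc s t 1 (2 * b)).
  have J2 := integrable_scale measurableT 2^-1 (icc s t (-1) 0).
  have J3 := integrable_scale measurableT (- m) (ic s).
  have J4 := integrable_scale measurableT (- m) (ic t).
  have J5 := integrable_scale measurableT (m ^+ 2) i1.
  have J45 := integrableDr measurableT J4 J5.
  have J345 := integrableDr measurableT J3 J45.
  have J2345 := integrableDr measurableT J2 J345.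
  rewrite RintegralD// RintegralD// RintegralD// RintegralD// !RintegralZl//.
  rewrite {1 2 3 4}/Rintegral !process_cos_pair !process_cos /= -/m.
  have -> : \int[P]_w (1 : R) = 1 by rewrite /Rintegral integral_cst//= mul1e probability_setT.
  set b2 := B _.
  rewrite cos0.
  have -> : expR (- (u ^+ 2 * (1 + 1 ^+ 2 + 2 * 1 * b2) / 2)) = expR (- u ^+ 2) * expR (- (u ^+ 2 * b2)).
    by rewrite -expRD; congr expR; field.
  have -> : expR (- (u ^+ 2 * (1 + (-1) ^+ 2 + 2 * -1 * b2) / 2)) = expR (- u ^+ 2) * expR (u ^+ 2 * b2).
    by rewrite -expRD; congr expR; field.
  have m2 : m ^+ 2 = 2^-1 * (1 + cos (2 * b)) * expR (- u ^+ 2).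
    rewrite /m exprMn -expRM_natl.
    have -> : 2%:R * - (u ^+ 2 / 2) = - u ^+ 2 by field.
    congr (_ * _); have -> : 2 * b = b + b by ring.
    rewrite cosD; have := cos2Dsin2 b; lra.
  have -> : forall x y : R, 2^-1 * x + (2^-1 * y + (- m * m + (- m * m + m ^+ 2 * 1))) = 2^-1 * x + 2^-1 * y - m ^+ 2 by move=> x y; ring.
  by rewrite m2; ring.
have c1 : {for 0, continuous (fun x : R => expR (u ^+ 2 * x))}.
  apply: continuous_comp; last exact: continuous_expR.
  by apply: cvgM; [exact: cvg_cst|exact: cvg_id].
have /cvgrPdist_lt/(_ e e0) := c1; rewrite mulr0 expR0.
move=> /nbhs_ballP[del /= del0 Hd].
exists del => // s t Bd.
rewrite val normrM (le_trans (ler_wpM2l (normr_ge0 _) (ler_normD _ _)))//.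
rewrite (normrM (cos (2 * b))).
have h1 : `|expR (- (u ^+ 2 * B (t - s))) - 1| < e.
  rewrite distrC -mulrN; apply: Hd; rewrite /ball/= sub0r opprK; exact: Bd.
have h2 : `|expR (u ^+ 2 * B (t - s)) - 1| < e.
  by rewrite distrC; apply: Hd; rewrite /ball/= sub0r normrN.
have h3 := cos_max (2 * b).
have h4 : `|2^-1 * expR (- u ^+ 2)| <= 2^-1.
  rewrite ger0_norm; last by rewrite mulr_ge0// expR_ge0.
  by rewrite ler_piMr// -[leRHS]expR0 ler_expR oppr_le0 sqr_ge0.
have h5 : `|cos (2 * b)| * `|expR (- (u ^+ 2 * B (t - s))) - 1| <= e.
  by rewrite -[leRHS]mul1r ler_pM// ltW.
apply: (@le_trans _ _ (2^-1 * (e + e))); last by lra.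
by apply: ler_pM => //; apply: lerD => //; exact: ltW.
Qed.

End GaussianProcess.

(** Each weight D_j multiplies a term at most (1 + t^2)^(-alpha_j / 2), and
    the weights sum to 1. *)
Lemma cyclic_covariance_decay (R : realType) (kappa : nat)
    (D vk alpha : 'I_kappa.+1 -> R) :
  (forall j, 0 <= D j) -> \sum_(j < kappa.+1) D j = 1 ->
  (forall j, 0 < alpha j) ->
  forall e : R, 0 < e -> exists A : R, forall t : R, A < `|t| ->
    `|cyclic_covariance D vk alpha t| < e.
Proof.
move=> D0 D1 a0 e e0.
have e20 : 0 < 2 / e by rewrite divr_gt0.
(* the value where (1 + t^2)^(alpha_j / 2) reaches 2 / e, in terms of 1 + t^2 *)
pose A j := (2 / e) `^ (2 / alpha j).
exists (1 + \sum_j A j) => t At.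
have Aj j : A j <= 1 + t ^+ 2.
  have h : A j <= \sum_j A j.
    by rewrite (bigD1 j)//= lerDl sumr_ge0// => i _; exact: powR_ge0.
  have : 1 + A j <= `|t| by apply: ltW; apply: le_lt_trans At; rewrite lerD2l.
  have := powR_ge0 (2 / e) (2 / alpha j); rewrite -/(A j).
  rewrite -[t ^+ 2]real_normK ?num_real//; nra.
have t20 : 0 < 1 + t ^+ 2 by rewrite ltr_pwDl// sqr_ge0.
have bound j : `|cos (vk j * t) / (1 + t ^+ 2) `^ (alpha j / 2)| <= e / 2.
  have h1 : 2 / e <= (1 + t ^+ 2) `^ (alpha j / 2).
    have -> : 2 / e = A j `^ (alpha j / 2).
      rewrite /A -powRrM.
      have -> : 2 / alpha j * (alpha j / 2) = 1 by have := a0 j => ?; field; lra.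
      by rewrite powRr1// ltW.
    apply: ge0_ler_powR => //; rewrite ?nnegrE; [|exact: powR_ge0|exact: ltW].
    by rewrite divr_ge0// ltW.
  have p0 : 0 < (1 + t ^+ 2) `^ (alpha j / 2) by apply: lt_le_trans h1.
  rewrite normrM [`|_ ^-1|]gtr0_norm ?invr_gt0//.
  rewrite ler_pdivrMr//; apply: (le_trans (cos_max _)).
  have : e / 2 * (2 / e) <= e / 2 * (1 + t ^+ 2) `^ (alpha j / 2).
    by rewrite ler_wpM2l// divr_ge0// ltW.
  by apply: le_trans; rewrite le_eqVlt; apply/orP; left; apply/eqP; field; lra.
apply: (@le_lt_trans _ _ (\sum_(j < kappa.+1) D j * (e / 2))).
  apply: (le_trans (ler_norm_sum _ _ _)); apply: ler_sum => j _.
  by rewrite normrM (ger0_norm (D0 j)) ler_wpM2l.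
rewrite -mulr_suml D1; lra.
Qed.

(** * Events of probability close to one *)

Section Likely.
Context d (Omega : measurableType d) (R : realType) (P : probability Omega R).
Implicit Types E F : R -> set Omega.

(** The quantifier over [eta] makes this stable under finite intersections and
    under perturbations, one level at a time; the single family of events asked
    for by [with_probability_tending_to_1] is recovered in [likely_wp1]. *)
Definition likely E : Prop := forall eta : R, 0 < eta ->
  \forall T \near +oo%R, exists A : set Omega,
    [/\ measurable A, A `<=` E T & ((1 - eta)%:E <= P A)%E].

Lemma likely_sub E F : (\forall T \near +oo%R, E T `<=` F T) -> likely E -> likely F.
Proof.
move=> EF LE eta /LE; apply: filterS2 EF => T EF [A [mA AE PA]].
by exists A; split => //; apply: subset_trans EF.
Qed.

Lemma likelyI E F : likely E -> likely F -> likely (fun T => E T `&` F T).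
Proof.
move=> LE LF eta eta0; have eta2 : 0 < eta / 2 by rewrite divr_gt0.
apply: filterS2 (LE _ eta2) (LF _ eta2) => T [A [mA AE PA]] [B [mB BF PB]].
exists (A `&` B); split; [exact: measurableI| |].
  by move=> w [Aw Bw]; split; [exact: AE|exact: BF].
have U : (P (~` (A `&` B)) <= P (~` A) + P (~` B))%E.
  by rewrite setCI; apply: measureU2; exact: measurableC.
have PE X : measurable X -> P X = (fine (P X))%:E.
  by move=> mX; rewrite fineK// fin_num_measure.
move: U PA PB; rewrite !probability_setC//; last exact: measurableI.
rewrite (PE _ mA) (PE _ mB) (PE _ (measurableI _ _ mA mB)).
rewrite -[1%E]/(1%:E) -!EFinB -EFinD !lee_fin; lra.
Qed.

Lemma likely_forall n (E : 'I_n -> R -> set Omega) :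
  (forall i, likely (E i)) -> likely (fun T => [set w | forall i, E i T w]).
Proof.
elim: n E => [|n IH] E LE.
  move=> eta eta0; apply: nearW => T; exists setT; split => //.
    by move=> w _ [].
  by rewrite probability_setT lee_fin; lra.
have := likelyI (LE ord0) (IH _ (fun i => LE (lift ord0 i))).
apply: likely_sub; apply: nearW => T w [/= E0 Ei] i.
by case: (unliftP ord0 i) => [j ->|->].
Qed.

Let fineP_le1 A : measurable A -> fine (P A) <= 1.
Proof.
by move=> mA; rewrite -lee_fin fineK ?fin_num_measure//; exact: probability_le1.
Qed.

(** For each T, choose a measurable subset of E T whose probability is within
    1 / T of the supremum over measurable subsets. *)
Lemma likely_wp1 E : likely E -> with_probability_tending_to_1 P E.
Proof.
move=> LE.
pose V T := [set fine (P A) | A in [set A | measurable A /\ A `<=` E T]].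
have V0 T : V T !=set0 by exists (fine (P set0)), set0 => //; split => //; exact: sub0set.
have Vub T : has_ubound (V T).
  by exists 1 => _ [A [mA _] <-]; exact: fineP_le1.
have ex T : exists A, [/\ measurable A, A `<=` E T &
    forall x, V T x -> 0 < T -> x - T^-1 < fine (P A)].
  have [T0|T0] := ltP 0 T; last first.
    by exists set0; split => // x _ T1; move: T0; rewrite leNgt T1.
  have : 0 < T^-1 by rewrite invr_gt0.
  move=> /(sup_adherent)/(_ (conj (V0 T) (Vub T)))[_ [A [mA AE] <-] h].
  exists A; split => // x Vx _; apply: le_lt_trans h.
  by rewrite lerD2r; exact: (ub_le_sup (Vub T)) Vx.
have {ex}/choice[A HA] := ex.
exists A; split; [by move=> T; case: (HA T)|by move=> T; case: (HA T)|].
rewrite (_ : (fun T => P (A T)) = (fun T => (fine (P (A T)))%:E)); last first.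
  by apply/funext => T; rewrite fineK// fin_num_measure//; case: (HA T).
apply: cvg_EFin; first exact: nearW.
apply/cvgrPdist_le => e e0; have e2 : 0 < e / 2 by rewrite divr_gt0.
near=> T; have [B [mB BE PB]] : exists A : set Omega,
    [/\ measurable A, A `<=` E T & ((1 - e / 2)%:E <= P A)%E].
  by near: T; exact: LE.
have T0 : 0 < T by near: T; exact: nbhs_pinfty_gt.
have [mA _ /(_ (fine (P B))) hA] := HA T.
have PA1 : fine (P (A T)) <= 1.
  exact: fineP_le1.
have {}PB : 1 - e / 2 <= fine (P B).
  by rewrite -lee_fin fineK ?fin_num_measure.
have TV : T^-1 <= e / 2.
  rewrite -[leRHS]invrK lef_pV2 ?posrE ?invr_gt0//.
have := hA (ex_intro2 _ _ B (conj mB BE) erefl) T0.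
rewrite /= ger0_norm; lra.
Unshelve. all: by end_near. Qed.

(** Markov's inequality, turned into a lower bound for the good event. *)
Lemma markov_event (Y : Omega -> \bar R) (c e : R) :
  measurable_fun [set: Omega] Y -> (forall w, (0 <= Y w)%E) -> 0 < c ->
  (\int[P]_w Y w <= e%:E)%E ->
  measurable [set w | (Y w < c%:E)%E] /\
  ((1 - e / c)%:E <= P [set w | (Y w < c%:E)%E])%E.
Proof.
move=> mY Y0 c0 Ye.
have mS : measurable [set w | (Y w < c%:E)%E].
  by have := emeasurable_fun_infty_o measurableT mY c%:E; rewrite setTI.
split => //.
have mC : measurable [set w | (c%:E <= Y w)%E].
  by have := emeasurable_fun_c_infty measurableT mY c%:E; rewrite setTI.
have SE : [set w | (Y w < c%:E)%E] = ~` [set w | (c%:E <= Y w)%E].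
  by apply/seteqP; split => w /=; rewrite ltNge => /negP.
rewrite SE probability_setC//.
have : (c%:E * P [set w | (c%:E <= Y w)%E] <= e%:E)%E.
  apply: le_trans Ye.
  have := @le_integral_comp_abse _ _ R P setT measurableT Y c id _ _ _ mY c0.
  rewrite setTI; under eq_integral do rewrite gee0_abs//.
  have -> : [set x | (c%:E <= `|Y x|)%E] = [set w | (c%:E <= Y w)%E].
    by apply/seteqP; split => x /=; rewrite gee0_abs.
  apply => //; exact: measurable_id.
have PE X : measurable X -> P X = (fine (P X))%:E.
  by move=> mX; rewrite fineK// fin_num_measure.
rewrite (PE _ mC) -EFinM lee_fin => H.
rewrite -[1%E]/(1%:E) -EFinB lee_fin lerD2l lerN2 ler_pdivlMr//.
by rewrite mulrC.
Qed.

End Likely.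

(** * Mean-square bound for weighted time averages *)

Lemma bounded_rv_integrable d (Omega : measurableType d) (R : realType)
    (P : probability Omega R) (h : Omega -> R) (K : R) :
  measurable_fun [set: Omega] h -> (forall w, `|h w| <= K) ->
  P.-integrable [set: _] (EFin \o h).
Proof.
move=> mh hK; have := @finite_measure_integrable_cst _ Omega R P setT K measurableT.
by move=> /(integrable_dom measurableT mh); apply => w _ /=.
Qed.

Section FubiniBounded.
Context d (Omega : measurableType d) (R : realType) (P : probability Omega R).
Notation leb := (@lebesgue_measure R).
Variables (T : R) (k : (measurableTypeR R * Omega)%type -> R) (K : R).
Hypothesis mk : measurable_fun [set: (measurableTypeR R * Omega)%type] k.
Hypothesis K0 : 0 <= K.
Hypothesis kK : forall z, `|k z| <= K.
Let D : set (measurableTypeR R) := `[0, T]%classic.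

Let mD : measurable D. Proof. exact: measurable_itv. Qed.

Let Dfin : (leb D < +oo)%E.
Proof. by rewrite /D lebesgue_measure_itv /=; case: ifP => _; rewrite ?ltry// -EFinD ltry. Qed.

Let f (z : (measurableTypeR R * Omega)%type) : \bar R := (k z * \1_D z.1)%:E.

Let mf : measurable_fun [set: (measurableTypeR R * Omega)%type] f.
Proof.
apply/measurable_EFinP; apply: measurable_funM => //.
by apply: (measurableT_comp (f := \1_D : measurableTypeR R -> R)) => //; exact: measurable_indic.
Qed.

Let fi : (leb \x P)%E.-integrable [set: _] f.
Proof.
apply: (proj2 (@integrable12ltyP _ _ (measurableTypeR R) Omega R leb P f mf)).
apply: (@le_lt_trans _ _ (\int[leb]_x (K * \1_D x)%:E)%E).
  apply: ge0_le_integral => //.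
  - by move=> x _; apply: integral_ge0.
  - have := measurable_fun_fubini_tonelli_F (m2 := P) (abse \o f).
    apply; last by move=> z; exact: abse_ge0.
    exact: measurableT_comp.
  - apply/measurable_EFinP; apply: measurable_funM => //; exact: measurable_indic.
  - move=> t _; apply: (@le_trans _ _ (\int[P]_w (K * \1_D t)%:E)%E); last first.
      by rewrite integral_cst//= probability_setT mule1.
    apply: ge0_le_integral => //.
    + apply: measurableT_comp => //.
      by have := measurableT_comp mf (pair1_measurable t); exact.
    + move=> w _; rewrite /f /= lee_fin normrM.
      by rewrite [X in _ * X]ger0_norm// ler_wpM2r.
under eq_integral do rewrite EFinM.
rewrite ge0_integralZl//; last first.
  by apply/measurable_EFinP; exact: measurable_indic.
rewrite integral_indic// setIT lte_mul_pinfty// lee_fin//.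
Qed.

Let FE t : (\int[P]_w k (t, w)) * \1_D t = fine (\int[P]_w f (t, w))%E.
Proof.
rewrite /f /= indicE; case: (t \in D) => /=.
  by rewrite mulr1 /Rintegral; congr fine; apply: eq_integral => w _; rewrite mulr1.
by rewrite mulr0; under eq_integral do rewrite mulr0; rewrite integral0.
Qed.

Let GE w : \int[leb]_(t in D) k (t, w) = fine (\int[leb]_t f (t, w))%E.
Proof.
rewrite Rintegral_mkcond /Rintegral; congr fine; apply: eq_integral => t _.
by rewrite /f /= patchE indicE; case: (t \in D); rewrite ?mulr1 ?mulr0.
Qed.

Lemma measurable_path_average :
  measurable_fun [set: Omega] (fun w => \int[leb]_(t in D) k (t, w)).
Proof.
under eq_fun do rewrite GE.
apply: (measurableT_comp (f := fine)) => //.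
exact: (measurable_fubini_G fi).
Qed.

Let intf t : P.-integrable [set: _] (fun w => f (t, w)).
Proof.
have H : measurable_fun [set: Omega] (fun w => f (t, w)).
  by have := measurableT_comp mf (pair1_measurable (t : measurableTypeR R)); exact.
have := @finite_measure_integrable_cst _ Omega R P setT K measurableT.
apply: le_integrable => // w _ /=; rewrite lee_fin normrM.
apply: le_trans (ler_norm _).
rewrite -[leRHS]mulr1 ler_pM//.
by rewrite indicE; case: (_ \in _); rewrite ?normr1 ?normr0.
Qed.

Lemma fubini_path :
  \int[leb]_(t in D) (\int[P]_w k (t, w)) = \int[P]_w (\int[leb]_(t in D) k (t, w)).
Proof.
rewrite Rintegral_mkcond.
transitivity (fine (\int[leb]_t \int[P]_w f (t, w))%E).
  rewrite /Rintegral; congr fine; apply: eq_integral => t _.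
  rewrite -[RHS]fineK; last exact: integrable_fin_num.
  by congr EFin; rewrite -FE patchE indicE; case: (t \in D); rewrite ?mulr1 ?mulr0.
rewrite (Fubini fi) /Rintegral; congr fine.
have [N [mN N0 NE]] := ae_integrable2 fi.
apply: ae_eq_integral => //.
- by have := measurable_fubini_G fi; exact.
- exact/measurable_EFinP/measurable_path_average.
- exists N; split => // w /= H; apply: NE => /= H'; apply: H => _.
  rewrite -/(Rintegral leb D (fun t => k (t, w))) GE fineK//.
  exact: integrable_fin_num.
Qed.

Lemma measurable_mean_path :
  measurable_fun D (fun t => \int[P]_w k (t, w)).
Proof.
have : measurable_fun D (fun t => fine (\int[P]_w f (t, w))%E).
  apply: measurable_funTS; apply: (measurableT_comp (f := fine)) => //.
  exact: (measurable_fubini_F fi).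
apply: eq_measurable_fun => t tD.
by rewrite -FE indicE tD mulr1.
Qed.

End FubiniBounded.

Section WeakLLN.
Context d (Omega : measurableType d) (R : realType) (P : probability Omega R).
Notation leb := (@lebesgue_measure R).
Variables (eta : R -> Omega -> R) (C : R).
Hypothesis meta : measurable_process eta.
Hypothesis C0 : 0 <= C.
Hypothesis etaC : forall t w, `|eta t w| <= C.

(** The double integral over [0, T]^2 of a s * a t * E (eta s * eta t) is split
    according to |t - s| <= A, where the integrand is at most C^2, or not, where
    it is at most e. To apply Fubini only once at a time, one of the two path
    integrals is kept as a bounded random variable [Z]. *)
Lemma weak_lln_bound (e A T : R) (a : R -> R) : 0 <= e -> 0 <= A -> 0 < T ->
  (forall s t, A < `|t - s| -> `|\int[P]_w (eta s w * eta t w)| <= e) ->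
  measurable_fun [set: R] a -> (forall t, `|a t| <= 1) ->
  \int[P]_w ((\int[leb]_(t in `[0, T]) (a t * eta t w)) ^+ 2) <=
    T * (e * T + 2 * A * C ^+ 2).
Proof.
move=> e0 A0 T0 He ma a1.
pose D : set (measurableTypeR R) := `[0, T]%classic.
have mD : measurable D by exact: measurable_itv.
have lebD : leb D = T%:E by rewrite lebesgue_measure_itv/= lte_fin T0 oppr0 adde0.
have Dfin : (leb D < +oo)%E by rewrite lebD ltry.
have Rcst (r : R) : \int[leb]_(t in D) r = r * T.
  by rewrite Rintegral_cst//; congr (_ * _); exact: (congr1 fine lebD).
have ma' : measurable_fun [set: (measurableTypeR R * Omega)%type] (fun z => a z.1).
  by apply: (measurableT_comp (f := a)) => //; exact: measurable_fst.
pose Z w := \int[leb]_(t in D) (a t * eta t w).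
have k1b z : `|a z.1 * eta z.1 z.2| <= C.
  by rewrite normrM -[leRHS]mul1r ler_pM.
have mk1 : measurable_fun [set: (measurableTypeR R * Omega)%type] (fun z => a z.1 * eta z.1 z.2).
  exact: measurable_funM.
have mZ : measurable_fun [set: Omega] Z by exact: (@measurable_path_average _ _ _ P T _ C mk1 C0 k1b).
have mpath w : measurable_fun D (fun t => a t * eta t w).
  apply: measurable_funTS; have := measurableT_comp mk1 (pair2_measurable w); exact.
have ipath w : leb.-integrable D (EFin \o (fun t => a t * eta t w)).
  apply: measurable_bounded_integrable => //.
  by exists C; split; [exact: num_real|move=> x Cx t _; exact: le_trans (k1b (t, w)) (ltW Cx)].
have normint (h : R -> R) K : measurable_fun D h -> 0 <= K -> (forall t, D t -> `|h t| <= K) ->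
    `|\int[leb]_(t in D) h t| <= K * T.
  move=> mh K0 hK.
  have ih : leb.-integrable D (EFin \o h).
    apply: measurable_bounded_integrable => //.
    by exists K; split; [exact: num_real|move=> x Cx t Dt; exact: le_trans (hK t Dt) (ltW Cx)].
  apply: (le_trans (le_normr_Rintegral _ ih)) => //.
  rewrite -Rcst.
  apply: le_Rintegral => //.
  - exact: integrable_norm.
  - apply: measurable_bounded_integrable => //; exact: bounded_cst.
have Zb w : `|Z w| <= C * T by apply: normint => // t _; exact: (k1b (t, w)).
have meanb (t : R) : `|\int[P]_w (eta t w * Z w)| <= e * T + 2 * A * C ^+ 2.
  pose k3 (z : (measurableTypeR R * Omega)%type) := a z.1 * eta z.1 z.2 * eta t z.2.
  have met : measurable_fun [set: (measurableTypeR R * Omega)%type] (fun z => eta t z.2).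
    apply: (measurableT_comp (f := eta t)); last exact: measurable_snd.
    exact: measurable_process_section.
  have mk3 : measurable_fun [set: (measurableTypeR R * Omega)%type] k3 by exact: measurable_funM.
  have CC0 : 0 <= C * C by rewrite mulr_ge0.
  have k3b z : `|k3 z| <= C * C by rewrite /k3 normrM ler_pM.
  have -> : \int[P]_w (eta t w * Z w) = \int[leb]_(s in D) (\int[P]_w k3 (s, w)).
    rewrite (@fubini_path _ _ _ P T _ _ mk3 CC0 k3b); apply: eq_Rintegral => w _.
    rewrite mulrC -RintegralZr//; exact: ipath.
  have mk3m := @measurable_mean_path _ _ _ P T _ _ mk3 CC0 k3b.
  pose I : set (measurableTypeR R) := `[t - A, t + A]%classic.
  have mI : measurable I by exact: measurable_itv.
  have k3s s : `|\int[P]_w k3 (s, w)| <= e + C * C * \1_I s.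
    have -> : \int[P]_w k3 (s, w) = a s * \int[P]_w (eta s w * eta t w).
      rewrite -RintegralZl//; first by apply: eq_Rintegral => w _; rewrite /k3/= mulrA.
      apply: (@bounded_rv_integrable _ _ _ _ _ (C * C)).
        by apply: measurable_funM; exact: measurable_process_section.
      by move=> w; rewrite normrM ler_pM.
    rewrite normrM; apply: (@le_trans _ _ `|\int[P]_w (eta s w * eta t w)|).
      by rewrite ler_piMl.
    have [sI|sI] := boolP (s \in I); rewrite indicE ?sI ?(negbTE sI) ?mulr1 ?mulr0 ?addr0.
      apply: (@le_trans _ _ (C * C)); last by rewrite lerDr.
      have iee : P.-integrable [set: _] (EFin \o (fun w => eta s w * eta t w)).
        apply: (@bounded_rv_integrable _ _ _ _ _ (C * C)).
          by apply: measurable_funM; exact: measurable_process_section.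
        by move=> w; rewrite normrM ler_pM.
      apply: (le_trans (le_normr_Rintegral _ iee)) => //.
      have -> : C * C = \int[P]_w (C * C).
        by rewrite /Rintegral integral_cst//= probability_setT mule1.
      apply: le_Rintegral => //.
      - exact: integrable_norm.
      - exact: finite_measure_integrable_cst.
      - by move=> w _; rewrite normrM ler_pM.
    apply: He; move: sI; rewrite notin_setE /I/= in_itv/= => /negP; rewrite negb_and -!ltNge.
    by move=> /orP[?|?]; [apply: lt_le_trans (ler_norm _)|rewrite distrC; apply: lt_le_trans (ler_norm _)]; lra.
  have ik3 : leb.-integrable D (EFin \o (fun s => \int[P]_w k3 (s, w))).
    apply: measurable_bounded_integrable => //.
    exists (e + C * C); split; [exact: num_real|move=> x Cx s _].
    apply: le_trans (ltW Cx); apply: (le_trans (k3s s)).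
    by rewrite lerD2l ler_piMr// indicE; case: (_ \in _).
  have iI : leb.-integrable D (EFin \o (\1_I : measurableTypeR R -> R)).
    apply: measurable_bounded_integrable => //.
    exists 1; split; [exact: num_real|move=> x x1 s _].
    by apply: le_trans (ltW x1); rewrite indicE; case: (_ \in _); rewrite ?normr1 ?normr0.
  have icst (r : R) : leb.-integrable D (EFin \o (fun=> r)).
    by apply: measurable_bounded_integrable => //; exact: bounded_cst.
  apply: (le_trans (le_normr_Rintegral _ ik3)) => //.
  apply: (@le_trans _ _ (\int[leb]_(s in D) (e + C * C * \1_I s))).
    apply: le_Rintegral => //; first exact: integrable_norm.
    by apply: integrableDr => //; apply: integrable_scale.
  rewrite RintegralD//; last exact: integrable_scale.
  rewrite Rcst RintegralZl//= lerD2l.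
  rewrite -mulrA mulrC -!mulrA [leRHS]mulrCA.
  rewrite [leRHS](_ : _ = C * (C * (2 * A))); last by ring.
  rewrite mulrCA [leLHS](_ : _ = C * (C * \int[leb]_(t in D) \1_I t)); last by ring.
  rewrite !ler_wpM2l// -lee_fin /Rintegral fineK; last exact: integrable_fin_num.
  rewrite integral_indic//; apply: (@le_trans _ _ (leb I)).
    by apply: le_measure; rewrite ?inE//; exact: measurableI.
  rewrite /I lebesgue_measure_itv/=; case: ifP => _; last by rewrite lee_fin; lra.
  by rewrite -EFinB lee_fin; lra.
have K0 : 0 <= e * T + 2 * A * C ^+ 2.
  by apply: (le_trans (normr_ge0 _) (meanb 0)).
pose k2 (z : (measurableTypeR R * Omega)%type) := a z.1 * eta z.1 z.2 * Z z.2.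
have mZ2 : measurable_fun [set: (measurableTypeR R * Omega)%type] (fun z => Z z.2).
  by apply: (measurableT_comp (f := Z)) => //; exact: measurable_snd.
have mk2 : measurable_fun [set: (measurableTypeR R * Omega)%type] k2.
  exact: measurable_funM.
have CT0 : 0 <= C * (C * T) by rewrite !mulr_ge0// ltW.
have k2b z : `|k2 z| <= C * (C * T) by rewrite /k2 normrM ler_pM.
have -> : \int[P]_w (Z w ^+ 2) = \int[leb]_(t in D) (\int[P]_w k2 (t, w)).
  rewrite (@fubini_path _ _ _ P T _ _ mk2 CT0 k2b); apply: eq_Rintegral => w _.
  rewrite expr2 {1}/Z -RintegralZr//; exact: ipath.
apply: le_trans (ler_norm _) _; rewrite mulrC.
apply: normint => //; first exact: (@measurable_mean_path _ _ _ P T _ _ mk2 CT0 k2b).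
move=> t _.
have -> : \int[P]_w k2 (t, w) = a t * \int[P]_w (eta t w * Z w).
  rewrite -RintegralZl//; first by apply: eq_Rintegral => w _; rewrite /k2/= mulrA.
  apply: (@bounded_rv_integrable _ _ _ _ _ (C * (C * T))).
    by apply: measurable_funM => //; exact: measurable_process_section.
  by move=> w; rewrite normrM ler_pM.
by rewrite normrM -[leRHS]mul1r ler_pM.
Qed.

End WeakLLN.

(** * Weighted law of large numbers along the path *)

Section LLN.
Context d (Omega : measurableType d) (R : realType) (P : probability Omega R).
Notation leb := (@lebesgue_measure R).
Variable xi : R -> Omega -> R.
Variable B : R -> R.
Hypothesis xi_measurable : measurable_process xi.
Hypothesis xi_stationary : stationary_process P xi.
Hypothesis xi_gaussian : gaussian_process P xi.
Hypothesis xi_mean : forall t, ('E_P[xi t] = 0)%E.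
Hypothesis xi_var : forall t, ('E_P[fun w => (xi t w ^+ 2)%R] = 1)%E.
Hypothesis xi_cov : forall t, ('E_P[fun w => (xi 0%R w * xi t w)%R] = (B t)%:E)%E.
Hypothesis B_decay : forall e : R, 0 < e -> exists A : R, forall t : R, A < `|t| -> `|B t| < e.

Let mxi t : measurable_fun [set: Omega] (xi t).
Proof. exact: measurable_process_section. Qed.

Let mean (H : R -> R) := \int[P]_w H (xi 0 w).

(** The weights may depend on T, and the bound holds for each fixed family of
    weights: the second derivatives of the regression function, rescaled by T,
    play this role. Integrability of the path is part of the event because it
    is not automatic for an unbounded H. *)
Definition lln (H : R -> R) : Prop :=
  [/\ measurable_fun [set: measurableTypeR R] H,
      P.-integrable [set: _] (EFin \o (fun w => H (xi 0 w))) &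
      forall (a : R -> R -> R), (forall T, measurable_fun [set: R] (a T)) ->
        (forall T t, `|a T t| <= 1) -> forall del : R, 0 < del ->
        likely P (fun T => [set w |
          leb.-integrable `[0, T]%classic (EFin \o (fun t => H (xi t w))) /\
          `|T^-1 * \int[leb]_(t in `[0, T]) (a T t * (H (xi t w) - mean H))| <= del])].

Let measurable_path (H : R -> R) w : measurable_fun [set: measurableTypeR R] H ->
  measurable_fun [set: measurableTypeR R] (fun t => H (xi t w)).
Proof.
move=> mH; apply: (measurableT_comp (f := H)) => //.
have := measurableT_comp xi_measurable (pair2_measurable w); exact.
Qed.

Let mD T : measurable (`[0, T]%classic : set (measurableTypeR R)).
Proof. exact: measurable_itv. Qed.

Let lebD T : 0 < T -> leb (`[0, T]%classic : set (measurableTypeR R)) = T%:E.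
Proof. by move=> T0; rewrite lebesgue_measure_itv/= lte_fin T0 oppr0 adde0. Qed.

Let icst T (r : R) : leb.-integrable (`[0, T]%classic : set (measurableTypeR R)) (EFin \o (fun=> r)).
Proof.
pose D : set (measurableTypeR R) := `[0, T]%classic.
have Dfin : (leb D < +oo)%E.
  by rewrite /D lebesgue_measure_itv /=; case: ifP => _; rewrite ?ltry// -EFinD ltry.
by apply: measurable_bounded_integrable => //; exact: bounded_cst.
Qed.

Let Rcst T (r : R) : 0 < T -> \int[leb]_(t in `[0, T]) r = r * T.
Proof.
move=> T0; rewrite Rintegral_cst//; congr (_ * _); exact: (congr1 fine (lebD T0)).
Qed.

Let iweight T (a f : R -> R) : measurable_fun [set: R] a -> (forall t, `|a t| <= 1) ->
  leb.-integrable (`[0, T]%classic : set (measurableTypeR R)) (EFin \o f) ->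
  leb.-integrable (`[0, T]%classic : set (measurableTypeR R)) (EFin \o (fun t => a t * f t)).
Proof.
move=> ma a1 fi; apply: (integrable_dom _ _ (integrable_norm fi)) => //.
  apply: measurable_funM; first exact: measurable_funTS.
  by have := integrable_measurable fi; exact.
by move=> t _ /=; rewrite normrM ler_piMl.
Qed.

(** Chebyshev's inequality and [weak_lln_bound], since cosines of the process at
    distant times are nearly uncorrelated. *)
Lemma lln_cos u b : lln (fun x => cos (u * x + b)).
Proof.
set H := fun x => _.
have mH : measurable_fun [set: measurableTypeR R] H.
  apply: measurableT_comp; first by apply: continuous_measurable_fun; exact: continuous_cos.
  by apply: measurable_funD => //; apply: measurable_funM.
have mHxi t : measurable_fun [set: Omega] (fun w => H (xi t w)).
  exact: (measurableT_comp (f := H)).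
have iH t : P.-integrable [set: _] (EFin \o (fun w => H (xi t w))).
  by apply: (@bounded_rv_integrable _ _ _ _ _ 1) => // w; exact: cos_max.
split => // a ma a1 del del0 eta eta0.
pose m := cos b * expR (- (u ^+ 2 / 2)).
have mE : mean H = m.
  by rewrite /mean /Rintegral (process_cos xi_measurable xi_stationary xi_gaussian xi_mean xi_var xi_cov 0 u b).
have m1 : `|m| <= 1.
  rewrite /m normrM -[leRHS]mulr1 ler_pM ?cos_max// ger0_norm ?expR_ge0//.
  by rewrite -[leRHS]expR0 ler_expR oppr_le0 divr_ge0// sqr_ge0.
pose et t w := H (xi t w) - m.
have met : measurable_process et.
  apply: measurable_funB => //; exact: (measurableT_comp (f := H)).
have etC t w : `|et t w| <= 2.
  apply: (le_trans (ler_normB _ _)).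
  have : `|H (xi t w)| <= 1 by exact: cos_max.
  lra.
pose e := eta * del ^+ 2 / 2.
have e0 : 0 < e by rewrite /e divr_gt0// mulr_gt0// exprn_gt0.
have [dl dl0 Hcov] := process_cos_cov xi_measurable xi_stationary xi_gaussian xi_mean xi_var xi_cov u b e0.
have [A0 HA0] := B_decay dl0.
pose A := Num.max A0 0.
have A_0 : 0 <= A by rewrite /A le_max lexx orbT.
have HA s t : A < `|t - s| -> `|\int[P]_w (et s w * et t w)| <= e.
  by move=> h; apply: Hcov; apply: HA0; apply: le_lt_trans h; rewrite /A le_max lexx.
near=> T.
have T0 : 0 < T by near: T; apply: nbhs_pinfty_gt; exact: num_real.
have TA : 2 * A * 2 ^+ 2 / e <= T by near: T; apply: nbhs_pinfty_ge; exact: num_real.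
pose Z w := \int[leb]_(t in `[0, T]) (a T t * et t w).
have bnd := weak_lln_bound met (ler0n R 2) etC (ltW e0) A_0 T0 HA (ma T) (a1 T).
have mk : measurable_fun [set: (measurableTypeR R * Omega)%type] (fun z => a T z.1 * et z.1 z.2).
  apply: measurable_funM => //.
  by apply: (measurableT_comp (f := a T)) => //; exact: measurable_fst.
have kb z : `|a T z.1 * et z.1 z.2| <= 2 by rewrite normrM -[leRHS]mul1r ler_pM.
have mZ : measurable_fun [set: Omega] Z.
  exact: (@measurable_path_average _ _ _ P T _ 2 mk (ler0n R 2) kb).
pose Y w := ((T^-1 * Z w) ^+ 2)%:E.
have mY : measurable_fun [set: Omega] Y.
  apply/measurable_EFinP; apply: measurable_funX; exact: measurable_funM.
have Y0 w : (0 <= Y w)%E by rewrite lee_fin sqr_ge0.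
have iet w : leb.-integrable (`[0, T]%classic : set (measurableTypeR R)) (EFin \o (fun t => et t w)).
  apply: (integrable_dom _ _ (icst T 2)) => //.
  by apply: measurable_funTS; apply: measurable_funB => //; exact: measurable_path.
have iaet w := iweight (ma T) (a1 T) (iet w).
have Zb w : `|Z w| <= 2 * T.
  apply: (le_trans (le_normr_Rintegral _ (iaet w))) => //.
  rewrite -Rcst//; apply: le_Rintegral => //; first exact: integrable_norm.
  by move=> t _; exact: (kb (t, w)).
have EY : (\int[P]_w Y w <= (2 * e)%:E)%E.
  have iZ2 : P.-integrable [set: _] (EFin \o (fun w => Z w ^+ 2)).
    apply: (@bounded_rv_integrable _ _ _ _ _ ((2 * T) ^+ 2)); first exact: measurable_funX.
    by move=> w; rewrite normrX lerXn2r// nnegrE// mulr_ge0// ltW.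
  have iY : P.-integrable [set: _] (EFin \o (fun w => (T^-1 ^+ 2) * Z w ^+ 2)).
    exact: integrable_scale.
  rewrite /Y; under eq_integral do rewrite exprMn.
  rewrite -[leLHS]fineK; last exact: integrable_fin_num.
  rewrite lee_fin -/(Rintegral _ _ _) RintegralZl//.
  apply: (@le_trans _ _ (T^-1 ^+ 2 * (T * (e * T + 2 * A * 2 ^+ 2)))).
    by rewrite ler_wpM2l// sqr_ge0.
  have -> : T^-1 ^+ 2 * (T * (e * T + 2 * A * 2 ^+ 2)) = e + 2 * A * 2 ^+ 2 / T by field; lra.
  have : 2 * A * 2 ^+ 2 / T <= e.
    by rewrite ler_pdivrMr// -ler_pdivrMl// mulrC.
  lra.
have [mS PS] := markov_event mY Y0 (exprn_gt0 2 del0) EY.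
exists [set w | (Y w < (del ^+ 2)%:E)%E]; split => //.
- move=> w /=; rewrite /Y lte_fin => Yw; split.
    apply: (integrable_dom _ _ (icst T 1)) => //.
      by apply: measurable_funTS; exact: measurable_path.
    by move=> t _; exact: cos_max.
  rewrite mE -/(et _ _) -/(Z w); apply: ltW.
  by rewrite -(ltr_pXn2r (_ : (0 < 2)%N)) ?nnegrE ?(ltW del0)// real_normK ?num_real.
- suff : 1 - eta = 1 - 2 * e / del ^+ 2 by move=> ->.
  by rewrite /e; field; lra.
Unshelve. all: by end_near. Qed.

Lemma lln_lin (c : R) H1 H2 : lln H1 -> lln H2 -> lln (fun x => c * H1 x + H2 x).
Proof.
move=> [m1 i1 L1] [m2 i2 L2].
have im1 := integrable_scale measurableT c i1.
split.
- by apply: measurable_funD => //; exact: measurable_funM.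
- exact: integrableDr.
move=> a ma a1 del del0.
have c0 : 0 < `|c| + 1 by rewrite ltr_wpDl.
have d1 : 0 < del / 2 / (`|c| + 1) by rewrite !divr_gt0.
have d2 : 0 < del / 2 by rewrite divr_gt0.
have := likelyI (L1 a ma a1 _ d1) (L2 a ma a1 _ d2).
apply: likely_sub; near=> T.
have T0 : 0 < T by near: T; apply: nbhs_pinfty_gt; exact: num_real.
move=> w [/= [J1 K1] [J2 K2]].
have J1' := integrable_scale (mD T) c J1.
split; first exact: integrableDr.
have I1 := iweight (ma T) (a1 T) (integrableBr (mD T) J1 (icst T (mean H1))).
have I2 := iweight (ma T) (a1 T) (integrableBr (mD T) J2 (icst T (mean H2))).
have mE : mean (fun x => c * H1 x + H2 x) = c * mean H1 + mean H2.
  by rewrite /mean RintegralD// RintegralZl.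
have -> : \int[leb]_(t in `[0, T]) (a T t * (c * H1 (xi t w) + H2 (xi t w) - mean (fun x => c * H1 x + H2 x))) =
  c * \int[leb]_(t in `[0, T]) (a T t * (H1 (xi t w) - mean H1)) +
  \int[leb]_(t in `[0, T]) (a T t * (H2 (xi t w) - mean H2)).
  rewrite -RintegralZl// -RintegralD//; last exact: integrable_scale.
  by apply: eq_Rintegral => t _; rewrite mE; ring.
rewrite mulrDr mulrCA; apply: (le_trans (ler_normD _ _)); rewrite normrM.
have : `|c| * `|T^-1 * \int[leb]_(t in `[0, T]) (a T t * (H1 (xi t w) - mean H1))| <= del / 2.
  apply: (@le_trans _ _ ((`|c| + 1) * (del / 2 / (`|c| + 1)))).
    by rewrite ler_pM// lerDl.
  by rewrite mulrC divfK// gt_eqF.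
by move: K2; lra.
Unshelve. all: by end_near. Qed.

Lemma stationary_ge0 (h : R -> R) t : measurable_fun [set: measurableTypeR R] h ->
  (forall x, 0 <= h x) ->
  (\int[P]_w (h (xi t w))%:E = \int[P]_w (h (xi 0 w))%:E)%E.
Proof.
move=> mh h0.
rewrite (@stationary_pair _ _ _ P xi xi_measurable xi_stationary (fun z => h z.1) t t)//.
by apply: (measurableT_comp (f := h)) => //; exact: measurable_fst.
Qed.

(** The weighted time average of |H - h| along the path has expectation at most
    E |H - h| for every T by stationarity, so Markov's inequality
    makes it small uniformly in T. *)
Lemma lln_approx H : measurable_fun [set: measurableTypeR R] H ->
  P.-integrable [set: _] (EFin \o (fun w => H (xi 0 w))) ->
  (forall e : R, 0 < e -> exists2 h, lln h &
     (\int[P]_w `|H (xi 0 w) - h (xi 0 w)|%:E < e%:E)%E) -> lln H.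
Proof.
move=> mH iH Happ; split => // a ma a1 del del0 eta eta0.
pose e := Num.min (del / 3) (del / 3 * (eta / 2)).
have d3 : 0 < del / 3 by rewrite divr_gt0.
have eta2 : 0 < eta / 2 by rewrite divr_gt0.
have e0 : 0 < e by rewrite /e lt_min d3/= mulr_gt0.
have [h [mh ih Lh] Hh] := Happ _ e0.
have LA := Lh a ma a1 _ d3 _ eta2.
pose r x := `|H x - h x|.
have r0 x : 0 <= r x by exact: normr_ge0.
have mr : measurable_fun [set: measurableTypeR R] r.
  by apply: measurableT_comp => //; exact: measurable_funB.
near=> T.
have T0 : 0 < T by near: T; apply: nbhs_pinfty_gt; exact: num_real.
have [A [mA Ah PA]] : exists A : set Omega, [/\ measurable A,
    A `<=` [set w | leb.-integrable `[0, T]%classic (EFin \o (fun t => h (xi t w))) /\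
          `|T^-1 * \int[leb]_(t in `[0, T]) (a T t * (h (xi t w) - mean h))| <= del / 3] &
    ((1 - eta / 2)%:E <= P A)%E] by near: T; exact: LA.
pose D : set (measurableTypeR R) := `[0, T]%classic.
pose Y w := (\int[leb]_(t in D) (r (xi t w))%:E)%E.
pose f (z : (measurableTypeR R * Omega)%type) : \bar R := ((r (xi z.1 z.2)) * \1_D z.1)%:E.
have mf : measurable_fun [set: (measurableTypeR R * Omega)%type] f.
  apply/measurable_EFinP; apply: measurable_funM.
    exact: (measurableT_comp (f := r)).
  by apply: (measurableT_comp (f := \1_D : measurableTypeR R -> R)) => //; apply: measurable_indic; exact: mD.
have f0 z : (0 <= f z)%E by rewrite lee_fin mulr_ge0// indicE.
have YE w : Y w = (\int[leb]_t f (t, w))%E.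
  rewrite /Y integral_mkcond; apply: eq_integral => t _.
  by rewrite /f /= patchE indicE; case: (t \in D); rewrite ?mulr1 ?mulr0.
have mY : measurable_fun [set: Omega] Y.
  rewrite (_ : Y = fun w => (\int[leb]_t f (t, w))%E); last by apply/funext.
  exact: measurable_fun_fubini_tonelli_G.
have Y0 w : (0 <= Y w)%E by apply: integral_ge0 => t _; rewrite lee_fin.
have EY : (\int[P]_w Y w <= (T * e)%:E)%E.
  under eq_integral do rewrite YE.
  rewrite -(fubini_tonelli f)//.
  have -> : (\int[leb]_t \int[P]_w f (t, w) = \int[leb]_(t in D) \int[P]_w (r (xi 0 w))%:E)%E.
    rewrite [RHS]integral_mkcond; apply: eq_integral => t _.
    rewrite /f /= patchE indicE; case: (t \in D).
      by under eq_integral do rewrite mulr1; exact: stationary_ge0.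
    by under eq_integral do rewrite mulr0; rewrite integral0.
  have fin : (\int[P]_w (r (xi 0 w))%:E)%E \is a fin_num.
    rewrite ge0_fin_numE ?(lt_trans Hh) ?ltry//.
    by apply: integral_ge0 => w _; rewrite lee_fin.
  have cstE (c : R) : (\int[leb]_(t in D) c%:E = (c * T)%:E)%E.
    by rewrite -Rcst// /Rintegral fineK//; exact: (integrable_fin_num (mD T) (icst T c)).
  rewrite -(fineK fin) cstE lee_fin mulrC.
  by rewrite ler_pM2l// -lee_fin fineK// ltW.
have c0 : 0 < T * (del / 3) by rewrite mulr_gt0.
have [mS PS] := markov_event mY Y0 c0 EY.
pose S := [set w | (Y w < (T * (del / 3))%:E)%E].
have L1 : forall w, A w -> S w -> leb.-integrable D (EFin \o (fun t => H (xi t w))) /\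
          `|T^-1 * \int[leb]_(t in `[0, T]) (a T t * (H (xi t w) - mean H))| <= del.
  move=> w Aw Sw; have [J1 J2] := Ah w Aw.
  have ir : leb.-integrable D (EFin \o (fun t => r (xi t w))).
    apply/integrableP; split.
      by apply/measurable_EFinP; apply: measurable_funTS; exact: measurable_path.
    rewrite (le_lt_trans _ (lt_trans Sw (ltry _)))//.
    by rewrite le_eqVlt; apply/orP; left; apply/eqP; apply: eq_integral => t _; rewrite gee0_abs ?lee_fin.
  have iHh : leb.-integrable D (EFin \o (fun t => H (xi t w) - h (xi t w))).
    apply: (integrable_dom (mD T) _ ir) => //.
    by apply: measurable_funTS; apply: measurable_funB; exact: measurable_path.
  have iHw : leb.-integrable D (EFin \o (fun t => H (xi t w))).
    have := integrableDr (mD T) iHh J1; apply: eq_integrable => // t _ /=.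
    by rewrite subrK.
  split => //.
  have I1 := iweight (ma T) (a1 T) (integrableBr (mD T) J1 (icst T (mean h))).
  have I2 := iweight (ma T) (a1 T) iHh.
  have I3 := iweight (ma T) (a1 T) (icst T (mean h - mean H)).
  have -> : \int[leb]_(t in `[0, T]) (a T t * (H (xi t w) - mean H)) =
     \int[leb]_(t in `[0, T]) (a T t * (h (xi t w) - mean h)) +
     (\int[leb]_(t in `[0, T]) (a T t * (H (xi t w) - h (xi t w))) +
      \int[leb]_(t in `[0, T]) (a T t * (mean h - mean H))).
    rewrite -RintegralD// -RintegralD//; last exact: integrableDr.
    by apply: eq_Rintegral => t _; ring.
  have B2 : `|\int[leb]_(t in `[0, T]) (a T t * (H (xi t w) - h (xi t w)))| <= T * (del / 3).
    apply: (le_trans (le_normr_Rintegral _ I2)) => //.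
    apply: (@le_trans _ _ (\int[leb]_(t in D) r (xi t w))).
      apply: le_Rintegral => //; first exact: integrable_norm.
      by move=> t _; rewrite normrM; apply: ler_piMl.
    rewrite -lee_fin /Rintegral fineK; last exact: (integrable_fin_num (mD T) ir).
    exact: ltW.
  have B3 : `|\int[leb]_(t in `[0, T]) (a T t * (mean h - mean H))| <= T * (del / 3).
    apply: (le_trans (le_normr_Rintegral _ I3)) => //.
    rewrite [leRHS]mulrC -(Rcst (del / 3) T0); apply: le_Rintegral => //; first exact: integrable_norm.
    move=> t _; rewrite normrM.
    apply: (@le_trans _ _ `|mean h - mean H|); first by rewrite ler_piMl.
    rewrite /mean -RintegralB//.
    apply: (le_trans (le_normr_Rintegral _ _)) => //; first exact: integrableBr.
    apply: (@le_trans _ _ e); last by rewrite /e ge_min lexx.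
    rewrite -lee_fin /Rintegral fineK.
      by apply: ltW; under eq_integral do rewrite distrC.
    by apply: integrable_fin_num => //; apply: integrable_norm; exact: integrableBr.
  rewrite mulrDr; apply: (le_trans (ler_normD _ _)).
  have : `|T^-1 * (\int[leb]_(t in `[0, T]) (a T t * (H (xi t w) - h (xi t w))) +
      \int[leb]_(t in `[0, T]) (a T t * (mean h - mean H)))| <= del / 3 + del / 3.
    rewrite normrM ger0_norm ?invr_ge0 ?(ltW T0)//.
    rewrite ler_pdivrMl// mulrDr; apply: (le_trans (ler_normD _ _)); exact: lerD.
  move=> K; apply: (le_trans (lerD J2 K)).
  by rewrite le_eqVlt; apply/orP; left; apply/eqP; field.
have PE X : measurable X -> P X = (fine (P X))%:E.
  by move=> mX; rewrite fineK// fin_num_measure.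
exists (A `&` S); split; [exact: measurableI|by move=> w [Aw Sw]; exact: L1|].
have U : (P (~` (A `&` S)) <= P (~` A) + P (~` S))%E.
  by rewrite setCI; apply: measureU2; exact: measurableC.
move: U PA PS; rewrite !probability_setC//; last exact: measurableI.
rewrite -/S (PE _ mA) (PE _ mS) (PE _ (measurableI _ _ mA mS)).
rewrite -[1%E]/(1%:E) -!EFinB -EFinD !lee_fin.
have : T * e / (T * (del / 3)) <= eta / 2.
  rewrite ler_pdivrMr// mulrCA ler_pM2l// mulrC.
  by rewrite /e ge_min lexx orbT.
lra.
Unshelve. all: by end_near. Qed.

(** The class [lln] is linear, L1-closed and contains the cosines, so
    [trig_total] applies under the law of xi 0. *)
Theorem lln_integrable H : measurable_fun [set: measurableTypeR R] H ->
  P.-integrable [set: _] (EFin \o (fun w => H (xi 0 w))) -> lln H.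
Proof.
move=> mH iH.
pose X : {mfun Omega >-> measurableTypeR R} :=
  HB.pack (xi 0 : Omega -> measurableTypeR R) (isMeasurableFun.Build _ _ _ _ (xi 0 : Omega -> measurableTypeR R) (mxi 0)).
pose mu : probability (measurableTypeR R) R := distribution P X.
have law (h : R -> R) : measurable_fun [set: measurableTypeR R] h -> (forall x, 0 <= h x) ->
    (\int[mu]_x (h x)%:E = \int[P]_w (h (xi 0 w))%:E)%E.
  move=> mh h0; have mh' : measurable_fun [set: measurableTypeR R] (EFin \o h).
    exact/measurable_EFinP.
  by rewrite (@ge0_integral_distribution _ _ _ _ _ P X (EFin \o h) mh')// => y; rewrite lee_fin.
have intE (h : R -> R) : measurable_fun [set: measurableTypeR R] h ->
    mu.-integrable [set: _] (EFin \o h) <-> P.-integrable [set: _] (EFin \o (fun w => h (xi 0 w))).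
  move=> mh.
  have mh' : measurable_fun [set: Omega] (fun w => h (xi 0 w)) by exact: (measurableT_comp (f := h)).
  have E : (\int[mu]_x `|(EFin \o h) x| = \int[P]_w `|(EFin \o (fun w => h (xi 0 w))) w|)%E.
    by rewrite /= (law (fun x => `|h x|))//; exact: measurableT_comp.
  split => /integrableP[_ fin]; apply/integrableP; split.
  - exact/measurable_EFinP.
  - by rewrite -E.
  - exact/measurable_EFinP.
  - by rewrite E.
apply: (@trig_total R mu lln).
- by move=> a f h; exact: lln_lin.
- exact: lln_cos.
- move=> f fi Hf; have mf := integrable_measurable fi.
  apply: lln_approx => //; first exact/intE.
  move=> e /Hf[h Sh he]; exists h => //.
  rewrite -(law (fun x => `|f x - h x|))//.
  apply: measurableT_comp => //; apply: measurable_funB => //.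
  by case: Sh.
- exact/intE.
Qed.

End LLN.

(** * Quadratic forms and the least eigenvalue *)

Lemma linear_coef_eq0 (R : realFieldType) (a b : R) : 0 <= b ->
  (forall t, 0 <= t * (2 * a) + t ^+ 2 * b) -> a = 0.
Proof.
move=> b0 H; have b1 : 0 < b + 1 by lra.
have := H (- a / (b + 1)).
have -> : - a / (b + 1) * (2 * a) + (- a / (b + 1)) ^+ 2 * b =
   - (a ^+ 2 * ((b + 2) / (b + 1) ^+ 2)) by field; lra.
rewrite oppr_ge0 => h.
have p : 0 < (b + 2) / (b + 1) ^+ 2 by rewrite divr_gt0 ?exprn_gt0//; lra.
have h2 : a ^+ 2 <= 0 by move: h; rewrite pmulr_lle0.
by apply/eqP; rewrite -sqrf_eq0 eq_le h2 sqr_ge0.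
Qed.

Section Rayleigh.
Context (R : realType) (n : nat).
Implicit Types u v : 'rV[R]_n.

Lemma continuous_sumr (T : topologicalType) k (F : 'I_k -> T -> R) :
  (forall i, continuous (F i)) -> continuous (fun x => \sum_(i < k) F i x).
Proof.
elim: k F => [|k IH] F cF.
  rewrite (_ : (fun x => _) = fun=> 0); first by move=> x; exact: cvg_cst.
  by apply/funext => x; rewrite big_ord0.
rewrite (_ : (fun x => _) =
    (fun x => \sum_(i < k) F (widen_ord (leqnSn k) i) x + F ord_max x)).
  by move=> x; apply: cvgD; [exact: IH|exact: cF].
by apply/funext => x; rewrite big_ord_recr.
Qed.

Definition bil (A : 'M[R]_n) u v := \sum_(i < n) \sum_(j < n) u 0 i * A i j * v 0 j.

Lemma bilE (A : 'M[R]_n) u v : bil A u v = \sum_(j < n) (u *m A) 0 j * v 0 j.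
Proof.
rewrite /bil exchange_big; apply: eq_bigr => j _.
by rewrite mxE big_distrl.
Qed.

Lemma bil_line (A : 'M[R]_n) u v t : A^T = A ->
  bil A (u + t *: v) (u + t *: v) = bil A u u + t * (2 * bil A u v) + t ^+ 2 * bil A v v.
Proof.
move=> sA; have sym : bil A v u = bil A u v.
  rewrite /bil exchange_big; apply: eq_bigr => i _; apply: eq_bigr => j _.
  by rewrite -[in LHS]sA mxE; ring.
have -> : 2 * bil A u v = bil A u v + bil A v u by rewrite sym; ring.
rewrite mulrDr /bil !mulr_sumr -!big_split; apply: eq_bigr => i _ /=.
rewrite !mulr_sumr -!big_split; apply: eq_bigr => j _ /=.
by rewrite !mxE; ring.
Qed.

Lemma bilZ (A : 'M[R]_n) u t : bil A (t *: u) (t *: u) = t ^+ 2 * bil A u u.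
Proof.
rewrite /bil !mulr_sumr; apply: eq_bigr => i _ /=.
by rewrite !mulr_sumr; apply: eq_bigr => j _ /=; rewrite !mxE; ring.
Qed.

Let sq u := \sum_(i < n) u 0 i ^+ 2.

Let sqZ u t : sq (t *: u) = t ^+ 2 * sq u.
Proof. by rewrite /sq mulr_sumr; apply: eq_bigr => i _; rewrite mxE exprMn. Qed.

Let sq_ge0 u : 0 <= sq u.
Proof. by apply: sumr_ge0 => i _; exact: sqr_ge0. Qed.

Let sq_eq0 u : sq u = 0 -> u = 0.
Proof.
move=> /eqP; rewrite psumr_eq0 => [/allP H|i _]; last exact: sqr_ge0.
apply/rowP => i; rewrite mxE; apply/eqP.
by have := H i (mem_index_enum i); rewrite sqrf_eq0.
Qed.

(** A minimizer of the quadratic form on the unit sphere exists by compactness;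
    the first-order condition at the minimizer makes it an eigenvector, so the
    minimum is an eigenvalue and bounds [lambda_min] from above. *)
Lemma rayleigh (A : 'M[R]_n) (lam : R) u : A^T = A -> lam <= lambda_min A ->
  lam * \sum_(i < n) u 0 i ^+ 2 <= bil A u u.
Proof.
move=> sA lamA; rewrite -/(sq u).
have [->|u0] := eqVneq u 0.
  have -> : (0 : 'rV[R]_n) = 0 *: 0 by rewrite scale0r.
  by rewrite sqZ bilZ expr0n/= !mul0r mulr0.
have sq_gt0 v : v != 0 -> 0 < sq v.
  move=> v0; rewrite lt_neqAle sq_ge0 andbT eq_sym.
  by apply: contra v0 => /eqP /sq_eq0 ->.
have normalize v : v != 0 -> sq ((Num.sqrt (sq v))^-1 *: v) = 1.
  move=> v0; rewrite sqZ exprVn sqr_sqrtr// mulVf// gt_eqF//; exact: sq_gt0.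
pose S : set 'rV[R]_n := [set v | sq v = 1].
have S0 : S !=set0 by exists ((Num.sqrt (sq u))^-1 *: u); exact: normalize.
have csq : continuous sq.
  apply: continuous_sumr => i v.
  apply: (@continuous_comp _ _ _ (fun v : 'rV[R]_n => v 0 i) (fun x : R => x ^+ 2)).
    exact: coord_continuous.
  exact: exprn_continuous.
have cbil : continuous (fun v => bil A v v).
  apply: continuous_sumr => i; apply: continuous_sumr => j v.
  have c1 k : (fun w : 'rV[R]_n => w 0 k) w @[w --> v] --> v 0 k by exact: coord_continuous.
  have c2 : (fun w : 'rV[R]_n => A i j) w @[w --> v] --> A i j by apply: cst_continuous.
  exact: (cvgM (cvgM (c1 i) c2) (c1 j)).
have closedS : closed S.
  have -> : S = sq @^-1` [set 1] by [].
  by apply: preimage_closed; [move=> v _; exact: csq|exact: closed_eq].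
have cS : compact S.
  have cK : compact [set v : 'rV[R]_n | forall i, (`[(-1 : R), 1]%classic : set R) (v ord0 i)].
    apply: (@rV_compact _ n (fun=> `[(-1 : R), 1]%classic : set R)) => i.
    exact: segment_compact.
  apply: (subclosed_compact closedS cK).
  move=> v /= Sv i; rewrite in_itv/= -ler_norml.
  have : v 0 i ^+ 2 <= 1.
    by rewrite -Sv /sq (bigD1 i)//= lerDl sumr_ge0// => j _; exact: sqr_ge0.
  by rewrite -[v 0 i ^+ 2]real_normK ?num_real// expr_le1.
have [v0 /set_mem Sv0 v0min] :=
  EVT_min_rV S0 cS (continuous_subspaceT cbil).
pose m := bil A v0 v0.
have v0n0 : v0 != 0.
  apply/eqP => e; have := Sv0; rewrite /S/= e /sq.
  under eq_bigr do rewrite mxE expr0n/=.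
  by rewrite big1// => /eqP; rewrite eq_sym oner_eq0.
have low v : m * sq v <= bil A v v.
  have [->|vn0] := eqVneq v 0.
    have -> : (0 : 'rV[R]_n) = 0 *: 0 by rewrite scale0r.
    by rewrite sqZ bilZ expr0n/= !mul0r mulr0.
  have := v0min ((Num.sqrt (sq v))^-1 *: v).
  rewrite bilZ exprVn sqr_sqrtr// => /(_ (mem_set (normalize v vn0))).
  by rewrite ler_pdivlMl ?sq_gt0// mulrC.
have crit v : bil A v0 v = m * \sum_(j < n) v0 0 j * v 0 j.
  set c := \sum_(j < n) _.
  have sqline t : sq (v0 + t *: v) = 1 + t * (2 * c) + t ^+ 2 * sq v.
    suff -> : sq (v0 + t *: v) = sq v0 + t * (2 * c) + t ^+ 2 * sq v by rewrite [sq v0]Sv0.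
    rewrite /sq /c !mulr_sumr -!big_split; apply: eq_bigr => i _ /=.
    by rewrite !mxE; ring.
  have H t : 0 <= t * (2 * (bil A v0 v - m * c)) + t ^+ 2 * (bil A v v - m * sq v).
    by have := low (v0 + t *: v); rewrite sqline bil_line// -/m; lra.
  set a := bil A v0 v - m * c in H; set b := bil A v v - m * sq v in H.
  have b0 : 0 <= b by rewrite /b subr_ge0.
  have a0 : a = 0 by exact: (linear_coef_eq0 b0 H).
  by apply/eqP; rewrite -subr_eq0 -/a a0.
have eig : eigenvalue A m.
  apply/eigenvalueP; exists v0 => //; apply/rowP => j.
  have := crit (delta_mx 0 j); rewrite bilE.
  have sum1 (f : 'I_n -> R) : \sum_(i < n) f i * (delta_mx 0 j : 'rV[R]_n) 0 i = f j.
    rewrite (bigD1 j)//= big1 ?addr0 => [|i ij]; first by rewrite mxE !eqxx mulr1.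
    by rewrite mxE (negbTE ij) andbF mulr0.
  by rewrite !sum1 => ->; rewrite mxE.
apply: le_trans (low u); rewrite ler_wpM2r//.
apply: (le_trans lamA); apply: ge_inf => //.
exists m => a /eigenvalueP[v va vn0].
have : bil A v v = a * sq v.
  rewrite bilE va /sq mulr_sumr; apply: eq_bigr => i _.
  by rewrite mxE; ring.
by have := low v => /[swap] ->; rewrite ler_pM2r// sq_gt0.
Qed.

End Rayleigh.

(** * Euclidean norm and directional derivatives *)

Section EuclideanNorm.
Context (R : realType) (q : nat).
Implicit Types u v w : 'rV[R]_q.

Let sq u : R := \sum_(i < q) u 0 i ^+ 2.

Let sq_ge0 u : 0 <= sq u.
Proof. by apply: sumr_ge0 => i _; exact: sqr_ge0. Qed.

Lemma enorm_ge0 u : 0 <= enorm u.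
Proof. exact: sqrtr_ge0. Qed.

Lemma enorm_sqr u : enorm u ^+ 2 = sq u.
Proof. by rewrite /enorm sqr_sqrtr//; exact: sq_ge0. Qed.

Lemma enorm0 : enorm (0 : 'rV[R]_q) = 0.
Proof.
rewrite /enorm big1 ?sqrtr0// => i _.
by rewrite mxE expr0n.
Qed.

Lemma enormZ (c : R) u : enorm (c *: u) = `|c| * enorm u.
Proof.
rewrite /enorm -sqrtr_sqr -sqrtrM ?sqr_ge0//; congr Num.sqrt.
by rewrite mulr_sumr; apply: eq_bigr => i _; rewrite mxE exprMn.
Qed.

Lemma enorm_coord u i : `|u 0 i| <= enorm u.
Proof.
rewrite -sqrtr_sqr ler_wsqrtr// (bigD1 i)//= lerDl sumr_ge0// => j _.
exact: sqr_ge0.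
Qed.

Lemma enorm_eq0 u : enorm u = 0 -> u = 0.
Proof.
move=> u0; apply/rowP => i; rewrite mxE; apply/eqP; rewrite -normr_le0.
by rewrite -u0 enorm_coord.
Qed.

Lemma enorm_lt u (c : R) : 0 <= c -> (enorm u < c) = (sq u < c ^+ 2).
Proof.
by move=> c0; rewrite -enorm_sqr ltr_pXn2r// nnegrE// enorm_ge0.
Qed.

Lemma enorm_le u (c : R) : 0 <= c -> (enorm u <= c) = (sq u <= c ^+ 2).
Proof.
by move=> c0; rewrite -enorm_sqr ler_pXn2r// nnegrE// enorm_ge0.
Qed.

Lemma enorm_segment u v (r s : R) : enorm u <= r -> enorm v <= r -> 0 <= s <= 1 ->
  enorm (u + s *: (v - u)) <= r.
Proof.
move=> ur vr /andP[s0 s1]; have r0 : 0 <= r by apply: le_trans ur; exact: enorm_ge0.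
move: ur vr; rewrite !enorm_le// => ur vr.
have : sq (u + s *: (v - u)) <= (1 - s) * sq u + s * sq v.
  rewrite /sq !mulr_sumr -big_split; apply: ler_sum => i _ /=; rewrite !mxE.
  have := sqr_ge0 (u 0 i - v 0 i); set a := u 0 i; set b := v 0 i => h.
  have -> : (1 - s) * a ^+ 2 + s * b ^+ 2 = (a + s * (b - a)) ^+ 2 + s * (1 - s) * (a - b) ^+ 2 by ring.
  by rewrite lerDl; apply: mulr_ge0 => //; apply: mulr_ge0 => //; lra.
move/le_trans; apply.
have -> : r ^+ 2 = (1 - s) * r ^+ 2 + s * r ^+ 2 by ring.
by rewrite lerD// ler_wpM2l//; lra.
Qed.

Lemma enorm_near u v (c : R) : enorm u < c ->
  exists2 rho : R, 0 < rho & forall h : R, `|h| < rho -> enorm (u + h *: v) < c.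
Proof.
move=> uc; have c0 : 0 <= c by apply: le_trans (ltW uc); exact: enorm_ge0.
pose P (h : R) : R := sq u + h * (2 * \sum_(i < q) u 0 i * v 0 i) + h ^+ 2 * sq v.
have PE h : sq (u + h *: v) = P h.
  rewrite /P /sq !mulr_sumr -!big_split; apply: eq_bigr => i _ /=.
  by rewrite !mxE; ring.
move: uc; rewrite enorm_lt// => uc.
set b := 2 * _ in P PE; set a := sq v in P PE.
pose gap := c ^+ 2 - sq u; have gap0 : 0 < gap by rewrite subr_gt0.
have M0 : 0 < `|b| + a + 1 by rewrite ltr_wpDl// addr_ge0//; exact: sq_ge0.
exists (Num.min 1 (gap / (`|b| + a + 1))).
  by rewrite lt_min ltr01/= divr_gt0.
move=> h; rewrite lt_min => /andP[h1 hg]; rewrite enorm_lt// PE /P.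
have a0 : 0 <= a by exact: sq_ge0.
have e1 : h * b <= `|h| * `|b| by rewrite -normrM ler_norm.
have e2 : h ^+ 2 * a <= `|h| * a.
  rewrite ler_wpM2r// -[h ^+ 2]real_normK ?num_real// expr2 ler_piMr//.
  exact: ltW.
have e3 : `|h| * (`|b| + a + 1) < gap by rewrite -ltr_pdivlMr.
rewrite /gap in e3.
have : `|h| * `|b| + `|h| * a <= `|h| * (`|b| + a + 1).
  by rewrite -mulrDr ler_wpM2l// lerDl.
lra.
Qed.

End EuclideanNorm.

Section Along.
Context (R : realType) (q : nat).
Implicit Types (phi : 'rV[R]_q -> R) (w u : 'rV[R]_q).

(** Derivatives along every line through [w], in linear dependence on the
    direction: what the regularity assumptions give on the open ball, and all
    that one-dimensional calculus needs. *)
Definition has_partials phi w (D : 'I_q -> R) : Prop := forall u : 'rV[R]_q,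
  is_derive (0 : R) (1 : R) ((fun h : R => phi (w + h *: u)) : R^o -> R^o) (\sum_(l < q) D l * u 0 l).

Lemma has_partials_line phi w u (h : R) D : has_partials phi (w + h *: u) D ->
  is_derive h (1 : R) ((fun k : R => phi (w + k *: u)) : R^o -> R^o) (\sum_(l < q) D l * u 0 l).
Proof.
move=> /(_ u) dphi.
have dshift : is_derive h (1 : R) (shift (- h) : R^o -> R^o) 1 by exact: is_derive_shift.
have dphi' : is_derive (shift (- h) h) (1 : R) ((fun k : R => phi (w + h *: u + k *: u)) : R^o -> R^o) (\sum_(l < q) D l * u 0 l).
  by rewrite /shift /= subrr.
have := is_derive1_comp dphi' dshift; rewrite mulr1.
rewrite (_ : _ \o _ = fun k : R => phi (w + k *: u))//.
apply/funext => k /=; congr phi.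
by rewrite -addrA -scalerDl addrCA subrr addr0.
Qed.

Lemma partials_lipschitz phi (G : 'rV[R]_q -> 'I_q -> R) w (K : R) :
  (forall s : R, 0 <= s <= 1 -> has_partials phi (s *: w) (G (s *: w))) ->
  (forall (s : R) l, 0 <= s <= 1 -> `|G (s *: w) l| <= K) ->
  `|phi w - phi 0| <= q%:R * K * enorm w.
Proof.
move=> dphi GK.
have d (s : R) : 0 <= s <= 1 -> is_derive s (1 : R) ((fun k : R => phi (0 + k *: w)) : R^o -> R^o) (\sum_(l < q) G (s *: w) l * w 0 l).
  by move=> s01; apply: has_partials_line; rewrite add0r; exact: dphi.
have [||c] := @MVT_segment R (fun k : R => phi (0 + k *: w)) (fun s => \sum_(l < q) G (s *: w) l * w 0 l) 0 1 ler01.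
- by move=> s; rewrite in_itv/= => /andP[? ?]; apply: d; apply/andP; split; exact: ltW.
- apply: derivable_within_continuous => s; rewrite in_itv/= => s01.
  by case: (d s s01).
rewrite in_itv/= => c01; rewrite scale1r scale0r !add0r subr0 mulr1 => ->.
apply: (le_trans (ler_norm_sum _ _ _)).
apply: (@le_trans _ _ (\sum_(l < q) K * enorm w)).
  apply: ler_sum => l _; rewrite normrM ler_pM//; first exact: GK.
  exact: enorm_coord.
by rewrite sumr_const card_ord -[leRHS]mulrA mulr_natl.
Qed.

End Along.

(** * The least-squares criterion on one sample path *)

Lemma is_derive_sumr (R : realType) k (h : 'I_k -> R -> R) (dh : 'I_k -> R) (x : R) :
  (forall i, is_derive x (1 : R) (h i : R^o -> R^o) (dh i)) ->
  is_derive x (1 : R) ((fun s => \sum_(i < k) h i s) : R^o -> R^o) (\sum_(i < k) dh i).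
Proof.
elim: k h dh => [|k IH] h dh H.
  rewrite big_ord0 (_ : (fun s => _) = cst 0); first exact: is_derive_cst.
  by apply/funext => s; rewrite big_ord0.
rewrite big_ord_recr (_ : (fun s => _) =
    (fun s => \sum_(i < k) h (widen_ord (leqnSn k) i) s) + h ord_max).
  have dl := IH _ _ (fun i => H (widen_ord (leqnSn k) i)); have dr := H ord_max.
  exact: is_deriveD.
by apply/funext => s; rewrite big_ord_recr.
Qed.

Section Criterion.
Context (R : realType) (q : nat).
Notation leb := (@lebesgue_measure R).
Variables (T tau0 K1 K2 : R).
Hypothesis T0 : 0 < T.
Hypothesis K1_ge0 : 0 <= K1.
Hypothesis K2_ge0 : 0 <= K2.
Let D : set (measurableTypeR R) := `[0, T]%classic.
Variables (f : R -> 'rV[R]_q -> R) (F1 : 'I_q -> R -> 'rV[R]_q -> R)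
  (F2 : 'I_q -> 'I_q -> R -> 'rV[R]_q -> R).
Hypothesis df : forall t w, enorm w < tau0 -> has_partials (f t) w (fun l => F1 l t w).
Hypothesis dF1 : forall t w i, enorm w < tau0 ->
  has_partials (F1 i t) w (fun l => F2 i l t w).
Hypothesis mf : forall w, enorm w < tau0 -> measurable_fun [set: measurableTypeR R] (f^~ w).
Hypothesis F1b : forall i t w, 0 <= t <= T -> enorm w < tau0 -> `|F1 i t w| <= K1.
Hypothesis F2b : forall i l t w, 0 <= t <= T -> enorm w < tau0 -> `|F2 i l t w| <= K2.
(* [e] is the noise along one path; the observation is [x]. *)
Variables (e : R -> R).
Hypothesis me : measurable_fun D e.
Hypothesis ie2 : leb.-integrable D (EFin \o (fun t => e t ^+ 2)).
Let x t := f t 0 + e t.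

Definition average (T : R) (h : R -> R) : R := T^-1 * \int[@lebesgue_measure R]_(t in `[0, T]) h t.
Notation avg := (average T).

Let mD : measurable D. Proof. exact: measurable_itv. Qed.

Let DP t : D t -> 0 <= t <= T.
Proof. by rewrite /D/= in_itv. Qed.

Let icst (r : R) : leb.-integrable D (EFin \o (fun=> r)).
Proof.
have Dfin : (leb D < +oo)%E.
  by rewrite /D lebesgue_measure_itv /=; case: ifP => _; rewrite ?ltry// -EFinD ltry.
by apply: measurable_bounded_integrable => //; exact: bounded_cst.
Qed.

Let avg_cst (r : R) : avg (fun=> r) = r.
Proof.
have lebD : leb D = T%:E by rewrite lebesgue_measure_itv/= lte_fin T0 oppr0 adde0.
rewrite /average Rintegral_cst//.
have -> : fine (leb D) = T by exact: (congr1 fine lebD).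
by rewrite mulrCA mulVf ?mulr1// gt_eqF.
Qed.

Let eq_avg h k : (forall t, 0 <= t <= T -> h t = k t) -> avg h = avg k.
Proof.
by move=> hk; rewrite /average; congr (_ * _); apply: eq_Rintegral => t /set_mem/DP/hk.
Qed.

Let avgD h k : leb.-integrable D (EFin \o h) -> leb.-integrable D (EFin \o k) ->
  avg (fun t => h t + k t) = avg h + avg k.
Proof. by move=> ih ik; rewrite /average RintegralD// mulrDr. Qed.

Let avgB h k : leb.-integrable D (EFin \o h) -> leb.-integrable D (EFin \o k) ->
  avg (fun t => h t - k t) = avg h - avg k.
Proof. by move=> ih ik; rewrite /average RintegralB// mulrBr. Qed.

Let avgZ (c : R) h : leb.-integrable D (EFin \o h) -> avg (fun t => c * h t) = c * avg h.
Proof. by move=> ih; rewrite /average RintegralZl// mulrCA. Qed.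

Let avg_sum (c : 'I_q -> R) (h : 'I_q -> R -> R) :
  (forall l, leb.-integrable D (EFin \o h l)) ->
  avg (fun t => \sum_(l < q) c l * h l t) = \sum_(l < q) c l * avg (h l).
Proof.
move=> ih; rewrite /average Rintegral_sum//; last by move=> l; exact: integrable_scale.
by rewrite mulr_sumr; apply: eq_bigr => l _; rewrite RintegralZl// mulrCA.
Qed.

Let norm_avg h k : leb.-integrable D (EFin \o h) -> leb.-integrable D (EFin \o k) ->
  (forall t, 0 <= t <= T -> `|h t| <= k t) -> `|avg h| <= avg k.
Proof.
move=> ih ik hk; rewrite /average normrM ger0_norm ?invr_ge0 ?(ltW T0)//.
rewrite ler_wpM2l ?invr_ge0 ?(ltW T0)//.
apply: (le_trans (le_normr_Rintegral _ ih)) => //.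
by apply: le_Rintegral => //; exact: integrable_norm.
Qed.

(* A partial derivative is a limit of difference quotients, hence measurable
   in time, although only the function itself is known to be measurable. *)
Let measurable_partial (phi : R -> 'rV[R]_q -> R) (G : 'I_q -> R -> 'rV[R]_q -> R) w l :
  enorm w < tau0 ->
  (forall t, has_partials (phi t) w (fun l => G l t w)) ->
  (forall w, enorm w < tau0 -> measurable_fun [set: measurableTypeR R] (phi^~ w)) ->
  measurable_fun [set: measurableTypeR R] (G l ^~ w).
Proof.
move=> wt dphi mphi.
have [rho rho0 Hrho] := enorm_near (delta_mx 0 l) wt.
have [N Nrho] : exists N : nat, forall n : nat, n.+1%:R^-1 < rho \/ (n < N)%N.
  have := @cvg_harmonic R; move=> /cvgrPdist_lt/(_ _ rho0)[N _ HN].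
  exists N => n; have [|Nn] := ltnP n N; first by right.
  left; have := HN n Nn; rewrite /= sub0r normrN ger0_norm ?invr_ge0//.
pose hn (n : nat) := (n + N).+1%:R^-1 : R.
have hn0 n : 0 < hn n by rewrite invr_gt0.
have hnrho n : `|hn n| < rho.
  rewrite ger0_norm ?ltW//.
  by have [//|] := Nrho (n + N)%N; rewrite ltnNge leq_addl.
apply: (@measurable_fun_cvg _ _ _ _ (fun n t => (hn n)^-1 * (phi t (w + hn n *: delta_mx 0 l) - phi t w))).
  move=> n; apply: measurable_funM => //.
  by apply: measurable_funB; [apply: mphi; exact: Hrho|exact: mphi].
move=> t _; have := dphi t (delta_mx 0 l).
have -> : \sum_(l0 < q) G l0 t w * (delta_mx 0 l : 'rV[R]_q) 0 l0 = G l t w.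
  rewrite (bigD1 l)//= big1 ?addr0 => [|i il]; first by rewrite mxE !eqxx mulr1.
  by rewrite mxE (negbTE il) andbF mulr0.
case=> /cvg_ex[/= L cL] dE.
have LE : L = G l t w by rewrite -dE; apply/esym/cvg_lim.
have hcv : hn n @[n --> \oo] --> (0 : R).
  by have := @cvg_harmonic R; rewrite -(cvg_shiftn N).
rewrite -LE; move: cL => /cvgr_dnbhsP/(_ hn (conj (fun n => lt0r_neq0 (hn0 n)) hcv)).
by under eq_fun do rewrite addr0 scale0r addr0 [_%:A]mulr1.
Qed.

Lemma measurable_F1 i w : enorm w < tau0 -> measurable_fun [set: measurableTypeR R] (F1 i ^~ w).
Proof.
by move=> wt; apply: (@measurable_partial f F1 w i wt _ mf) => t; exact: df.
Qed.

Lemma measurable_F2 i l w : enorm w < tau0 -> measurable_fun [set: measurableTypeR R] (F2 i l ^~ w).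
Proof.
move=> wt; apply: (@measurable_partial (F1 i) (F2 i) w l wt) => [t|w' wt'].
  exact: dF1.
exact: measurable_F1.
Qed.

Let ie : leb.-integrable D (EFin \o (fun t => `|e t|)).
Proof.
apply: (integrable_dom _ _ (integrableDr mD (icst 1) ie2)) => //.
  exact: measurableT_comp.
move=> t _; rewrite normr_id -[e t ^+ 2]real_normK ?num_real//.
by have := normr_ge0 (e t); set z := `|e t|; nra.
Qed.

Let f_lip t w : 0 <= t <= T -> enorm w < tau0 -> `|f t w - f t 0| <= q%:R * K1 * enorm w.
Proof.
move=> tT wt; have H (s : R) : 0 <= s <= 1 -> enorm (s *: w) < tau0.
  move=> /andP[s0 s1]; apply: le_lt_trans wt.
  by rewrite enormZ ger0_norm// ler_piMl// enorm_ge0.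
apply: (@partials_lipschitz _ _ (f t) (fun w l => F1 l t w)) => s.
  by move=> s01; apply: df; exact: H.
by move=> l s01; apply: F1b => //; exact: H.
Qed.

Let F1_lip i t w : 0 <= t <= T -> enorm w < tau0 ->
  `|F1 i t w - F1 i t 0| <= q%:R * K2 * enorm w.
Proof.
move=> tT wt; have H (s : R) : 0 <= s <= 1 -> enorm (s *: w) < tau0.
  move=> /andP[s0 s1]; apply: le_lt_trans wt.
  by rewrite enormZ ger0_norm// ler_piMl// enorm_ge0.
apply: (@partials_lipschitz _ _ (F1 i t) (fun w l => F2 i l t w)) => s.
  by move=> s01; apply: dF1; exact: H.
by move=> l s01; apply: F2b => //; exact: H.
Qed.

Let Kf : R := q%:R * K1 * tau0.

Let resid_b t w : 0 <= t <= T -> enorm w < tau0 -> `|x t - f t w| <= `|e t| + Kf.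
Proof.
move=> tT wt; have -> : x t - f t w = e t + (f t 0 - f t w) by rewrite /x; ring.
apply: (le_trans (ler_normD _ _)); rewrite lerD2l distrC.
apply: (le_trans (f_lip tT wt)); rewrite ler_wpM2l ?mulr_ge0//; exact: ltW.
Qed.

Let mx w : enorm w < tau0 -> 0 < tau0 -> measurable_fun D (fun t => x t - f t w).
Proof.
move=> wt t0; apply: measurable_funB; last by apply: measurable_funTS; exact: mf.
apply: measurable_funD => //; apply: measurable_funTS; apply: mf.
by rewrite enorm0.
Qed.

Hypothesis tau0_gt0 : 0 < tau0.

Let Kf0 : 0 <= Kf. Proof. by rewrite /Kf !mulr_ge0// ltW. Qed.

Lemma integrable_residual_sqr w : enorm w < tau0 ->
  leb.-integrable D (EFin \o (fun t => (x t - f t w) ^+ 2)).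
Proof.
move=> wt; have I := integrableDr mD (integrable_scale mD 2 ie2) (icst (2 * Kf ^+ 2)).
apply: (integrable_dom _ _ I) => //.
  by apply: measurable_funX; exact: mx.
move=> t /DP tT; rewrite ger0_norm ?sqr_ge0//.
have := resid_b tT wt; rewrite -[(x t - _) ^+ 2]real_normK ?num_real//.
rewrite -[e t ^+ 2]real_normK ?num_real//.
have := normr_ge0 (x t - f t w); have := normr_ge0 (e t); have := Kf0.
set a := `|e t|; set b := `|x t - f t w|; set c := Kf => c0 a0 b0 h.
have : b ^+ 2 <= (a + c) ^+ 2 by rewrite lerXn2r// nnegrE// addr_ge0.
by have := sqr_ge0 (a - c); nra.
Qed.

Let integrable_residM w (k : R -> R) (K : R) : enorm w < tau0 -> 0 <= K ->
  measurable_fun [set: measurableTypeR R] k -> (forall t, 0 <= t <= T -> `|k t| <= K) ->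
  leb.-integrable D (EFin \o (fun t => (x t - f t w) * k t)).
Proof.
move=> wt K0 mk kK.
have I := integrable_scale mD K (integrableDr mD ie (icst Kf)).
apply: (integrable_dom _ _ I) => //.
  by apply: measurable_funM; [exact: mx|exact: measurable_funTS].
move=> t /DP tT; rewrite normrM mulrC ler_pM//; first exact: kK.
exact: resid_b.
Qed.

Let integrable_bdd (k : R -> R) (K : R) :
  measurable_fun [set: measurableTypeR R] k -> (forall t, 0 <= t <= T -> `|k t| <= K) ->
  leb.-integrable D (EFin \o k).
Proof.
move=> mk kK; apply: (integrable_dom _ _ (icst K)) => //; exact: measurable_funTS.
Qed.

Definition criterion w := avg (fun t => (x t - f t w) ^+ 2).

(** The gradient of half the criterion, see [criterion_derive]. *)
Definition half_gradient i w := avg (fun t => (x t - f t w) * - F1 i t w).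

Lemma integrable_gradient i w : enorm w < tau0 ->
  leb.-integrable D (EFin \o (fun t => (x t - f t w) * - F1 i t w)).
Proof.
move=> wt; apply: (@integrable_residM w _ K1) => //.
  exact: measurableT_comp (measurable_F1 i wt).
by move=> t tT; rewrite normrN; exact: F1b.
Qed.

Let usum (u : 'rV[R]_q) := \sum_(l < q) `|u 0 l|.

Let lin_b (G : 'I_q -> R) (u : 'rV[R]_q) (K : R) : (forall l, `|G l| <= K) ->
  `|\sum_(l < q) G l * u 0 l| <= K * usum u.
Proof.
move=> GK; apply: (le_trans (ler_norm_sum _ _ _)); rewrite /usum mulr_sumr.
by apply: ler_sum => l _; rewrite normrM ler_wpM2r.
Qed.

Let usum0 u : 0 <= usum u. Proof. exact: sumr_ge0. Qed.

Let abs_range (rho h : R) : - rho < h < rho -> `|h| < rho.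
Proof. by rewrite ltr_norml. Qed.

Lemma criterion_derive w u : enorm w < tau0 ->
  is_derive (0 : R) (1 : R) ((fun h : R => criterion (w + h *: u)) : R^o -> R^o)
    (2 * \sum_(l < q) u 0 l * half_gradient l w).
Proof.
move=> wt; have [rho rho0 Hrho] := enorm_near u wt.
have {}Hrho (h : R) : - rho < h < rho -> enorm (w + h *: u) < tau0 by move/abs_range/Hrho.
pose g h t := (x t - f t (w + h *: u)) ^+ 2.
pose g' h t := 2 * ((x t - f t (w + h *: u)) * - \sum_(l < q) F1 l t (w + h *: u) * u 0 l).
pose G t := 2 * (K1 * usum u) * (`|e t| + Kf).
have dg : is_derive (0 : R) (1 : R) ((fun h : R => \int[leb]_(t in D) g h t) : R^o -> R^o)
    (\int[leb]_(t in D) g' 0 t).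
  apply: (@is_derive_under_integral R _ _ leb D g g' 0 (- rho) rho G) => //.
  - by rewrite oppr_lt0 rho0.
  - by move=> h /Hrho; exact: integrable_residual_sqr.
  - move=> h t /Hrho hh _; have dft := has_partials_line (df t hh).
    by apply: trigger_derive; rewrite /g'; rewrite /GRing.scale/=; ring.
  - by move=> t; rewrite !mulr_ge0// addr_ge0.
  - by apply: integrable_scale => //; exact: integrableDr.
  - move=> h t /Hrho hh /DP tT; rewrite /g' /G normrM ger0_norm// -mulrA ler_wpM2l//.
    rewrite normrM normrN mulrC ler_pM//; last exact: resid_b.
    by apply: lin_b => l; exact: F1b.
have : is_derive (0 : R) (1 : R) ((fun h : R => T^-1 * \int[leb]_(t in D) g h t) : R^o -> R^o)
    (T^-1 * \int[leb]_(t in D) g' 0 t).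
  by apply: trigger_derive; rewrite /GRing.scale/=; ring.
have -> : T^-1 * \int[leb]_(t in D) g' 0 t = 2 * \sum_(l < q) u 0 l * half_gradient l w; last by [].
rewrite -/(average T (g' 0)) /half_gradient -avg_sum; last first.
  by move=> l; exact: integrable_gradient.
rewrite -avgZ; last first.
  apply: integrable_sumr => // l; apply: integrable_scale => //.
  exact: integrable_gradient.
apply: eq_avg => t _; rewrite /g' scale0r addr0; congr (_ * _).
rewrite -sumrN mulr_sumr; apply: eq_bigr => l _; ring.
Qed.

Definition hessian i l w := avg (fun t => F1 i t w * F1 l t w - (x t - f t w) * F2 i l t w).

Lemma integrable_F1F1 i l w : enorm w < tau0 -> leb.-integrable D (EFin \o (fun t => F1 i t w * F1 l t w)).
Proof.
move=> wt; apply: (@integrable_bdd _ (K1 * K1)).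
  by apply: measurable_funM; exact: measurable_F1.
by move=> t tT; rewrite normrM ler_pM// F1b.
Qed.

Let int_rF i l w : enorm w < tau0 -> leb.-integrable D (EFin \o (fun t => (x t - f t w) * F2 i l t w)).
Proof.
move=> wt; apply: (@integrable_residM w _ K2) => //; first exact: measurable_F2.
by move=> t tT; exact: F2b.
Qed.

Lemma half_gradient_derive i w u : enorm w < tau0 ->
  is_derive (0 : R) (1 : R) ((fun h : R => half_gradient i (w + h *: u)) : R^o -> R^o)
    (\sum_(l < q) u 0 l * hessian i l w).
Proof.
move=> wt; have [rho rho0 Hrho] := enorm_near u wt.
have {}Hrho (h : R) : - rho < h < rho -> enorm (w + h *: u) < tau0 by move/abs_range/Hrho.
pose g h t := (x t - f t (w + h *: u)) * - F1 i t (w + h *: u).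
pose g' h t := F1 i t (w + h *: u) * (\sum_(l < q) F1 l t (w + h *: u) * u 0 l) -
   (x t - f t (w + h *: u)) * (\sum_(l < q) F2 i l t (w + h *: u) * u 0 l).
pose G t := K1 * (K1 * usum u) + (K2 * usum u) * (`|e t| + Kf).
have dg : is_derive (0 : R) (1 : R) ((fun h : R => \int[leb]_(t in D) g h t) : R^o -> R^o)
    (\int[leb]_(t in D) g' 0 t).
  apply: (@is_derive_under_integral R _ _ leb D g g' 0 (- rho) rho G) => //.
  - by rewrite oppr_lt0 rho0.
  - by move=> h /Hrho hh; exact: integrable_gradient.
  - move=> h t /Hrho hh _; have dft := has_partials_line (df t hh).
    have dF1t := has_partials_line (dF1 t i hh).
    by apply: trigger_derive; rewrite /g'; rewrite /GRing.scale/=; ring.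
  - by move=> t; rewrite !addr_ge0 ?mulr_ge0// addr_ge0.
  - apply: integrableDr => //; apply: integrable_scale => //; exact: integrableDr.
  - move=> h t /Hrho hh /DP tT; rewrite /g' /G; apply: (le_trans (ler_normB _ _)).
    rewrite lerD//.
      by rewrite normrM ler_pM ?F1b//; apply: lin_b => l; exact: F1b.
    rewrite normrM mulrC ler_pM//; last exact: resid_b.
    by apply: lin_b => l; exact: F2b.
have : is_derive (0 : R) (1 : R) ((fun h : R => T^-1 * \int[leb]_(t in D) g h t) : R^o -> R^o)
    (T^-1 * \int[leb]_(t in D) g' 0 t).
  by apply: trigger_derive; rewrite /GRing.scale/=; ring.
have -> : T^-1 * \int[leb]_(t in D) g' 0 t = \sum_(l < q) u 0 l * hessian i l w; last by [].
rewrite -/(average T (g' 0)) /hessian -avg_sum; last first.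
  by move=> l; apply: integrableBr => //; [exact: integrable_F1F1|exact: int_rF].
apply: eq_avg => t _; rewrite /g' scale0r addr0 !mulr_sumr -sumrB.
by apply: eq_bigr => l _; ring.
Qed.

Variables (lam Kn K3 del r0 : R).
Hypothesis r0_gt0 : 0 < r0.
Hypothesis r0_lt : r0 < tau0.
(* The first two conditions hold with high probability; the last two express the
   smoothness of the second derivatives and the positivity of the information
   matrix. *)
Hypothesis noise_energy : avg (fun t => e t ^+ 2) <= Kn.
Hypothesis noise_F2 : forall i l, `|avg (fun t => e t * F2 i l t 0)| <= del.
Hypothesis PhiF2 : forall i l w, enorm w <= r0 ->
  avg (fun t => (F2 i l t w - F2 i l t 0) ^+ 2) <= K3 * r0 ^+ 2.
Hypothesis J_pos : forall u : 'rV[R]_q, lam * enorm u ^+ 2 <=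
  \sum_(i < q) \sum_(l < q) u 0 i * u 0 l * avg (fun t => F1 i t 0 * F1 l t 0).

Definition hessian_error := 3 * q%:R * K1 * K2 * r0 + r0 * (Kn + K3) / 2 + del.

Lemma integrable_F2_increment i l w : enorm w < tau0 ->
  leb.-integrable D (EFin \o (fun t => (F2 i l t w - F2 i l t 0) ^+ 2)).
Proof.
move=> wt; have zt : enorm (0 : 'rV[R]_q) < tau0 by rewrite enorm0.
apply: (@integrable_bdd _ ((K2 + K2) ^+ 2)).
  by apply: measurable_funX; apply: measurable_funB; exact: measurable_F2.
move=> t tT; rewrite normrX lerXn2r// ?nnegrE ?addr_ge0//.
by apply: (le_trans (ler_normB _ _)); rewrite lerD// F2b.
Qed.

(** The difference from the information matrix splits into four terms: the
    increments of F1 and of f are bounded through the mean value theorem, the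
    product of the noise with the increment of F2 by the energies of both factors
    (weighted arithmetic-geometric inequality with weight r0), and the remaining
    term, the noise against F2 at 0, is small only through cancellation in the
    noise. *)
Lemma hessian_near i l w : enorm w <= r0 ->
  `|hessian i l w - avg (fun t => F1 i t 0 * F1 l t 0)| <= hessian_error.
Proof.
move=> wr; have wt : enorm w < tau0 by apply: le_lt_trans r0_lt.
have zt : enorm (0 : 'rV[R]_q) < tau0 by rewrite enorm0.
have qK1 : 0 <= q%:R * K1 by rewrite mulr_ge0.
have qK2 : 0 <= q%:R * K2 by rewrite mulr_ge0.
have I1 : leb.-integrable D (EFin \o (fun t => F1 i t w * F1 l t w - F1 i t 0 * F1 l t 0)).
  by apply: integrableBr => //; exact: integrable_F1F1.
have I2 : leb.-integrable D (EFin \o (fun t => (f t 0 - f t w) * F2 i l t w)).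
  apply: (@integrable_bdd _ (q%:R * K1 * enorm w * K2)).
    by apply: measurable_funM; [apply: measurable_funB; exact: mf|exact: measurable_F2].
  by move=> t tT; rewrite normrM ler_pM ?F2b// distrC; exact: f_lip.
have ieF w' : enorm w' < tau0 -> leb.-integrable D (EFin \o (fun t => e t * F2 i l t w')).
  move=> wt'; apply: (integrable_dom _ _ (integrable_scale mD K2 ie)) => //.
    by apply: measurable_funM => //; apply: measurable_funTS; exact: measurable_F2.
  by move=> t /DP tT; rewrite normrM mulrC ler_wpM2r// F2b.
have I3 : leb.-integrable D (EFin \o (fun t => e t * F2 i l t w - e t * F2 i l t 0)).
  by apply: integrableBr => //; exact: ieF.
have I4 := ieF _ zt.
have -> : hessian i l w - avg (fun t => F1 i t 0 * F1 l t 0) =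
   avg (fun t => F1 i t w * F1 l t w - F1 i t 0 * F1 l t 0) -
   avg (fun t => (f t 0 - f t w) * F2 i l t w) -
   avg (fun t => e t * F2 i l t w - e t * F2 i l t 0) - avg (fun t => e t * F2 i l t 0).
  rewrite /hessian -!avgB//; try by [apply: integrable_F1F1|apply: integrableBr => //; apply: integrableBr|apply: integrableBr => //; [exact: integrable_F1F1|exact: int_rF]].
  by apply: eq_avg => t _; rewrite /x; ring.
have B1 : `|avg (fun t => F1 i t w * F1 l t w - F1 i t 0 * F1 l t 0)| <= 2 * q%:R * K1 * K2 * r0.
  rewrite -[leRHS]avg_cst; apply: norm_avg => // t tT.
  have -> : F1 i t w * F1 l t w - F1 i t 0 * F1 l t 0 =
    (F1 i t w - F1 i t 0) * F1 l t w + F1 i t 0 * (F1 l t w - F1 l t 0) by ring.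
  apply: (le_trans (ler_normD _ _)); rewrite !normrM.
  have -> : 2 * q%:R * K1 * K2 * r0 = q%:R * K2 * r0 * K1 + K1 * (q%:R * K2 * r0) by ring.
  have lip j : `|F1 j t w - F1 j t 0| <= q%:R * K2 * r0.
    by apply: (le_trans (F1_lip j tT wt)); rewrite ler_wpM2l.
  by rewrite lerD// ler_pM// F1b.
have B2 : `|avg (fun t => (f t 0 - f t w) * F2 i l t w)| <= q%:R * K1 * K2 * r0.
  rewrite -[leRHS]avg_cst; apply: norm_avg => // t tT.
  have -> : q%:R * K1 * K2 * r0 = q%:R * K1 * r0 * K2 by ring.
  rewrite normrM ler_pM ?F2b// distrC; apply: (le_trans (f_lip tT wt)).
  by rewrite ler_wpM2l.
have B3 : `|avg (fun t => e t * F2 i l t w - e t * F2 i l t 0)| <= r0 * (Kn + K3) / 2.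
  have IP := integrable_F2_increment i l wt.
  have IA := integrable_scale mD (r0 / 2) ie2.
  have IB := integrable_scale mD ((2 * r0)^-1) IP.
  apply: (@le_trans _ _ (avg (fun t => r0 / 2 * e t ^+ 2 + (2 * r0)^-1 * (F2 i l t w - F2 i l t 0) ^+ 2))).
    apply: norm_avg => //; first exact: integrableDr.
    move=> t tT; rewrite -mulrBr; set a := e t; set b := F2 i l t w - _.
    have p2 : 0 <= (2 * r0)^-1 by rewrite invr_ge0 mulr_ge0// ltW.
    have E1 : r0 / 2 * a ^+ 2 + (2 * r0)^-1 * b ^+ 2 - a * b = (2 * r0)^-1 * (r0 * a - b) ^+ 2.
      by field; rewrite gt_eqF.
    have E2 : r0 / 2 * a ^+ 2 + (2 * r0)^-1 * b ^+ 2 + a * b = (2 * r0)^-1 * (r0 * a + b) ^+ 2.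
      by field; rewrite gt_eqF.
    have N1 : 0 <= (2 * r0)^-1 * (r0 * a - b) ^+ 2 by rewrite mulr_ge0// sqr_ge0.
    have N2 : 0 <= (2 * r0)^-1 * (r0 * a + b) ^+ 2 by rewrite mulr_ge0// sqr_ge0.
    by rewrite ler_norml; apply/andP; split; lra.
  rewrite avgD// !avgZ//.
  have -> : r0 * (Kn + K3) / 2 = r0 / 2 * Kn + (2 * r0)^-1 * (K3 * r0 ^+ 2).
    by field; rewrite gt_eqF.
  rewrite lerD// ler_wpM2l ?invr_ge0 ?divr_ge0 ?mulr_ge0 ?(ltW r0_gt0)//.
  exact: PhiF2.
rewrite /hessian_error.
apply: (le_trans (ler_normB _ _)); rewrite lerD ?noise_F2//.
apply: (le_trans (ler_normB _ _)); rewrite lerD//.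
apply: (le_trans (ler_normB _ _)).
have -> : 3 * q%:R * K1 * K2 * r0 = 2 * q%:R * K1 * K2 * r0 + q%:R * K1 * K2 * r0 by ring.
by rewrite lerD.
Qed.

Hypothesis small : q%:R * q%:R * hessian_error < lam.

Lemma hessian_definite (w u : 'rV[R]_q) : enorm w <= r0 ->
  \sum_(i < q) u 0 i * \sum_(l < q) u 0 l * hessian i l w = 0 -> u = 0.
Proof.
move=> wr H0; apply: enorm_eq0.
set J := fun i l => avg (fun t => F1 i t 0 * F1 l t 0).
have E : \sum_(i < q) \sum_(l < q) u 0 i * u 0 l * J i l =
   - \sum_(i < q) \sum_(l < q) u 0 i * u 0 l * (hessian i l w - J i l).
  apply/eqP; rewrite -subr_eq0 opprK -big_split/=; apply/eqP.
  rewrite -[RHS]H0; apply: eq_bigr => i _; rewrite -big_split mulr_sumr/=.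
  by apply: eq_bigr => l _; ring.
have := J_pos u; rewrite -/J E => h.
have : - \sum_(i < q) \sum_(l < q) u 0 i * u 0 l * (hessian i l w - J i l) <=
   q%:R * q%:R * hessian_error * enorm u ^+ 2.
  apply: (le_trans (ler_norm _)); rewrite normrN.
  apply: (le_trans (ler_norm_sum _ _ _)).
  apply: (@le_trans _ _ (\sum_(i < q) \sum_(l < q) hessian_error * enorm u ^+ 2)).
    apply: ler_sum => i _; apply: (le_trans (ler_norm_sum _ _ _)).
    apply: ler_sum => l _; rewrite !normrM mulrC ler_pM ?mulr_ge0//.
      exact: hessian_near.
    by rewrite expr2 ler_pM// enorm_coord.
  by rewrite !sumr_const !card_ord -mulrnA -[leLHS]mulr_natl natrM mulrA.
move=> h2; have {h2}h := le_trans h h2.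
have : (lam - q%:R * q%:R * hessian_error) * enorm u ^+ 2 <= 0 by rewrite mulrBl subr_le0.
rewrite pmulr_rle0 ?subr_gt0// => h3.
by apply/eqP; rewrite -sqrf_eq0 eq_le h3 sqr_ge0.
Qed.

(** Rolle's theorem for s |-> <half_gradient (v' + s (v - v')), v - v'>, which
    vanishes at both ends, gives a point where the Hessian form is zero in the
    direction v - v'. *)
Lemma half_gradient_unique v v' : enorm v <= r0 -> enorm v' <= r0 ->
  (forall i, half_gradient i v = 0) -> (forall i, half_gradient i v' = 0) -> v = v'.
Proof.
move=> vr vr' H H'; apply/eqP; rewrite -subr_eq0; apply/eqP.
set u := v - v'.
pose phi (s : R) := \sum_(i < q) u 0 i * half_gradient i (v' + s *: u).
have seg (s : R) : 0 <= s <= 1 -> enorm (v' + s *: u) <= r0.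
  by move=> s01; exact: enorm_segment.
have dphi (s : R) : 0 <= s <= 1 -> is_derive s (1 : R) (phi : R^o -> R^o)
    (\sum_(i < q) u 0 i * \sum_(l < q) u 0 l * hessian i l (v' + s *: u)).
  move=> s01; have st : enorm (v' + s *: u) < tau0 by apply: le_lt_trans r0_lt; exact: seg.
  apply: (@is_derive_sumr R q (fun i s => u 0 i * half_gradient i (v' + s *: u))) => i.
  have Hi : has_partials (half_gradient i) (v' + s *: u) (fun l => hessian i l (v' + s *: u)).
    move=> z; have := half_gradient_derive i z st.
    by under eq_bigr do rewrite mulrC.
  have := has_partials_line Hi; under eq_bigr do rewrite mulrC; move=> dH.
  by apply: trigger_derive; rewrite /GRing.scale/=; ring.
have [] := @Rolle R phi 0 1 ltr01.
- by move=> s; rewrite in_itv/= => /andP[s0 s1]; case: (dphi s) => //; rewrite !ltW.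
- by apply: derivable_within_continuous => s; rewrite in_itv/= => s01; case: (dphi s).
- rewrite /phi scale0r addr0 scale1r addrC subrK.
  by rewrite !big1// => i _; rewrite ?H ?H' mulr0.
move=> c; rewrite in_itv/= => /andP[c0 c1] dc.
have c01 : 0 <= c <= 1 by rewrite !ltW.
apply: (@hessian_definite (v' + c *: u)); first exact: seg.
have d1 := dphi c c01.
by rewrite -[LHS](@derive_val _ _ _ _ _ _ _ d1) (@derive_val _ _ _ _ _ _ _ dc).
Qed.

End Criterion.

(** * From gradients to partial derivatives *)

Section Derivatives.
Context (R : realType) (q : nat).

Lemma is_derive0_bound (F : R -> R) (L : R) :
  (forall e : R, 0 < e -> exists2 rho : R, 0 < rho &
     forall h, `|h| < rho -> `|F h - F 0 - h * L| <= e * `|h|) ->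
  is_derive (0 : R) (1 : R) (F : R^o -> R^o) L.
Proof.
move=> H.
have cv : h^-1 *: ((F : R^o -> R^o) (h *: (1 : R) + 0) - F 0) @[h --> (0 : R)^'] --> (L : R^o).
  apply/cvgrPdist_le => e e0; have [rho rho0 Hr] := H e e0.
  rewrite near_withinE; near=> h => /= h0.
  have hr : `|h| < rho.
    have : ball (0 : R) rho h by near: h; exact: nbhsx_ballx.
    by rewrite /ball/= sub0r normrN.
  have -> : h *: (1 : R) + 0 = h by rewrite addr0 [_ *: _]mulr1.
  have h0' : 0 < `|h| by rewrite normr_gt0.
  rewrite distrC -(ler_pM2r h0') -normrM /GRing.scale/=.
  have -> : (h^-1 * (F h - F 0) - L) * h = F h - F 0 - h * L.
    by rewrite mulrBl mulrAC mulVf// mul1r; ring.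
  exact: Hr.
apply: DeriveDef; first by apply/cvg_ex; exists L.
exact: cvg_lim cv.
Unshelve. all: by end_near. Qed.

Lemma is_derive_along (F : 'rV[R]_q -> R) (v u : 'rV[R]_q) (L : R) :
  is_derive (0 : R) (1 : R) ((fun h : R => F (v + h *: u)) : R^o -> R^o) L ->
  is_derive v u (F : 'rV[R]_q -> R^o) L.
Proof.
move=> [dF vF].
have E : (fun h : R => h^-1 *: (((fun h : R => F (v + h *: u)) : R^o -> R^o) (h *: (1 : R) + 0) - F (v + (0 : R) *: u))) =
         (fun h : R => h^-1 *: ((F : 'rV[R]_q -> R^o) (h *: u + v) - F v)).
  apply/funext => h; rewrite scale0r addr0 addr0.
  by rewrite [h *: (1 : R)]mulr1 [v + _]addrC.
apply: DeriveDef.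
  by move: dF; rewrite /derivable /comp /shift/= E.
by move: vF; rewrite /derive /comp /shift/= E.
Qed.

(** The chain rule along a diagonal affine change of variables. The relative
    gradient suffices because a short segment through [w] in each direction is
    mapped into [A]. *)
Lemma gradient_partials (A : set 'rV[R]_q) (phi : 'rV[R]_q -> R)
    (p : 'rV[R]_q -> 'rV[R]_q) (w : 'rV[R]_q) (c : 'I_q -> R) (G : 'I_q -> R) :
  (forall (h : R) u, p (w + h *: u) = p w + h *: \row_l (c l * u 0 l)) ->
  (forall u : 'rV[R]_q, exists2 rho : R, 0 < rho & forall h : R, `|h| < rho -> A (p (w + h *: u))) ->
  has_gradient A phi (p w) G ->
  has_partials (fun w => phi (p w)) w (fun l => c l * G l).
Proof.
move=> pE Anear grad u; apply: is_derive0_bound => e e0.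
pose z : 'rV[R]_q := \row_l (c l * u 0 l).
have z1 : 0 < enorm z + 1 by rewrite ltr_wpDl// enorm_ge0.
have [rho1 rho10 HA] := Anear u.
have /nbhs_ballP[rho2 /= rho20 Hg] := grad (e / (enorm z + 1)) (divr_gt0 e0 z1).
have M0 : 0 < `|z| + 1 by rewrite ltr_wpDl.
exists (Num.min rho1 (rho2 / (`|z| + 1))).
  by rewrite lt_min rho10 divr_gt0.
move=> h; rewrite lt_min => /andP[h1 h2].
rewrite scale0r addr0 pE -/z.
have By : ball (p w) rho2 (p w + h *: z).
  rewrite mx_norm_ball /ball_ /= opprD addrA subrr sub0r normrN.
  rewrite normrZ; apply: (@le_lt_trans _ _ (`|h| * (`|z| + 1))).
    by rewrite ler_wpM2l// lerDl.
  by rewrite -ltr_pdivlMr.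
have := Hg _ By; rewrite -pE => /(_ (HA h h1)); rewrite pE -/z.
have -> : \sum_(i < q) G i * ((p w + h *: z) 0 i - p w 0 i) = h * \sum_(l < q) c l * G l * u 0 l.
  rewrite mulr_sumr; apply: eq_bigr => i _; rewrite !mxE; ring.
move/le_trans; apply.
have -> : p w + h *: z - p w = h *: z by rewrite addrAC subrr add0r.
rewrite enormZ mulrCA mulrC ler_wpM2r//.
rewrite mulrAC ler_pdivrMr// ler_wpM2l ?(ltW e0)//.
by rewrite lerDl.
Qed.

Lemma continuous_slice (A : set 'rV[R]_q) (g : R -> 'rV[R]_q -> R) (y : 'rV[R]_q) :
  {within [set: R] `*` A, continuous (fun p : R * 'rV[R]_q => g p.1 p.2)} ->
  A y -> continuous (g^~ y).
Proof.
move=> cg Ay t.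
have /subspace_continuousP/(_ (t, y)) := cg.
move=> /(_ (conj I Ay)) cgt.
have : (fun s : R => (s, y)) s @[s --> t] --> within ([set: R] `*` A) (nbhs (t, y)).
  move=> U; rewrite /within/= => HU.
  have : \forall s \near t, ([set: R] `*` A) (s, y) -> U (s, y).
    have c : (fun s : R => (s, y)) s @[s --> t] --> (t, y).
      have c1 : (fun s : R => s) s @[s --> t] --> t by exact: cvg_id.
      have c2 : (fun s : R => y) s @[s --> t] --> y by apply: cst_continuous.
      exact: (cvg_pair c1 c2).
    exact: (c _ HU).
  by apply: filterS => s; apply.
by move=> /cvg_comp/(_ cgt).
Qed.

End Derivatives.

(** * The normed regression model on one sample path *)

Lemma has_partials_scale (R : realType) (q : nat) (phi : 'rV[R]_q -> R) w G (a : R) :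
  has_partials phi w G -> has_partials (fun v => a * phi v) w (fun l => a * G l).
Proof.
move=> H u; have dH := H u.
have -> : \sum_(l < q) a * G l * u 0 l = a * \sum_(l < q) G l * u 0 l.
  by rewrite mulr_sumr; apply: eq_bigr => l _; rewrite mulrA.
by apply: trigger_derive; rewrite /GRing.scale/=; ring.
Qed.

Section Sample.
Context (R : realType) (q : nat).
Notation leb := (@lebesgue_measure R).
Variables (g : R -> 'rV[R]_q -> R) (g1 : 'I_q -> R -> 'rV[R]_q -> R)
  (g2 : 'I_q -> 'I_q -> R -> 'rV[R]_q -> R) (Theta : set 'rV[R]_q) (theta : 'rV[R]_q).
Hypothesis g_continuous : {within [set: R] `*` closure Theta,
     continuous (fun p : R * 'rV[R]_q => g p.1 p.2)}.
Hypothesis cond1 : forall t, twice_differentiable_on (closure Theta) (g t)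
     (fun i => g1 i t) (fun i l => g2 i l t).
Variables (T tau0 : R) (k1 : 'I_q -> R) (k2 kt kh : 'I_q -> 'I_q -> R).
Hypothesis T0 : 0 < T.
Hypothesis tau0_gt0 : 0 < tau0.
Hypothesis d_gt0 : forall i, 0 < dT1 g1 T theta i.
Hypothesis k1_gt0 : forall i, 0 < k1 i.
Hypothesis k2_gt0 : forall i l, 0 < k2 i l.
Hypothesis kt_gt0 : forall i l, 0 < kt i l.
Hypothesis kh_gt0 : forall i l, 0 < kh i l.
Notation wp := (wpoint g1 theta T).
Hypothesis wp_in : forall w, eball tau0 w -> closure Theta (wp w).
Hypothesis g1_le : forall i t w, 0 <= t <= T -> eball tau0 w ->
  `|g1 i t (wp w)| <= k1 i * (Num.sqrt T)^-1 * dT1 g1 T theta i.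
Hypothesis g2_le : forall i l t w, 0 <= t <= T -> eball tau0 w ->
  `|g2 i l t (wp w)| <= k2 i l * (Num.sqrt T)^-1 * dT2 g2 T theta i l.
Hypothesis dT2_le : forall i l, dT2 g2 T theta i l <=
  kt i l * (Num.sqrt T)^-1 * (dT1 g1 T theta i * dT1 g1 T theta l).
Hypothesis Phi_le : forall i l w, eball tau0 w -> w != 0 ->
  T * (dT1 g1 T theta i) ^- 2 * (dT1 g1 T theta l) ^- 2
    * Phi g1 g2 theta T i l w * (enorm w) ^- 2 <= kh i l.

Let d i := dT1 g1 T theta i.
Let D : set (measurableTypeR R) := `[0, T]%classic.
Let sT : 0 < Num.sqrt T. Proof. by rewrite sqrtr_gt0. Qed.
Let sTT : Num.sqrt T * Num.sqrt T = T. Proof. by rewrite -expr2 sqr_sqrtr// ltW. Qed.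

Definition wscale i : R := Num.sqrt T * (dT1 g1 T theta i)^-1.
Notation c := wscale.

Let c_gt0 i : 0 < c i. Proof. by rewrite /c mulr_gt0// invr_gt0. Qed.

(** The regression function in the normed variable w. Its partial derivatives
    [wmodel1] and [wmodel2] are bounded by constants independent of T. *)
Definition wmodel t w := g t (wp w).
Definition wmodel1 i t w := c i * g1 i t (wp w).
Definition wmodel2 i l t w := c i * c l * g2 i l t (wp w).
Definition bound1 := \sum_i k1 i.
Definition bound2 := \sum_i \sum_l k2 i l * kt i l.
Definition bound3 := \sum_i \sum_l kh i l.

Let wp_line (h : R) w u : wp (w + h *: u) = wp w + h *: \row_l (c l * u 0 l).
Proof. by apply/rowP => i; rewrite !mxE /c; ring. Qed.

Let wp0 : wp 0 = theta.
Proof. by apply/rowP => i; rewrite !mxE mulr0 addr0. Qed.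

Let near_in w : enorm w < tau0 -> forall u : 'rV[R]_q, exists2 rho : R, 0 < rho &
  forall h : R, `|h| < rho -> closure Theta (wp (w + h *: u)).
Proof.
move=> wt u; have [rho rho0 H] := enorm_near u wt.
by exists rho => // h /H/ltW; exact: wp_in.
Qed.

Let closure_wp w : enorm w < tau0 -> closure Theta (wp w).
Proof. by move/ltW; exact: wp_in. Qed.

Lemma wmodel_partials t w : enorm w < tau0 -> has_partials (wmodel t) w (fun l => wmodel1 l t w).
Proof.
move=> wt; have [grad _] := cond1 t (closure_wp wt).
exact: (gradient_partials (fun h u => wp_line h w u) (near_in wt) grad).
Qed.

Lemma wmodel1_partials t w i : enorm w < tau0 ->
  has_partials (wmodel1 i t) w (fun l => wmodel2 i l t w).
Proof.
move=> wt; have [_ /(_ i) grad] := cond1 t (closure_wp wt).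
have := has_partials_scale (c i) (gradient_partials (fun h u => wp_line h w u) (near_in wt) grad).
rewrite (_ : (fun l => c i * _) = (fun l => wmodel2 i l t w))//.
by apply/funext => l; rewrite /wmodel2 mulrA.
Qed.

Lemma measurable_wmodel w : enorm w < tau0 -> measurable_fun [set: measurableTypeR R] (wmodel^~ w).
Proof.
move=> wt; apply: continuous_measurable_fun.
exact: (continuous_slice g_continuous (closure_wp wt)).
Qed.

(* The T^(-1/2) in the hypotheses is exactly what the rescaling absorbs. *)
Let cd i : c i * (Num.sqrt T)^-1 * d i = 1.
Proof. by rewrite /c /d; field; rewrite !gt_eqF. Qed.

Lemma wmodel1_le i t w : 0 <= t <= T -> enorm w < tau0 -> `|wmodel1 i t w| <= bound1.
Proof.
move=> tT wt; rewrite normrM (ger0_norm (ltW (c_gt0 i))).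
apply: (@le_trans _ _ (k1 i)); last first.
  by rewrite /bound1 (bigD1 i)//= lerDl sumr_ge0// => j _; exact: ltW.
have := ler_wpM2l (ltW (c_gt0 i)) (g1_le i tT (ltW wt)).
move/le_trans; apply; rewrite le_eqVlt; apply/orP; left; apply/eqP.
by rewrite -[RHS]mulr1 -(cd i) /d; ring.
Qed.

Lemma wmodel2_le i l t w : 0 <= t <= T -> enorm w < tau0 -> `|wmodel2 i l t w| <= bound2.
Proof.
move=> tT wt; have cc : 0 <= c i * c l by rewrite mulr_ge0// ltW.
rewrite normrM (ger0_norm cc).
apply: (@le_trans _ _ (k2 i l * kt i l)); last first.
  rewrite /bound2 (bigD1 i)//= (bigD1 l)//= -addrA lerDl.
  have kk j m : 0 <= k2 j m * kt j m by rewrite mulr_ge0// ltW.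
  by rewrite addr_ge0// sumr_ge0// => j _; rewrite sumr_ge0.
have h1 := ler_wpM2l cc (g2_le i l tT (ltW wt)); apply: (le_trans h1).
have ks : 0 <= k2 i l * (Num.sqrt T)^-1 by rewrite mulr_ge0 ?invr_ge0 ?(ltW sT)// ltW.
have h2 := ler_wpM2l cc (ler_wpM2l ks (dT2_le i l)); apply: (le_trans h2).
rewrite le_eqVlt; apply/orP; left; apply/eqP.
rewrite -[RHS]mulr1 -[X in _ = _ * X]mulr1 -{1}(cd i) -(cd l) /d; ring.
Qed.

Let bound1_ge0 : 0 <= bound1. Proof. by apply: sumr_ge0 => i _; exact: ltW. Qed.
Let bound2_ge0 : 0 <= bound2.
Proof. by apply: sumr_ge0 => i _; apply: sumr_ge0 => l _; rewrite mulr_ge0// ltW. Qed.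
Let bound3_ge0 : 0 <= bound3.
Proof. by apply: sumr_ge0 => i _; apply: sumr_ge0 => l _; exact: ltW. Qed.

Let t00 : enorm (0 : 'rV[R]_q) < tau0. Proof. by rewrite enorm0. Qed.

Lemma measurable_wmodel2 i l : measurable_fun [set: measurableTypeR R] (wmodel2 i l ^~ 0).
Proof.
exact: (@measurable_F2 R q tau0 wmodel wmodel1 wmodel2 wmodel_partials wmodel1_partials measurable_wmodel i l 0 t00).
Qed.

Lemma measurable_g2 i l : measurable_fun [set: measurableTypeR R] (g2 i l ^~ theta).
Proof.
have M := measurable_wmodel2 i l.
have -> : g2 i l ^~ theta = (fun t => (c i * c l)^-1 * wmodel2 i l t 0).
  apply/funext => t; rewrite /wmodel2 wp0 mulKf//.
  by rewrite mulf_neq0// gt_eqF.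
exact: measurable_funM.
Qed.

Variables (lam : R) (e x : R -> R).
Hypothesis lam_le : lam <= lambda_min (JT g1 theta T).
Hypothesis me : measurable_fun D e.
Hypothesis ie2 : leb.-integrable D (EFin \o (fun t => e t ^+ 2)).
Hypothesis xE : forall t, x t = g t theta + e t.

Let resE t w : wmodel t 0 + e t - wmodel t w = x t - g t (wp w).
Proof. by rewrite /wmodel wp0 xE. Qed.

(** After rescaling, the matrix of averages of products of first derivatives at
    0 is [JT]. *)
Lemma information_form (u : 'rV[R]_q) : lam * enorm u ^+ 2 <=
  \sum_(i < q) \sum_(l < q) u 0 i * u 0 l *
    average T (fun t => wmodel1 i t 0 * wmodel1 l t 0).
Proof.
have Jsym : (JT g1 theta T)^T = JT g1 theta T.
  apply/matrixP => i l; rewrite !mxE; congr (_ * _); first exact: mulrC.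
  by apply: eq_Rintegral => t _; rewrite mulrC.
have := rayleigh u Jsym lam_le.
rewrite -/(enorm u) enorm_sqr => /le_trans; apply.
rewrite le_eqVlt; apply/orP; left; apply/eqP; rewrite /bil.
apply: eq_bigr => i _; apply: eq_bigr => l _.
rewrite -mulrA [_ * u 0 l]mulrC mulrA; congr (_ * _); rewrite mxE /average.
have I := @integrable_F1F1 R q T tau0 bound1 wmodel wmodel1 wmodel_partials
  measurable_wmodel wmodel1_le i l 0 t00.
have -> : \int[leb]_(t in `[0, T]) (g1 i t theta * g1 l t theta) =
    (c i * c l)^-1 * \int[leb]_(t in `[0, T]) (wmodel1 i t 0 * wmodel1 l t 0).
  rewrite -RintegralZl//; apply: eq_Rintegral => t _; rewrite /wmodel1 wp0.
  by field; rewrite !gt_eqF.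
rewrite mulrA; congr (_ * _); rewrite /c.
have -> : T^-1 = (Num.sqrt T * Num.sqrt T)^-1 by rewrite sTT.
by field; rewrite !gt_eqF.
Qed.

Lemma wmodel2_increment i l w r : enorm w <= r -> r < tau0 ->
  average T (fun t => (wmodel2 i l t w - wmodel2 i l t 0) ^+ 2) <= bound3 * r ^+ 2.
Proof.
move=> wr rt; have wt : enorm w < tau0 by apply: le_lt_trans rt.
have [->|w0] := eqVneq w 0.
  rewrite /average (_ : (fun t => _) = fun=> 0).
    by rewrite /Rintegral integral0 mulr0 mulr_ge0// sqr_ge0.
  by apply/funext => t; rewrite subrr expr0n.
have e0 : 0 < enorm w.
  rewrite lt_neqAle enorm_ge0 andbT eq_sym; apply: contra w0 => /eqP h.
  by apply/eqP; exact: enorm_eq0.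
have I := @integrable_F2_increment R q T tau0 bound2 bound2_ge0 wmodel wmodel1 wmodel2
  wmodel_partials wmodel1_partials measurable_wmodel wmodel2_le tau0_gt0 i l w wt.
have PhiE : Phi g1 g2 theta T i l w = (c i * c l) ^- 2 *
    \int[leb]_(t in `[0, T]) ((wmodel2 i l t w - wmodel2 i l t 0) ^+ 2).
  rewrite -RintegralZl//; apply: eq_Rintegral => t _; rewrite /wmodel2 -mulrBr.
  by field; rewrite !gt_eqF.
have := Phi_le i l (ltW wt) w0; rewrite PhiE.
set A := \int[leb]_(t in _) _.
have -> : T * (dT1 g1 T theta i) ^- 2 * (dT1 g1 T theta l) ^- 2 *
   ((c i * c l) ^- 2 * A) * enorm w ^- 2 = T^-1 * A * enorm w ^- 2.
  congr (_ * _); rewrite mulrA; congr (_ * _); rewrite /c.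
  have scaleE (s t a b : R) : s * s = t -> s != 0 -> a != 0 -> b != 0 ->
      t * a ^- 2 * b ^- 2 * (s * a^-1 * (s * b^-1)) ^- 2 = t^-1.
    by move=> <- s0 a0 b0; field; rewrite s0 a0 b0.
  by apply: scaleE => //; rewrite gt_eqF.
rewrite ler_pdivrMr ?exprn_gt0// => h; rewrite /average -/A; apply: (le_trans h).
apply: ler_pM; rewrite ?sqr_ge0 ?(ltW (kh_gt0 _ _))//.
  rewrite /bound3 (bigD1 i)//= (bigD1 l)//= -addrA lerDl.
  rewrite addr_ge0// sumr_ge0// => j _; first exact: ltW.
  by rewrite sumr_ge0// => m _; exact: ltW.
by rewrite ler_pXn2r// nnegrE// ltW// (lt_le_trans e0).
Qed.

Notation crit := (criterion T wmodel e).
Notation hgrad := (half_gradient T wmodel wmodel1 e).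

(** True also when the integral is infinite: both sides are then 0. *)
Lemma fine_QT w : fine (QT g x T (wp w)) = crit w.
Proof.
rewrite /QT /criterion /average /Rintegral.
have -> : (\int[leb]_(t in `[0%R, T]) ((x t - g t (wp w)) ^+ 2)%:E =
   \int[leb]_(t in `[0%R, T]) ((wmodel t 0 + e t - wmodel t w) ^+ 2)%:E)%E.
  by apply: eq_integral => t _; rewrite resE.
have iT : 0 < T^-1 by rewrite invr_gt0.
set A := (\int[leb]_(t in _) _)%E; case: A => [a| |] //=.
  by rewrite gt0_muley ?lte_fin//= mulr0.
by rewrite gt0_muleNy ?lte_fin//= mulr0.
Qed.

Lemma QT_fin w : enorm w < tau0 -> QT g x T (wp w) \is a fin_num.
Proof.
move=> wt; have I := @integrable_residual_sqr R q T tau0 bound1 bound1_ge0 wmodel wmodel1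
  wmodel_partials measurable_wmodel wmodel1_le e me ie2 tau0_gt0 w wt.
rewrite /QT fin_numM//.
have -> : (\int[leb]_(t in `[0%R, T]) ((x t - g t (wp w)) ^+ 2)%:E =
   \int[leb]_(t in `[0%R, T]) ((wmodel t 0 + e t - wmodel t w) ^+ 2)%:E)%E.
  by apply: eq_integral => t _; rewrite resE.
by apply: integrable_fin_num.
Qed.

Lemma MTE w i : enorm w < tau0 -> MT g g1 theta x T w 0 i = hgrad i w.
Proof.
move=> wt; rewrite mxE /half_gradient /average.
have I := @integrable_gradient R q T tau0 bound1 bound1_ge0 wmodel wmodel1
  wmodel_partials measurable_wmodel wmodel1_le e me ie2 tau0_gt0 i w wt.
have -> : \int[leb]_(t in `[0, T]) ((x t - g t (wp w)) * (- g1 i t (wp w) / dT1 g1 T theta i)) =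
    (Num.sqrt T)^-1 * \int[leb]_(t in `[0, T]) ((wmodel t 0 + e t - wmodel t w) * - wmodel1 i t w).
  rewrite -RintegralZl//; apply: eq_Rintegral => t _; rewrite resE /wmodel1 /c.
  by field; rewrite !gt_eqF.
rewrite mulrA; congr (_ * _); rewrite -invfM; congr (_^-1).
exact: sTT.
Qed.

Let sum_delta (F : 'I_q -> R) i : \sum_(l < q) (delta_mx 0 i : 'rV[R]_q) 0 l * F l = F i.
Proof.
rewrite (bigD1 i)//= big1 ?addr0 => [|l li]; first by rewrite mxE !eqxx mul1r.
by rewrite mxE (negbTE li) andbF mul0r.
Qed.

Lemma MT_gradient v i : enorm v < tau0 ->
  is_derive v (delta_mx 0 i) (fun v' => 2^-1 * fine (QT g x T (wp v')))
    (MT g g1 theta x T v 0 i).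
Proof.
move=> vt; rewrite MTE//; apply: is_derive_along.
have -> : (fun h : R => 2^-1 * fine (QT g x T (wp (v + h *: delta_mx 0 i)))) =
    (fun h : R => 2^-1 * crit (v + h *: delta_mx 0 i)).
  by apply/funext => h; rewrite fine_QT.
have dc := @criterion_derive R q T tau0 bound1 bound1_ge0 wmodel wmodel1
  wmodel_partials measurable_wmodel wmodel1_le e me ie2 tau0_gt0 v (delta_mx 0 i) vt.
apply: trigger_derive; rewrite /GRing.scale/= sum_delta.
by rewrite mulrA mulVf ?mul1r.
Qed.

Variables (tauhat : 'rV[R]_q) (r0 Kn del : R).
Hypothesis tauhat_min : QT g x T tauhat = ereal_inf [set QT g x T tau | tau in closure Theta].
Notation what := (normed_estimate g1 theta T tauhat).
Hypothesis r0_gt0 : 0 < r0.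
Hypothesis r0_lt : r0 < tau0.
Hypothesis what_le : enorm what <= r0.
Hypothesis noise_energy : average T (fun t => e t ^+ 2) <= Kn.
Hypothesis noise_g2 : forall i l, `|average T (fun t => e t * wmodel2 i l t 0)| <= del.
Hypothesis small : q%:R * q%:R * hessian_error q bound1 bound2 Kn bound3 del r0 < lam.

Let wp_what : wp what = tauhat.
Proof.
apply/rowP => i; rewrite !mxE -!/(d i).
by rewrite /d; field; rewrite !gt_eqF.
Qed.

(** The estimate minimizes the criterion over the closure of the parameter set;
    being in the open ball, in the normed variable it is an interior local
    minimum along each coordinate direction. *)
Lemma MT_what : MT g g1 theta x T what = 0.
Proof.
have wt : enorm what < tau0 by apply: le_lt_trans r0_lt.
apply/rowP => i; rewrite MTE// mxE.
have [rho rho0 Hrho] := enorm_near (delta_mx 0 i) wt.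
pose phi (h : R) := crit (what + h *: delta_mx 0 i).
have Hr (h : R) : h \in `]-rho, rho[ -> enorm (what + h *: delta_mx 0 i) < tau0.
  by rewrite in_itv/= -ltr_norml; exact: Hrho.
have dphi (h : R) : h \in `]-rho, rho[ -> derivable (phi : R^o -> R^o) h 1.
  move=> /Hr ht.
  have P : has_partials crit (what + h *: delta_mx 0 i) (fun l => 2 * hgrad l (what + h *: delta_mx 0 i)).
    move=> u; have := @criterion_derive R q T tau0 bound1 bound1_ge0 wmodel wmodel1
      wmodel_partials measurable_wmodel wmodel1_le e me ie2 tau0_gt0 _ u ht.
    rewrite mulr_sumr; congr is_derive; apply: eq_bigr => l _; ring.
  by have := has_partials_line P; case.
have r2 : -rho <= rho by lra.
have z_in : 0 \in `]-rho, rho[ by rewrite in_itv/= oppr_lt0 rho0.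
have mn (h : R) : h \in `]-rho, rho[ -> phi 0 <= phi h.
  move=> /Hr ht; rewrite /phi scale0r addr0 -!fine_QT fine_le ?QT_fin//.
  rewrite wp_what tauhat_min; apply: ereal_inf_lbound.
  by exists (wp (what + h *: delta_mx 0 i)) => //; apply: closure_wp.
have d0 := derive1_at_min r2 dphi z_in mn.
have d1 := @criterion_derive R q T tau0 bound1 bound1_ge0 wmodel wmodel1
  wmodel_partials measurable_wmodel wmodel1_le e me ie2 tau0_gt0 _ (delta_mx 0 i) wt.
have : 2 * hgrad i what = 0.
  rewrite -(sum_delta (fun l => hgrad l what) i).
  by rewrite -[LHS](@derive_val _ _ _ _ _ _ _ d1) (@derive_val _ _ _ _ _ _ _ d0).
by move=> /eqP; rewrite mulf_eq0 pnatr_eq0/= => /eqP.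
Qed.

Theorem sample_unique : forall v, eball r0 v -> MT g g1 theta x T v = 0 -> v = what.
Proof.
move=> v vr Mv.
apply: (@half_gradient_unique R q T tau0 bound1 bound2 T0 bound1_ge0 bound2_ge0
  wmodel wmodel1 wmodel2 wmodel_partials wmodel1_partials measurable_wmodel
  wmodel1_le wmodel2_le e me ie2 tau0_gt0 lam Kn bound3 del r0) => //.
- by move=> i l w wr; exact: wmodel2_increment.
- exact: information_form.
- by move=> i; rewrite -MTE ?Mv ?mxE//; exact: le_lt_trans r0_lt.
- by move=> i; rewrite -MTE ?MT_what ?mxE//; exact: le_lt_trans r0_lt.
Qed.

End Sample.

(** * The noise *)

Lemma limf_einf_gt0 (R : realType) (f : R -> \bar R) (F : set_system R) {FF : Filter F} :
  (0 < limf_einf f F)%E -> F [set x | (0 < f x)%E].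
Proof.
rewrite limf_einfE => /ereal_sup_gt[_ [V FV <-] V0].
apply: filterS FV => x Vx /=; apply: lt_le_trans V0 _.
by apply: ereal_inf_lbound; exists x.
Qed.

Section Noise.
Context d (Omega : measurableType d) (R : realType) (P : probability Omega R).
Notation leb := (@lebesgue_measure R).
Variables (xi : R -> Omega -> R) (G : R -> R).
Hypothesis xi_measurable : measurable_process xi.
Hypothesis G_measurable : measurable_fun [set: R] G.
Hypothesis G_mean : ('E_P[fun w => G (xi 0%R w)] = 0)%E.
Hypothesis G_moment4 : ('E_P[fun w => (G (xi 0%R w) ^+ 4)%R] < +oo)%E.
Hypothesis xi_lln : forall H : R -> R, measurable_fun [set: measurableTypeR R] H ->
  P.-integrable [set: _] (EFin \o (fun w => H (xi 0 w))) -> lln P xi H.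

Lemma measurable_noise w : measurable_fun [set: measurableTypeR R] (fun t => G (xi t w)).
Proof.
apply: (measurableT_comp (f := G)) => //.
have := measurableT_comp xi_measurable (pair2_measurable w); exact.
Qed.

Let mG0 : measurable_fun [set: Omega] (fun w => G (xi 0 w)).
Proof.
by apply: (measurableT_comp (f := G)) => //; exact: measurable_process_section.
Qed.

Let icst (r : R) : P.-integrable [set: _] (EFin \o (fun=> r)).
Proof. exact: finite_measure_integrable_cst. Qed.

Let iG4 : P.-integrable [set: _] (EFin \o (fun w => 1 + G (xi 0 w) ^+ 4)).
Proof.
apply: integrableDr => //; apply/integrableP; split.
  by apply/measurable_EFinP; exact: measurable_funX.
move: G_moment4; rewrite expectation.unlock.
under [in X in _ -> X]eq_integral => w _.
  rewrite /= ger0_norm; first over.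
  by rewrite exprn_even_ge0.
by [].
Qed.

Let iG2 : P.-integrable [set: _] (EFin \o (fun w => G (xi 0 w) ^+ 2)).
Proof.
apply: (integrable_dom _ _ iG4) => //; first exact: measurable_funX.
move=> w _; rewrite ger0_norm ?sqr_ge0//; set y := G _.
have -> : y ^+ 4 = (y ^+ 2) ^+ 2 by ring.
by have := sqr_ge0 (y ^+ 2 - 1); nra.
Qed.

Let iG : P.-integrable [set: _] (EFin \o (fun w => G (xi 0 w))).
Proof.
apply: (integrable_dom _ _ (integrableDr _ (icst 1) iG2)) => //.
move=> w _; set y := G _; rewrite ler_norml; apply/andP; split; nra.
Qed.

Definition noise_variance := \int[P]_w (G (xi 0 w) ^+ 2).

Lemma noise_variance_ge0 : 0 <= noise_variance.
Proof. by apply: Rintegral_ge0 => w _; exact: sqr_ge0. Qed.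

(** The law of large numbers for G^2 with constant weight. *)
Lemma noise_energy_likely : likely P (fun T => [set w |
  leb.-integrable `[0, T]%classic (EFin \o (fun t => G (xi t w) ^+ 2)) /\
  average T (fun t => G (xi t w) ^+ 2) <= noise_variance + 1]).
Proof.
have mG2 : measurable_fun [set: measurableTypeR R] (fun x => G x ^+ 2) by exact: measurable_funX.
have [_ _ L] := xi_lln mG2 iG2.
have a1 (T t : R) : `|(fun=> fun=> 1) T t| <= 1 :> R by rewrite normr1.
have := L (fun=> fun=> 1) (fun=> measurable_cst _) a1 1 ltr01; apply: likely_sub.
near=> T => w /= [iw h]; split => //; have T0 : 0 < T by [].
rewrite -lerBlDl; apply: le_trans h; apply: le_trans (ler_norm _).
pose D : set (measurableTypeR R) := `[0, T]%classic.
have lebD : leb D = T%:E by rewrite lebesgue_measure_itv/= lte_fin T0 oppr0 adde0.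
have ic : leb.-integrable D (EFin \o (fun=> noise_variance)).
  apply: measurable_bounded_integrable => //; last exact: bounded_cst.
  exact: measurable_itv.
  by rewrite [X in (X < _)%E]lebD ltry.
rewrite (_ : \int[leb]_(t in `[0, T]) _ =
  \int[leb]_(t in D) (G (xi t w) ^+ 2 - noise_variance)); last first.
  by apply: eq_Rintegral => t _; rewrite mul1r.
rewrite RintegralB//; last exact: measurable_itv.
rewrite mulrBr lerD2l lerN2.
rewrite Rintegral_cst//; last exact: measurable_itv.
rewrite (_ : fine _ = T); last by exact: (congr1 fine lebD).
by rewrite mulrCA mulVf ?mulr1// gt_eqF.
Unshelve. all: by end_near. Qed.

(* The weights [h] are bounded on [0, T] only; clipping turns them into weights
   bounded for all times. *)
Definition clip (x : R) : R := Num.max (-1) (Num.min 1 x).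

Let clip_le1 x : `|clip x| <= 1.
Proof.
have N1 : -1 <= 1 :> R by lra.
by rewrite ler_norml /clip le_max lexx ge_max ge_min lexx N1.
Qed.

Let clip_id x : `|x| <= 1 -> clip x = x.
Proof. by rewrite ler_norml /clip => /andP[x0 x1]; rewrite min_r// max_r. Qed.

(** The law of large numbers for G, whose mean is zero. *)
Lemma noise_average_likely (h : R -> R -> R) (K del : R) :
  (forall T, measurable_fun [set: R] (h T)) ->
  0 <= K -> (\forall T \near +oo%R, forall t, 0 <= t <= T -> `|h T t| <= K) -> 0 < del ->
  likely P (fun T => [set w | `|average T (fun t => G (xi t w) * h T t)| <= del]).
Proof.
move=> mh K0 hK del0; have K1 : 0 < K + 1 by rewrite ltr_wpDl.
have mG : measurable_fun [set: measurableTypeR R] G by [].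
have [_ _ L] := xi_lln mG iG.
have ma T : measurable_fun [set: R] (fun t => clip ((K + 1)^-1 * h T t)).
  apply: measurable_maxr => //; apply: measurable_minr => //.
  exact: measurable_funM.
have := L _ ma (fun T t => clip_le1 _) (del / (K + 1)) (divr_gt0 del0 K1).
apply: likely_sub; near=> T => w /= [iw].
have T0 : 0 < T by [].
have hT : forall t, 0 <= t <= T -> `|h T t| <= K by near: T; exact: hK.
have -> : \int[P]_w G (xi 0 w) = 0.
  by move: G_mean; rewrite expectation.unlock /Rintegral => ->.
rewrite ler_pdivlMr// -[X in _ * X <= _](gtr0_norm K1) -normrM; congr (`|_| <= _).
rewrite -mulrA /average; congr (_ * _).
pose D : set (measurableTypeR R) := `[0, T]%classic.
have mD : measurable D by exact: measurable_itv.
have ic : leb.-integrable D (EFin \o (fun t => clip ((K + 1)^-1 * h T t) * (G (xi t w) - 0))).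
  apply: (integrable_dom _ _ (integrable_norm iw)) => //.
    apply: measurable_funM; first exact: (measurable_funTS (ma T)).
    by apply: measurable_funB => //; exact: integrable_measurable iw.
  by move=> t _; rewrite subr0 normrM/= ler_piMl.
rewrite [LHS]mulrC -[LHS](RintegralZl (K + 1) mD ic).
apply: eq_Rintegral => t /set_mem; rewrite /D/= in_itv/= => tT.
rewrite subr0 clip_id; first by field; rewrite gt_eqF.
rewrite normrM gtr0_norm ?invr_gt0// ler_pdivrMl// mulr1.
by apply: (le_trans (hT t tT)); rewrite lerDl.
Unshelve. all: by end_near. Qed.

End Noise.

(** * From sample paths to probabilities *)

(** The radius is chosen after the bounds on the derivatives and on the noise
    energy, none of which depends on T. *)
Lemma hessian_error_small (R : realType) (q : nat) (K1 K2 Kn K3 lam tau0 : R) :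
  0 <= K1 -> 0 <= K2 -> 0 <= Kn -> 0 <= K3 -> 0 < lam -> 0 < tau0 ->
  exists r0 del : R, [/\ 0 < r0, r0 < tau0, 0 < del &
    q%:R * q%:R * hessian_error q K1 K2 Kn K3 del r0 < lam].
Proof.
move=> K10 K20 Kn0 K30 lam0 tau00.
pose c : R := q%:R * q%:R + 1; pose L := 3 * q%:R * K1 * K2 + (Kn + K3) / 2 + 1.
have c0 : 0 < c by rewrite ltr_wpDl// mulr_ge0.
have L0 : 0 < L by rewrite ltr_wpDl// addr_ge0 ?divr_ge0 ?addr_ge0// !mulr_ge0.
pose del := lam / (4 * c).
have del0 : 0 < del by rewrite divr_gt0 ?mulr_gt0.
exists (Num.min (tau0 / 2) (del / L)), del; set r0 := Num.min _ _.
have r00 : 0 < r0 by rewrite lt_min; apply/andP; split; apply: divr_gt0.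
have rt : r0 <= tau0 / 2 by rewrite ge_min lexx.
have rL : r0 * L <= del by rewrite -ler_pdivlMr// ge_min lexx orbT.
split => //; first lra.
have E : hessian_error q K1 K2 Kn K3 del r0 = r0 * L - r0 + del.
  by rewrite /hessian_error /L; field.
have {}E : hessian_error q K1 K2 Kn K3 del r0 <= 2 * del by rewrite E; lra.
have c1 : q%:R * q%:R <= c by rewrite lerDl.
apply: (@le_lt_trans _ _ (q%:R * q%:R * (2 * del))); first by rewrite ler_wpM2l// mulr_ge0.
apply: (@le_lt_trans _ _ (c * (2 * del))); first by rewrite ler_wpM2r// mulr_ge0// ltW.
have -> : c * (2 * del) = lam / 2 by rewrite /del; field; rewrite gt_eqF.
by lra.
Qed.

Lemma likely_setC (d : measure_display) (Omega : measurableType d) (R : realType) (P : probability Omega R)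
    (E : R -> set Omega) :
  (\forall T \near +oo%R, measurable (E T)) -> P (E T) @[T --> +oo%R] --> 0%E ->
  likely P (fun T => ~` E T).
Proof.
move=> mE PE eta eta0.
have Eeta : \forall T \near +oo%R, (P (E T) < eta%:E)%E.
  exact: cvge0_lt PE eta0.
apply: filterS2 mE Eeta => T mE Eeta; exists (~` E T); split => //; first exact: measurableC.
rewrite probability_setC//; move: Eeta.
have -> : P (E T) = (fine (P (E T)))%:E by rewrite fineK// fin_num_measure.
by rewrite -[1%E]/(1%:E) -EFinB lte_fin lee_fin lerD2l lerN2 => /ltW.
Qed.

Lemma measurable_enorm (d : measure_display) (Omega : measurableType d) (R : realType) (q : nat)
    (X : Omega -> 'rV[R]_q) : random_vector X ->
  measurable_fun [set: Omega] (fun w => enorm (X w)).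
Proof.
move=> mX; apply: measurableT_comp.
  by apply: continuous_measurable_fun => x; exact: sqrt_continuous.
by apply: measurable_sum => i; exact: measurable_funX.
Qed.

Unset Implicit Arguments.
Set Strict Implicit.
Set Printing Implicit Defensive.

Theorem theorem3 (d : measure_display) (Omega : measurableType d)
  (R : realType) (P : probability Omega R)
  (* the Gaussian process *)
  (xi : R -> Omega -> R)
  (kappa : nat) (D vk alpha : 'I_kappa.+1 -> R)
  (xi_measurable : measurable_process xi)
  (xi_ms_continuous : ms_continuous P xi)
  (xi_stationary : stationary_process P xi)
  (xi_gaussian : gaussian_process P xi)
  (xi_mean : forall t, ('E_P[xi t] = 0)%E)
  (xi_var : forall t, ('E_P[fun w => (xi t w ^+ 2)%R] = 1)%E)
  (xi_cov : forall t,
     ('E_P[fun w => (xi 0%R w * xi t w)%R] = (cyclic_covariance D vk alpha t)%:E)%E)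
  (D_ge0 : forall j, 0 <= D j)
  (D_sum : \sum_(j < kappa.+1) D j = 1)
  (vk_ge0 : 0 <= vk ord0)
  (vk_incr : forall j k : 'I_kappa.+1, (j < k)%N -> vk j < vk k)
  (alpha_gt0 : forall j, 0 < alpha j)
  (* the noise *)
  (G : R -> R) (m : nat)
  (G_measurable : measurable_fun [set: R] G)
  (G_mean : ('E_P[fun w => G (xi 0%R w)] = 0)%E)
  (G_moment4 : ('E_P[fun w => (G (xi 0%R w) ^+ 4)%R] < +oo)%E)
  (m_ge1 : (1 <= m)%N)
  (G_rank : hermite_rank G m)
  (* the regression model *)
  (q : nat) (q_gt0 : (0 < q)%N)
  (Theta : set 'rV[R]_q) (Theta_open : open Theta)
  (theta : 'rV[R]_q) (theta_in : Theta theta)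
  (g : R -> 'rV[R]_q -> R)
  (g1 : 'I_q -> R -> 'rV[R]_q -> R)
  (g2 : 'I_q -> 'I_q -> R -> 'rV[R]_q -> R)
  (g_continuous : {within [set: R] `*` closure Theta,
     continuous (fun p : R * 'rV[R]_q => g p.1 p.2)})
  (x : R -> Omega -> R)
  (x_model : forall t w, x t w = g t theta + G (xi t w))
  (theta_hat : R -> Omega -> 'rV[R]_q)
  (theta_hat_lse : least_squares_estimate g Theta x theta_hat)
  (* (1) *)
  (cond1 : forall t, twice_differentiable_on (closure Theta) (g t)
     (fun i => g1 i t) (fun i l => g2 i l t))
  (* (2) *)
  (cond2 : forall i,
     (0 < limf_einf (fun T : R => (T^-1 * (dT1 g1 T theta i) ^+ 2)%:E) +oo%R)%E)
  (* (3) *)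
  (cond3 : forall r : R, 0 <= r ->
     exists (k1 : 'I_q -> R) (k2 kt : 'I_q -> 'I_q -> R),
       [/\ forall i, 0 < k1 i,
           forall i l, 0 < k2 i l,
           forall i l, 0 < kt i l &
           \forall T \near +oo%R,
             [/\ forall u, eball r u -> closure Theta (upoint g1 theta T u),
                 forall i t u, 0 <= t <= T -> eball r u ->
                   `|g1 i t (upoint g1 theta T u)|
                     <= k1 i * (Num.sqrt T)^-1 * dT1 g1 T theta i,
                 forall i l t u, 0 <= t <= T -> eball r u ->
                   `|g2 i l t (upoint g1 theta T u)|
                     <= k2 i l * (Num.sqrt T)^-1 * dT2 g2 T theta i l &
                 forall i l, dT2 g2 T theta i l
                   <= kt i l * (Num.sqrt T)^-1
                      * (dT1 g1 T theta i * dT1 g1 T theta l)]])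
  (* (4) *)
  (lambda : R) (lambda_gt0 : 0 < lambda)
  (cond4 : \forall T \near +oo%R, lambda <= lambda_min (JT g1 theta T))
  (* (5) *)
  (tau0 : R) (tau0_gt0 : 0 < tau0)
  (cond5 : exists (k1 : 'I_q -> R) (k2 kh : 'I_q -> 'I_q -> R),
       [/\ forall i, 0 < k1 i,
           forall i l, 0 < k2 i l,
           forall i l, 0 < kh i l &
           \forall T \near +oo%R,
             [/\ forall w, eball tau0 w -> closure Theta (wpoint g1 theta T w),
                 forall i t w, 0 <= t <= T -> eball tau0 w ->
                   `|g1 i t (wpoint g1 theta T w)|
                     <= k1 i * (Num.sqrt T)^-1 * dT1 g1 T theta i,
                 forall i l t w, 0 <= t <= T -> eball tau0 w ->
                   `|g2 i l t (wpoint g1 theta T w)|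
                     <= k2 i l * (Num.sqrt T)^-1 * dT2 g2 T theta i l &
                 forall i l w, eball tau0 w -> w != 0 ->
                   T * (dT1 g1 T theta i) ^- 2 * (dT1 g1 T theta l) ^- 2
                     * Phi g1 g2 theta T i l w * (enorm w) ^- 2
                   <= kh i l]])
  (* (6) *)
  (cond6 : forall r : R, 0 < r ->
     P [set w | r < enorm (normed_estimate g1 theta T (theta_hat T w))]
       @[T --> +oo%R] --> 0%E) :
  exists r0 : R, [/\ 0 < r0, r0 <= tau0 &
    with_probability_tending_to_1 P (fun T => [set om |
      let what := normed_estimate g1 theta T (theta_hat T om) in
      let M := MT g g1 theta (x^~ om) T in
      [/\ (* M is the gradient of half the normed least-squares criterion *)
          forall (v : 'rV[R]_q) (i : 'I_q), eball r0 v ->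
            is_derive v (delta_mx 0 i)
              (fun v' => 2^-1 * fine (QT g (x^~ om) T (wpoint g1 theta T v')))
              (M v 0 i),
          (* what solves M w = 0 ... *)
          eball r0 what /\ M what = 0 &
          (* ... and is the only solution *)
          forall v : 'rV[R]_q, eball r0 v -> M v = 0 -> v = what]])].
Proof.
(* The bound on the ratios of the norms does not involve u, so radius 0 will do. *)
have [k1' [k2' [kt [_ _ kt0 H3]]]] := cond3 0 (lexx 0).
have [k1 [k2 [kh [k10 k20 kh0 H5]]]] := cond5.
have LLN := lln_integrable xi_measurable xi_stationary xi_gaussian xi_mean xi_var xi_cov
  (fun e => cyclic_covariance_decay vk D_ge0 D_sum alpha_gt0 (e := e)).
have eventually_gt (M : R) : \forall T \near +oo%R, M < T.
  by apply: nbhs_pinfty_gt; exact: num_real.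
have [Md d_gt0] : exists M : R, forall T, M < T -> forall i, 0 < dT1 g1 T theta i.
  suff : \forall T \near +oo%R, forall i, 0 < dT1 g1 T theta i.
    by case=> M [_ HM]; exists M.
  apply: filter_forall => i; have [M [Mreal HM]] := limf_einf_gt0 (cond2 i).
  exists M; split => // T /HM/=; rewrite lte_fin => h.
  rewrite lt_neqAle sqrtr_ge0 andbT eq_sym.
  by apply/eqP => d0; move: h; rewrite d0 expr0n/= mulr0 ltxx.
have [M3 [_ {}H3]] := H3; have [M4 [_ H4]] := cond4; have [M5 [_ {}H5]] := H5.
have wp0 T : wpoint g1 theta T 0 = theta.
  by apply/rowP => i; rewrite !mxE mulr0 addr0.
(* Any single T gives the measurability in time of the second derivatives. *)
have mg2 i l : measurable_fun [set: measurableTypeR R] (g2 i l ^~ theta).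
  have [T [T0 Td T5]] : exists T : R, [/\ 0 < T, Md < T & M5 < T].
    exists (Num.max 0 (Num.max Md M5) + 1).
    by split; rewrite ltr_pwDr// !le_max lexx ?orbT.
  have [wp_in _ _ _] := H5 T T5.
  exact: (measurable_g2 g_continuous cond1 T0 tau0_gt0 (d_gt0 T Td) wp_in).
have K1_ge0 : 0 <= bound1 k1 by apply: sumr_ge0 => i _; exact: ltW.
have K2_ge0 : 0 <= bound2 k2 kt.
  by apply: sumr_ge0 => i _; apply: sumr_ge0 => l _; rewrite mulr_ge0// ltW.
have K3_ge0 : 0 <= bound3 kh by apply: sumr_ge0 => i _; apply: sumr_ge0 => l _; exact: ltW.
have Kn_ge0 : 0 <= noise_variance P xi G + 1 by rewrite addr_ge0// noise_variance_ge0.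
have [r0 [del [r0_gt0 r0_lt del_gt0 small]]] :=
  hessian_error_small q K1_ge0 K2_ge0 Kn_ge0 K3_ge0 lambda_gt0 tau0_gt0.
exists r0; split => //; first exact: ltW.
have energy := noise_energy_likely xi_measurable G_measurable G_moment4 LLN.
have cross i l : likely P (fun T => [set om |
    `|average T (fun t => G (xi t om) * wmodel2 g1 g2 theta T i l t 0)| <= del]).
  apply: (noise_average_likely xi_measurable G_measurable G_mean G_moment4 LLN
    (h := fun T t => wmodel2 g1 g2 theta T i l t 0) _ K2_ge0) => //.
    move=> T; rewrite /wmodel2 wp0; apply: measurable_funM => //; exact: mg2.
  near=> T; have T0 : 0 < T by near: T; exact: eventually_gt.
  have Td : Md < T by near: T; exact: eventually_gt.
  have T3 : M3 < T by near: T; exact: eventually_gt.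
  have T5 : M5 < T by near: T; exact: eventually_gt.
  have dT := d_gt0 T Td; have [_ _ _ dT2_le] := H3 T T3.
  have [_ _ g2_le _] := H5 T T5 => t tT.
  by apply: (wmodel2_le T0 dT k20 kt0 g2_le dT2_le) => //; rewrite enorm0.
have small_estimate : likely P (fun T => [set om |
    enorm (normed_estimate g1 theta T (theta_hat T om)) <= r0]).
  have me : \forall T \near +oo%R, measurable [set om |
      r0 < enorm (normed_estimate g1 theta T (theta_hat T om))].
    near=> T; have T0 : 0 < T by near: T; exact: eventually_gt.
    have [mhat _] := theta_hat_lse T T0.
    have mw : random_vector (fun om => normed_estimate g1 theta T (theta_hat T om)).
      move=> i; under eq_fun do rewrite mxE.
      by apply: measurable_funM => //; apply: measurable_funB => //; exact: mhat.
    have := measurable_enorm mw measurableT (measurable_itv `]r0, +oo[).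
    by rewrite setTI; congr measurable; apply/seteqP; split => om /=; rewrite in_itv/= andbT.
  have := likely_setC me (cond6 r0 r0_gt0); apply: likely_sub.
  by apply: nearW => T om /= /negP; rewrite -leNgt.
apply: likely_wp1.
have := likelyI (likelyI small_estimate energy)
  (likely_forall (fun i => likely_forall (cross i))).
apply: likely_sub; near=> T; have T0 : 0 < T by near: T; exact: eventually_gt.
have Td : Md < T by near: T; exact: eventually_gt.
have T3 : M3 < T by near: T; exact: eventually_gt.
have T4 : M4 < T by near: T; exact: eventually_gt.
have T5 : M5 < T by near: T; exact: eventually_gt.
have dT := d_gt0 T Td; have lam_le := H4 T T4; have [_ _ _ dT2_le] := H3 T T3.
have [wp_in g1_le g2_le Phi_le] := H5 T T5.
move=> om /= [[what_le [ie2 noise_energy]] noise_g2].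
have me : measurable_fun `[0, T]%classic (fun t => G (xi t om)).
  exact: (measurable_funTS (measurable_noise xi_measurable G_measurable om)).
have xE t : (x^~ om) t = g t theta + G (xi t om) by exact: x_model.
have [_ /(_ om)[_ hat_min]] := theta_hat_lse T T0.
split.
- move=> v i vr; have vt : enorm v < tau0 by exact: le_lt_trans r0_lt.
  exact: (MT_gradient g_continuous cond1 T0 tau0_gt0 dT k10 wp_in g1_le me ie2 xE i vt).
- split => //.
  exact: (MT_what g_continuous cond1 T0 tau0_gt0 dT k10 wp_in g1_le me ie2 xE hat_min r0_lt what_le).
- move=> v; exact: (sample_unique g_continuous cond1 T0 tau0_gt0 dT k10 k20 kt0 kh0 wp_in g1_le
    g2_le dT2_le Phi_le lam_le me ie2 xE hat_min r0_gt0 r0_lt what_le noise_energy noise_g2 small).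
Unshelve. all: by end_near. Qed.
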